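(* Let $K\in\mathbb R$. If $K\in[K_c^-,K_c^+]$, then the spectrum of $T$ consists of the continuous spectrum, lying on the imaginary axis, and possibly one or more negative eigenvalues. Otherwise (if $K\notin[K_c^-,K_c^+]$) there is at least one positive eigenvalue of $T$.
   Context: $I=[0,1]$, $X=\mathbb R\times I$. $g$ is a probability density on $\mathbb R$ that is continuous, even, and monotonically decreasing on $\mathbb R^+$. $W:I^2\to\mathbb R$ is symmetric and Lipschitz continuous. For the coupling strength $K\in\mathbb R$, $T$ is the linear operator on the (complex) weighted space $L^2(X,g\,d\omega\,dx)$, $$T[Z](\omega,x)=i\omega Z(\omega,x)+\frac K2\mathcal P[Z](x),\qquad \mathcal P[Z](x)=\int_I\int_{\mathbb R}W(x,y)Z(\lambda,y)g(\lambda)\,d\lambda\,dy,$$ with its natural domain $\{Z:\ \omega Z\in L^2(X,g\,d\omega\,dx)\}$. $\mathcal W:L^2(I)\to L^2(I)$ is the self-adjoint compact operator $\mathcal W[f](x)=\int_IW(x,y)f(y)\,dy$, and $\sigma_p(\mathcal W)$ is its set of eigenvalues. Let $\xi_{max}(\mathcal W)=\max\{\zeta:\zeta\in\sigma_p(\mathcal W)\cap\mathbb R^+\}$ if $\sigma_p(\mathcal W)$ contains a positive number, and $\xi_{max}(\mathcal W)=0+0$ otherwise; let $\xi_{min}(\mathcal W)=\min\{\zeta:\zeta\in\sigma_p(\mathcal W)\cap\mathbb R^-\}$ if $\sigma_p(\mathcal W)$ contains a negative number, and $\xi_{min}(\mathcal W)=0-0$ otherwise ($\mathbb R^\pm$ denote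 the positive/negative reals). Set $$K_c^+=\frac{2}{\pi g(0)\,\xi_{max}(\mathcal W)},\qquad K_c^-=\frac{2}{\pi g(0)\,\xi_{min}(\mathcal W)},$$ with the convention $K_c^+=+\infty$ when $\xi_{max}(\mathcal W)=0+0$ and $K_c^-=-\infty$ when $\xi_{min}(\mathcal W)=0-0$. *)

(* Defs.v *)
From HB Require Import structures.
From mathcomp Require Import all_boot all_order all_algebra.
From mathcomp Require Import complex.
From mathcomp Require Import all_classical all_reals all_analysis.

Set Implicit Arguments.
Unset Strict Implicit.
Unset Printing Implicit Defensive.

Import Order.TTheory GRing.Theory Num.Theory.
Import numFieldNormedType.Exports.

Local Open Scope classical_set_scope.
Local Open Scope ring_scope.

Section complex_L2.
Context d (X : measurableType d) (R : realType).
Variables (mu : {measure set X -> \bar R}) (D : set X).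

Definition cintegral (f : X -> R[i]) : R[i] :=
  (\int[mu]_(x in D) complex.Re (f x) +i* \int[mu]_(x in D) complex.Im (f x))%C.

Definition csqr_norm (z : R[i]) : R := complex.Re z ^+ 2 + complex.Im z ^+ 2.

(* L^2(D, r dmu) for a weight r >= 0, as a set of functions. They are not
   quotiented: f and h are the same vector when L2norm r (f - h) = 0, that is,
   when they agree r dmu-almost everywhere on D. *)
Definition L2 (r : X -> R) : set (X -> R[i]) := [set f |
  [/\ measurable_fun D (fun x => complex.Re (f x)),
      measurable_fun D (fun x => complex.Im (f x)) &
      (\int[mu]_(x in D) (csqr_norm (f x) * r x)%:E < +oo)%E]].

Definition L2norm (r : X -> R) (f : X -> R[i]) : R :=
  Num.sqrt (\int[mu]_(x in D) (csqr_norm (f x) * r x)).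

End complex_L2.

(* A possibly unbounded linear operator on the normed space obtained from
   op_space by identifying f and h when op_norm (f - h) = 0. *)
Record operator (R : realType) (X : Type) := Operator {
  op_space : set (X -> R[i]);
  op_norm : (X -> R[i]) -> R;
  op_dom : set (X -> R[i]);
  op_act : (X -> R[i]) -> (X -> R[i]) }.

Section spectrum.
Context (R : realType) (X : Type).
Variable A : operator R X.

Definition op_shift (l : R[i]) (Z : X -> R[i]) : X -> R[i] :=
  fun x => op_act A Z x - l * Z x.

Definition op_surjective (l : R[i]) : Prop := forall f, op_space A f ->
  exists2 Z, op_dom A Z & op_norm A (fun x => f x - op_shift l Z x) = 0.

Definition op_dense_range (l : R[i]) : Prop :=
  forall f, op_space A f -> forall e : R, 0 < e ->
  exists2 Z, op_dom A Z & op_norm A (fun x => f x - op_shift l Z x) < e.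

(* This bound forces op_shift l to be injective on classes. *)
Definition op_bounded_inverse (l : R[i]) : Prop :=
  exists C : R, forall Z, op_dom A Z ->
    op_norm A Z <= C * op_norm A (op_shift l Z).

Definition resolvent_set : set R[i] :=
  [set l | op_surjective l /\ op_bounded_inverse l].

Definition spectrum : set R[i] := ~` resolvent_set.

Definition point_spectrum : set R[i] := [set l |
  exists Z, [/\ op_dom A Z, op_norm A Z != 0 & op_norm A (op_shift l Z) = 0]].

Definition continuous_spectrum : set R[i] :=
  [set l | [/\ spectrum l, ~ point_spectrum l & op_dense_range l]].

End spectrum.

Section kuramoto.
Context (R : realType).
Variables (g : R -> R) (W : R -> R -> R).

Local Notation leb := (@lebesgue_measure R).
Local Notation leb2 := (@lebesgue_measure R \x @lebesgue_measure R)%E.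

Definition unitI : set R := `[0, 1].

Definition graphon_op : operator R R := {|
  op_space := L2 leb unitI (cst 1);
  op_norm := L2norm leb unitI (cst 1);
  op_dom := L2 leb unitI (cst 1);
  op_act := fun f x => cintegral leb unitI (fun y => (W x y)%:C%C * f y) |}.

Definition stripX : set (R * R) := setT `*` unitI.

Definition L2X : set (R * R -> R[i]) :=
  L2 leb2 stripX (fun p => g p.1).

Definition L2X_norm : (R * R -> R[i]) -> R :=
  L2norm leb2 stripX (fun p => g p.1).

Definition calP (Z : R * R -> R[i]) (x : R) : R[i] :=
  cintegral leb unitI (fun y => cintegral leb setT
    (fun l => (W x y)%:C%C * Z (l, y) * (g l)%:C%C)).

Definition kuramoto_op (K : R) : operator R (R * R) := {|
  op_space := L2X;
  op_norm := L2X_norm;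
  op_dom := [set Z | L2X Z /\ L2X (fun p => p.1%:C%C * Z p)];
  op_act := fun Z p =>
    'i%C * p.1%:C%C * Z p + (K / 2)%:C%C * calP Z p.2 |}.

Definition pos_eigenvalues : set R :=
  [set z | 0 < z /\ point_spectrum graphon_op z%:C%C].

Definition neg_eigenvalues : set R :=
  [set z | z < 0 /\ point_spectrum graphon_op z%:C%C].

(* The maximum (resp. minimum) of the set, which exists when the set is
   nonempty since graphon_op is compact; 0 when the set is empty. *)
Definition xi_max : R := xget 0 (pos_eigenvalues `&` ubound pos_eigenvalues).

Definition xi_min : R := xget 0 (neg_eigenvalues `&` lbound neg_eigenvalues).

Definition Kc_plus : \bar R :=
  if pselect (pos_eigenvalues !=set0)
  then (2 / (pi * g 0 * xi_max))%:E else +oo%E.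

Definition Kc_minus : \bar R :=
  if pselect (neg_eigenvalues !=set0)
  then (2 / (pi * g 0 * xi_min))%:E else -oo%E.

End kuramoto.

(* Main.v *)
Require Import Defs.
From HB Require Import structures.
From mathcomp Require Import all_boot all_order all_algebra.
From mathcomp Require Import complex.
From mathcomp Require Import all_classical all_reals all_analysis.
From mathcomp Require Import measurable_realfun ring lra.

Set Implicit Arguments.
Unset Strict Implicit.
Unset Printing Implicit Defensive.

Import Order.TTheory GRing.Theory Num.Theory.
Import numFieldNormedType.Exports.

Local Open Scope classical_set_scope.
Local Open Scope ring_scope.

(** Put [m w = 1 / (l - i w)], [c = (K / 2) int m g] and [p = P Z].  The equation
[(T - l) Z = F] reads [Z = m(w) ((K / 2) p(y) - F)], and applying [P] to it
leaves an equation of the second kind on the unit interval,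
[p = c W p - P (m F)].  Both halves of the theorem are statements about [c].

Eigenvalues.  [l] is an eigenvalue when [p = c W p] has a nonzero solution and
[m p] is square integrable.  The operator [W] is symmetric, so [c] is then real
and [1 / c] is a nonzero eigenvalue of [W] ([ckop_keig]).  A reflection argument
that uses the monotonicity of [g] shows that [c] is not real when
[Re l != 0] and [Im l != 0] ([wint_res_im_neq0]), and the real part of [c]
vanishes when [Re l = 0].  Hence an eigenvalue is a nonzero real number [a] with
[(K / 2) I(a) z = 1], where [z] is an eigenvalue of [W] and
[I(a) = int a / (a ^ 2 + w ^ 2) g(w) dw] ([fix_real]).  On [a > 0] the Poisson
integral [I] takes exactly the values between [0] and [pi g(0)]
([wint_res_re_lt], [wint_res_re_ivt]), so a positive eigenvalue exists if and
only if [K z > 2 / (pi g(0))] for some [z]; by the extremality of [xi_max] and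
[xi_min] this says that [K] is outside the critical interval ([Kc_rangeP]).

Off the imaginary axis.  There [m] is bounded, so solving for [Z] amounts to
solving for [p], and the Fredholm alternative for [W] makes [l] either an
eigenvalue or a resolvent point ([resolvent_off_axis]).  The alternative itself
([fredholm_solve], [fredholm_stable]) comes from the Lipschitz bound on the kernel:
collocation on a grid gives approximate solutions [p], their images [W p] are
equi-Lipschitz, and so they converge uniformly along an ultrafilter
([approx_solution_cvg]).

On the imaginary axis, [l = i b].  The range of [T - l] is dense: [F] may be
replaced by a function that vanishes for [w] near [b].  If [1 / (w - b)] is square
integrable for [g], then [m p] is admissible, and since [c] is purely imaginary
the equation for [p] is uniquely solvable.  If it is not, then the functional
[h |-> int h g / (w - b)] is unbounded, hence its kernel contains functions [h]
arbitrarily close to [1] ([kernel_near1]), and the remainder [r(y)] of a first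
attempt [Z = - m F] is absorbed, up to a small error, by adding [h m r], whose
image under [P] is zero ([dense_range_csq]).  So a spectral point that is not an
eigenvalue lies on the imaginary axis and belongs to the continuous spectrum.
That spectrum contains [0]: on indicators of shrinking neighbourhoods of [w = 0]
the operator [T] tends to [0] relative to their norm ([zero_not_bounded]). *)

Local Notation normc := Normc.normc.

(** * Square-integrable functions for a probability weight *)

Section weighted_L2.
Context d (T : measurableType d) (R : realType).
Variables (mu : {measure set T -> \bar R}) (D : set T) (w : T -> R).

(** One notion covers the three measures in play: [g dw] on the line, [dy] on the
unit interval and [g dw dy] on the strip. *)
Definition prob_weight : Prop :=
  [/\ measurable D, forall x, 0 <= w x, measurable_fun D w &
      (\int[mu]_(x in D) (w x)%:E = 1)%E].

Definition wL1 (f : T -> R) : Prop :=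
  measurable_fun D f /\ mu.-integrable D (EFin \o (fun x => f x * w x)).

Definition wL2 (f : T -> R) : Prop :=
  measurable_fun D f /\ mu.-integrable D (EFin \o (fun x => f x ^+ 2 * w x)).

Definition wint (f : T -> R) : R := \int[mu]_(x in D) (f x * w x).

Definition wsq (f : T -> R) : R := wint (fun x => f x ^+ 2).

Hypothesis pw : prob_weight.

Let mD : measurable D. Proof. by case: pw. Qed.
Let w0 x : 0 <= w x. Proof. by case: pw. Qed.
Let mw : measurable_fun D w. Proof. by case: pw. Qed.

Lemma wL1_le (f h : T -> R) : measurable_fun D f -> wL1 h ->
  (forall x, D x -> `|f x| <= h x) -> wL1 f.
Proof.
move=> mf [mh ih] fh; split=> //.
apply: (le_integrable mD _ _ ih).
  by apply/measurable_EFinP; apply: measurable_funM.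
move=> x Dx /=; rewrite lee_fin !normrM ler_wpM2r//.
by apply: le_trans (fh _ Dx) _; rewrite ler_norm.
Qed.

Lemma wL1_cst (c : R) : wL1 (cst c).
Proof.
split; first exact: measurable_cst.
have iw : mu.-integrable D (EFin \o w).
  apply/integrableP; split; first exact/measurable_EFinP.
  under eq_integral do rewrite /= ger0_norm//.
  by case: pw => _ _ _ ->; rewrite ltry.
by have := integrableZl mD c iw; apply: eq_integrable.
Qed.

Lemma wL1D (f h : T -> R) : wL1 f -> wL1 h -> wL1 (fun x => f x + h x).
Proof.
move=> [mf If] [mh Ih]; split; first exact: measurable_funD.
have := integrableD mD If Ih; apply: eq_integrable => // x _ /=.
by rewrite -EFinD mulrDl.
Qed.

Lemma wL1Z (c : R) f : wL1 f -> wL1 (fun x => c * f x).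
Proof.
move=> [mf If]; split; first exact: measurable_funM.
have := integrableZl mD c If; apply: eq_integrable => // x _ /=.
by rewrite -EFinM mulrA.
Qed.

Lemma wL1N (f : T -> R) : wL1 f -> wL1 (fun x => - f x).
Proof.
move=> /(wL1Z (-1)); congr wL1; apply/funext => x; exact: mulN1r.
Qed.

Lemma wL1B (f h : T -> R) : wL1 f -> wL1 h -> wL1 (fun x => f x - h x).
Proof. by move=> Lf /wL1N; exact: wL1D. Qed.

Lemma wL1_norm (f : T -> R) : wL1 f -> wL1 (fun x => `|f x|).
Proof.
move=> [mf If]; split; first exact: measurableT_comp.
have := integrable_norm If; apply: eq_integrable => // x _ /=.
by rewrite normrM (ger0_norm (w0 x)).
Qed.

Lemma wL1_bndM (b : T -> R) B f : measurable_fun D b -> (forall x, D x -> `|b x| <= B) ->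
  wL1 f -> wL1 (fun x => b x * f x).
Proof.
move=> mb bB Lf; apply: (@wL1_le _ (fun x => B * `|f x|)).
- by apply: measurable_funM => //; case: Lf.
- exact/wL1Z/wL1_norm.
- by move=> x Dx; rewrite normrM ler_wpM2r// bB.
Qed.

Lemma wL1_bnd (b : T -> R) B : measurable_fun D b -> (forall x, D x -> `|b x| <= B) ->
  wL1 b.
Proof. by move=> mb bB; apply: (wL1_le mb (wL1_cst B)). Qed.

Lemma wL2E (f : T -> R) : wL2 f <-> measurable_fun D f /\ wL1 (fun x => f x ^+ 2).
Proof.
split=> [[mf If]|[mf [_ If]]]; split=> //; split=> //.
exact: measurable_funX.
Qed.

(** The total mass is finite and [|t| <= 1 + t ^ 2]. *)
Lemma wL2_L1 (f : T -> R) : wL2 f -> wL1 f.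
Proof.
move=> /wL2E[mf If]; apply: (@wL1_le _ (fun x => 1 + f x ^+ 2)) => //.
  by apply: wL1D => //; exact: wL1_cst.
move=> x _; rewrite -(real_normK (num_real (f x))); nra.
Qed.

Lemma wL2D (f h : T -> R) : wL2 f -> wL2 h -> wL2 (fun x => f x + h x).
Proof.
move=> /wL2E[mf Lf] /wL2E[mh Lh]; apply/wL2E; split; first exact: measurable_funD.
apply: (@wL1_le _ (fun x => 2 * f x ^+ 2 + 2 * h x ^+ 2)).
- by apply: measurable_funX; exact: measurable_funD.
- by apply: wL1D; exact: wL1Z.
- by move=> x _; rewrite ger0_norm ?sqr_ge0//; have := sqr_ge0 (f x - h x); nra.
Qed.

Lemma wL2_bndM (b : T -> R) B f : measurable_fun D b -> (forall x, D x -> `|b x| <= B) ->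
  wL2 f -> wL2 (fun x => b x * f x).
Proof.
move=> mb bB /wL2E[mf Lf]; apply/wL2E; split; first exact: measurable_funM.
rewrite (_ : (fun _ => _) = fun x => b x ^+ 2 * f x ^+ 2).
  apply: (@wL1_bndM _ (B ^+ 2)) => //; first exact: measurable_funX.
  move=> x Dx; rewrite normrX lerXn2r ?nnegrE// ?bB//.
  exact: le_trans (bB _ Dx).
by apply/funext => x; rewrite exprMn.
Qed.

Lemma wL2_bnd (b : T -> R) B : measurable_fun D b -> (forall x, D x -> `|b x| <= B) ->
  wL2 b.
Proof.
move=> mb bB; apply/wL2E; split=> //.
apply: (@wL1_bnd _ (B ^+ 2)); first exact: measurable_funX.
move=> x Dx; rewrite normrX lerXn2r ?nnegrE// ?bB//.
exact: le_trans (bB _ Dx).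
Qed.

Lemma wL2Z (c : R) f : wL2 f -> wL2 (fun x => c * f x).
Proof. by apply: (@wL2_bndM _ `|c|) => //; exact: measurable_cst. Qed.

Lemma wL2N (f : T -> R) : wL2 f -> wL2 (fun x => - f x).
Proof.
move=> /(wL2Z (-1)); congr wL2; apply/funext => x; exact: mulN1r.
Qed.

Lemma wL2B (f h : T -> R) : wL2 f -> wL2 h -> wL2 (fun x => f x - h x).
Proof. by move=> Lf /wL2N; exact: wL2D. Qed.

Lemma wintD (f h : T -> R) : wL1 f -> wL1 h -> wint (fun x => f x + h x) = wint f + wint h.
Proof.
move=> [_ If] [_ Ih]; rewrite /wint.
under eq_Rintegral do rewrite mulrDl.
exact: (RintegralD mD If Ih).
Qed.

Lemma wintZ (c : R) f : wL1 f -> wint (fun x => c * f x) = c * wint f.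
Proof.
move=> [_ If]; rewrite /wint.
under eq_Rintegral do rewrite -mulrA.
exact: (RintegralZl c mD If).
Qed.

Lemma wintE (f : T -> R) : wL1 f ->
  (wint f)%:E = (\int[mu]_(x in D) (f x * w x)%:E)%E.
Proof. by move=> [_ If]; rewrite /wint /Rintegral fineK//; exact: integrable_fin_num. Qed.

Lemma wintN (f : T -> R) : wL1 f -> wint (fun x => - f x) = - wint f.
Proof.
move=> Lf; rewrite -mulN1r -wintZ//; congr wint; apply/funext => x.
by rewrite mulN1r.
Qed.

Lemma wintB (f h : T -> R) : wL1 f -> wL1 h -> wint (fun x => f x - h x) = wint f - wint h.
Proof. by move=> Lf Lh; rewrite wintD ?wintN//; exact: wL1N. Qed.

Lemma eq_wint (f h : T -> R) : (forall x, D x -> f x = h x) -> wint f = wint h.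
Proof.
by move=> fh; apply: eq_Rintegral => x; rewrite inE => /fh ->.
Qed.

Lemma le_wint (f h : T -> R) : wL1 f -> wL1 h -> (forall x, D x -> f x <= h x) ->
  wint f <= wint h.
Proof.
move=> [_ If] [_ Ih] fh; apply: le_Rintegral => // x Dx /=.
by rewrite ler_wpM2r// fh.
Qed.

Lemma wint_ge0 (f : T -> R) : (forall x, D x -> 0 <= f x) -> 0 <= wint f.
Proof. by move=> f0; apply: Rintegral_ge0 => x Dx; rewrite mulr_ge0// f0. Qed.

Lemma wint_cst (c : R) : wint (cst c) = c.
Proof.
rewrite (_ : cst c = fun x => c * cst 1 x); last by apply/funext => x /=; rewrite mulr1.
rewrite wintZ; last exact: wL1_cst.
rewrite /wint; under eq_Rintegral do rewrite /= mul1r.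
by rewrite /Rintegral; case: pw => _ _ _ -> /=; rewrite mulr1.
Qed.

Lemma le_norm_wint (f h : T -> R) : wL1 f -> wL1 h -> (forall x, D x -> `|f x| <= h x) ->
  `|wint f| <= wint h.
Proof.
move=> Lf Lh fh; rewrite ler_norml -wintN//.
apply/andP; split; apply: le_wint => //; first exact: wL1N.
  by move=> x Dx; have := fh x Dx; rewrite ler_norml => /andP[].
by move=> x Dx; have := fh x Dx; rewrite ler_norml => /andP[].
Qed.

Lemma wint_bnd (f : T -> R) B : wL1 f -> (forall x, D x -> `|f x| <= B) -> `|wint f| <= B.
Proof.
by move=> Lf fB; rewrite -[leRHS]wint_cst; apply: le_norm_wint => //; exact: wL1_cst.
Qed.

(** The variance of [|f|] is nonnegative. *)
Lemma wint_norm_sq (f : T -> R) : wL2 f -> wint (fun x => `|f x|) ^+ 2 <= wsq f.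
Proof.
move=> Lf; have Lf1 := wL1_norm (wL2_L1 Lf).
have /wL2E[mf Lf2] := Lf.
set t := wint _.
have : 0 <= wint (fun x => f x ^+ 2 - (2 * t) * `|f x| + cst (t ^+ 2) x).
  apply: wint_ge0 => x _ /=; rewrite -(real_normK (num_real (f x))).
  by have := sqr_ge0 (`|f x| - t); nra.
rewrite wintD ?wintB ?wint_cst ?wintZ -/t//.
- rewrite -/(wsq f); nra.
- exact: wL1Z.
- by apply: wL1B => //; exact: wL1Z.
- exact: wL1_cst.
Qed.

Lemma wsq_ge0 (f : T -> R) : 0 <= wsq f.
Proof. by apply: wint_ge0 => x _; exact: sqr_ge0. Qed.

Lemma wint_norm_sqrt (f : T -> R) : wL2 f -> wint (fun x => `|f x|) <= Num.sqrt (wsq f).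
Proof.
move=> Lf; rewrite -[leLHS]ger0_norm; last by apply: wint_ge0.
by rewrite -sqrtr_sqr ler_wsqrtr// wint_norm_sq.
Qed.

(** If [f] is a null vector it vanishes almost everywhere for the weighted
measure, so it stays null after multiplication by an unbounded function. *)
Lemma wsq0M (f h : T -> R) : measurable_fun D h -> wL2 f -> wsq f = 0 ->
  wL2 (fun x => h x * f x) /\ wsq (fun x => h x * f x) = 0.
Proof.
move=> mh /wL2E[mf Lf] f0.
have ae0 : ae_eq mu D (fun x => (f x ^+ 2 * w x)%:E) (cst 0%E).
  apply/(ae_eq_integral_abs mu mD).
    by apply/measurable_EFinP; apply: measurable_funM => //; exact: measurable_funX.
  rewrite (eq_integral (fun x => (f x ^+ 2 * w x)%:E)); last first.
    by move=> x _; rewrite abse_EFin ger0_norm// mulr_ge0// sqr_ge0.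
  have [_ If] := Lf; have := integrable_fin_num mD If.
  by rewrite /wsq /wint /Rintegral in f0; move=> /fineK; rewrite f0 => <-.
have ae1 : ae_eq mu D (fun x => ((h x * f x) ^+ 2 * w x)%:E) (cst 0%E).
  apply: filterS ae0 => x + Dx => /(_ Dx) /= [] fw.
  by rewrite exprMn -mulrA fw mulr0.
have mhf : measurable_fun D (fun x => ((h x * f x) ^+ 2 * w x)%:E).
  apply/measurable_EFinP; apply: measurable_funM => //.
  by apply: measurable_funX; exact: measurable_funM.
have i0 : (\int[mu]_(x in D) ((h x * f x) ^+ 2 * w x)%:E = 0)%E.
  by rewrite (ae_eq_integral (cst 0%E))// integral0.
split.
  split; first exact: measurable_funM.
  apply/integrableP; split=> //.
  rewrite (eq_integral (fun x => ((h x * f x) ^+ 2 * w x)%:E)) ?i0//.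
  by move=> x _; rewrite /= ger0_norm// mulr_ge0// sqr_ge0.
by rewrite /wsq /wint /Rintegral i0.
Qed.

Lemma wsq0_wint (f h : T -> R) : measurable_fun D h -> wL2 f -> wsq f = 0 ->
  wint (fun x => h x * f x) = 0.
Proof.
move=> mh Lf f0; have [Lhf hf0] := wsq0M mh Lf f0.
apply/eqP; rewrite -normr_le0.
apply: le_trans (le_norm_wint (wL2_L1 Lhf) (wL1_norm (wL2_L1 Lhf)) _) _ => //.
by apply: le_trans (wint_norm_sqrt Lhf) _; rewrite hf0 sqrtr0.
Qed.

Lemma wsqZ (c : R) f : wL2 f -> wsq (fun x => c * f x) = c ^+ 2 * wsq f.
Proof.
move=> /wL2E[mf Lf]; rewrite /wsq -wintZ//; congr wint.
by apply/funext => x; rewrite exprMn.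
Qed.

Lemma wsqD_le (f h : T -> R) : wL2 f -> wL2 h ->
  wsq (fun x => f x + h x) <= 2 * wsq f + 2 * wsq h.
Proof.
move=> Lf Lh; have /wL2E[_ Lfh] := wL2D Lf Lh.
move: Lf Lh => /wL2E[_ Lf] /wL2E[_ Lh].
rewrite /wsq -!wintZ// -wintD//; try exact: wL1Z.
apply: le_wint => //; first by apply: wL1D; exact: wL1Z.
by move=> x _; have := sqr_ge0 (f x - h x); nra.
Qed.

(** Dominated convergence for multiplication by a sequence of cut-offs. *)
Lemma wsq_cutoff (b : nat -> T -> R) (f : T -> R) : (forall n, measurable_fun D (b n)) ->
  (forall n x, D x -> `|b n x| <= 1) ->
  {ae mu, forall x, D x -> b n x @[n --> \oo] --> (0 : R)} -> wL2 f ->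
  wsq (fun x => b n x * f x) @[n --> \oo] --> (0 : R).
Proof.
move=> mb b1 b0 /wL2E[mf [_ If]].
have mbf n : measurable_fun D (EFin \o (fun x => (b n x * f x) ^+ 2 * w x)).
  apply/measurable_EFinP; apply: measurable_funM => //.
  by apply: measurable_funX; exact: measurable_funM.
have [|||_ _] := @dominated_convergence _ _ _ mu D mD
  (fun n => EFin \o (fun x => (b n x * f x) ^+ 2 * w x)) (cst 0%E)
  (EFin \o (fun x => f x ^+ 2 * w x)) mbf _ _ If _.
- exact: measurable_cst.
- apply: filterS b0 => x + Dx => /(_ Dx) bx0.
  apply: cvg_EFin; first by near=> n.
  rewrite /=; under eq_fun do rewrite exprMn -mulrA.
  rewrite (_ : 0 = 0 ^+ 2 * (f x ^+ 2 * w x)); last by rewrite expr0n mul0r.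
  by apply: cvgMl; apply: (cvg_comp _ (fun z : R => z ^+ 2) bx0); exact: exprn_continuous.
- apply: aeW => x n Dx /=; rewrite lee_fin ger0_norm; last by rewrite mulr_ge0// sqr_ge0.
  rewrite ler_wpM2r// exprMn ler_piMl ?sqr_ge0//.
  by rewrite -real_normK ?num_real// expr_le1// b1.
by rewrite integral0 => /fine_cvg.
Unshelve. all: end_near. Qed.

End weighted_L2.

(** * Integrals on the line *)

Section one_dim.
Context (R : realType).
Local Notation leb := (@lebesgue_measure R).

Section reflection.
Variable c : R.

Let refl (x : measurableTypeR R) : measurableTypeR R := c - x.

Let measurable_refl : measurable_fun setT refl.
Proof. by apply: measurable_funB => //; exact: measurable_cst. Qed.

HB.instance Definition _ := isMeasurableFun.Build _ _ _ _ _ measurable_refl.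

Let lebesgue_measure_refl (A : set R) : measurable A ->
  leb A = pushforward leb refl A.
Proof.
move=> mA; apply: lebesgue_measure_unique => //= _ [[a b]] _ <-.
rewrite /pushforward /refl.
rewrite (_ : _ @^-1` _ = `[c - b, c - a[%classic).
  rewrite !lebesgue_measure_itv/= !lte_fin ltrD2l ltrN2.
  by case: ifP => // _; rewrite -!EFinD; congr EFin; ring.
apply/seteqP; split => x /=; rewrite !in_itv/= => /andP[? ?].
  by apply/andP; split; lra.
by apply/andP; split; lra.
Qed.

Let integral_refl (h : R -> \bar R) :
  (\int[leb]_x h x = \int[pushforward leb refl]_x h x)%E.
Proof. by apply: eq_measure_integral => A mA _; exact: lebesgue_measure_refl. Qed.

Lemma integrable_reflect (f : R -> R) : leb.-integrable setT (EFin \o f) ->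
  leb.-integrable setT (EFin \o (fun x => f (c - x))).
Proof.
move=> /integrableP[/measurable_EFinP mf If]; apply/integrableP; split.
  by apply/measurable_EFinP; exact: (measurableT_comp mf).
apply: le_lt_trans If; rewrite [in leRHS]integral_refl ge0_integral_pushforward//.
by apply: measurableT_comp => //; exact/measurable_EFinP.
Qed.

Lemma Rintegral_reflect (f : R -> R) : leb.-integrable setT (EFin \o f) ->
  \int[leb]_x f x = \int[leb]_x f (c - x).
Proof.
move=> If; rewrite /Rintegral; congr fine.
rewrite integral_refl (integral_pushforward measurable_refl)//.
  by have /integrableP[] := If.
by rewrite preimage_setT; exact: integrable_reflect.
Qed.

End reflection.

Lemma integral_ge_itv (D : set R) (F : R -> R) (c u v : R) : measurable D ->
  measurable_fun D F -> (forall x, D x -> 0 <= F x) -> 0 <= c -> u <= v ->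
  `[u, v] `<=` D -> (forall x, u <= x <= v -> c <= F x) ->
  ((c * (v - u))%:E <= \int[leb]_(x in D) (F x)%:E)%E.
Proof.
move=> mD mF F0 c0 uv sD cF.
apply: (@le_trans _ _ (\int[leb]_(x in `[u, v]) (F x)%:E)%E); last first.
  by apply: ge0_subset_integral => //; exact/measurable_EFinP.
apply: (@le_trans _ _ (\int[leb]_(x in `[u, v]) cst c%:E x)%E).
  rewrite integral_cst//= lebesgue_measure_itv/= lte_fin.
  rewrite EFinM; case: ltP => [_|vu]; first by rewrite EFinB.
  have -> : v - u = 0 by apply/eqP; rewrite subr_eq0; apply/eqP/le_anti/andP.
  by [].
apply: ge0_le_integral => //.
by apply/measurable_EFinP; apply: measurable_funS mF.
Qed.

Lemma continuous_integral_eq0 (F : R -> R) : continuous F ->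
  (forall x, 0 <= F x) -> (\int[leb]_x (F x)%:E = 0)%E -> forall x, F x = 0.
Proof.
move=> cF F0 iF x; apply/eqP/negPn/negP => Fx0.
have Fx : 0 < F x by rewrite lt_neqAle eq_sym Fx0 F0.
have /cvgrPdist_lt /(_ (F x / 2)) : F y @[y --> x] --> F x by exact: cF.
rewrite divr_gt0// => /(_ isT) /nbhs_ballP[e /= e0 he].
have : ((F x / 2 * ((x + e / 2) - (x - e / 2)))%:E <= \int[leb]_(x in setT) (F x)%:E)%E.
  apply: integral_ge_itv => //.
  - exact: continuous_measurable_fun.
  - by rewrite divr_ge0// F0.
  - by lra.
  - move=> y /andP[y1 y2]; have /he : ball x e y.
      by rewrite /ball/= ltr_norml; apply/andP; split; lra.
    by rewrite ltr_norml => /andP[? ?]; lra.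
rewrite iF lee_fin; apply/negP; rewrite -ltNge.
by rewrite mulr_gt0 ?divr_gt0//; lra.
Qed.

(** [res_re a b + i res_im a b] is [1 / (l - i w)] for [l = a + i b]. *)
Definition res_re (a b w : R) : R := a / (a ^+ 2 + (w - b) ^+ 2).
Definition res_im (a b w : R) : R := (w - b) / (a ^+ 2 + (w - b) ^+ 2).

Lemma res_den_gt0 (a b w : R) : a != 0 \/ w != b -> 0 < a ^+ 2 + (w - b) ^+ 2.
Proof.
case=> [a0|wb].
  by rewrite ltr_pwDl ?sqr_ge0// lt_neqAle eq_sym sqrf_eq0 a0 sqr_ge0.
by rewrite ltr_wpDl ?sqr_ge0// lt_neqAle eq_sym sqrf_eq0 subr_eq0 wb sqr_ge0.
Qed.

Lemma continuous_res_den (a b : R) : continuous (fun w => a ^+ 2 + (w - b) ^+ 2).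
Proof.
move=> w; apply: cvgD; first exact: cvg_cst.
apply: (@continuous_comp _ _ _ (fun w => w - b) (fun z : R => z ^+ 2)).
  by apply: cvgB; [exact: cvg_id|exact: cvg_cst].
exact: exprn_continuous.
Qed.

Lemma continuous_res_re (a b : R) : a != 0 -> continuous (res_re a b).
Proof.
move=> a0 w; apply: cvgM; first exact: cvg_cst.
apply: cvgV; first by rewrite gt_eqF//; apply: res_den_gt0; left.
exact: continuous_res_den.
Qed.

Lemma continuous_res_im (a b : R) : a != 0 -> continuous (res_im a b).
Proof.
move=> a0 w; apply: cvgM; first by apply: cvgB; [exact: cvg_id|exact: cvg_cst].
apply: cvgV; first by rewrite gt_eqF//; apply: res_den_gt0; left.
exact: continuous_res_den.
Qed.

Lemma res_sqr (a b w : R) :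
  res_re a b w ^+ 2 + res_im a b w ^+ 2 = (a ^+ 2 + (w - b) ^+ 2)^-1.
Proof.
rewrite /res_re /res_im !exprMn -mulrDl; set q := a ^+ 2 + _.
by have [->|q0] := eqVneq q 0; [rewrite invr0 mul0r|field].
Qed.

Lemma res_bnd (a b w : R) : a != 0 ->
  `|res_re a b w| <= `|a|^-1 /\ `|res_im a b w| <= `|a|^-1.
Proof.
move=> a0; have a1 : 0 < `|a| by rewrite normr_gt0.
have H : res_re a b w ^+ 2 + res_im a b w ^+ 2 <= `|a|^-1 ^+ 2.
  rewrite res_sqr exprVn real_normK ?num_real// lef_pV2 ?lerDl ?sqr_ge0//.
    by rewrite posrE; apply: res_den_gt0; left.
  by rewrite posrE lt_neqAle eq_sym sqrf_eq0 a0 sqr_ge0.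
split.
  rewrite -(@ler_pXn2r _ 2) ?nnegrE ?invr_ge0// real_normK ?num_real//.
  by apply: le_trans H; rewrite lerDl sqr_ge0.
rewrite -(@ler_pXn2r _ 2) ?nnegrE ?invr_ge0// real_normK ?num_real//.
by apply: le_trans H; rewrite lerDr sqr_ge0.
Qed.

End one_dim.

(** * The density and its Poisson integral *)

Section density.
Context (R : realType) (g : R -> R).
Hypothesis g_ge0 : forall w, 0 <= g w.
Hypothesis g_int1 : (\int[@lebesgue_measure R]_(w in setT) (g w)%:E = 1)%E.
Hypothesis g_cont : continuous g.
Hypothesis g_even : forall w, g (- w) = g w.
Hypothesis g_decr : forall a b : R, 0 < a -> a <= b -> g b <= g a.
Local Notation leb := (@lebesgue_measure R).

Lemma density_weight : prob_weight leb setT g.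
Proof. by split=> //; exact: continuous_measurable_fun. Qed.
Let pw := density_weight.

Lemma density_le0 w : g w <= g 0.
Proof.
wlog w0 : w / 0 <= w.
  move=> H; have [/H//|/ltW w0] := leP 0 w.
  by rewrite -g_even; apply: H; rewrite oppr_ge0.
have [->//|wn0] := eqVneq w 0.
have wp : 0 < w by rewrite lt_neqAle eq_sym wn0.
rewrite leNgt; apply/negP => gw.
have /cvgrPdist_lt /(_ (g w - g 0)) : g y @[y --> 0] --> g 0 by exact: g_cont.
rewrite subr_gt0 => /(_ gw) /nbhs_ballP[e /= e0 he].
pose x := Num.min (e / 2) w.
have x0 : 0 < x by rewrite /x lt_min wp divr_gt0.
have /he : ball (0 : R) e x.
  rewrite /ball/= sub0r normrN gtr0_norm// /x gt_min; apply/orP; left; lra.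
have := g_decr x0 (_ : x <= w); rewrite /x ge_min lexx orbT => /(_ isT).
by rewrite ltr_norml => ? /andP[? ?]; lra.
Qed.

Lemma density_homo x y : `|x| <= `|y| -> g y <= g x.
Proof.
have gn z : g z = g `|z|.
  by case: (ger0P z) => z0; rewrite ?g_even.
move=> xy; rewrite (gn x) (gn y).
have [->|x0] := eqVneq x 0; first by rewrite normr0 density_le0.
by apply: g_decr => //; rewrite normr_gt0.
Qed.

(** Since [g(0)] is the maximum, the alternative is a constant density, whose integral
over the line is not [1]. *)
Lemma density_not_cst : ~ (forall w, g 0 <= g w).
Proof.
move=> gc; have [g00|g0] := leP (g 0) 0.
  have : (\int[leb]_(w in setT) (g w)%:E = 0)%E.
    apply: integral0_eq => w _; congr EFin; apply/le_anti/andP; split=> //.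
    exact: le_trans (density_le0 w) g00.
  by rewrite g_int1 => /eqP; rewrite onee_eq0.
have := @integral_ge_itv R setT g (g 0) 0 (2 / g 0).
rewrite g_int1 subr0 lee_fin mulrCA divff ?gt_eqF// mulr1 => H.
suff : (2 : R) <= 1 by lra.
apply: H => //; first exact: continuous_measurable_fun.
by rewrite ltW// divr_gt0.
Qed.

Lemma density0_gt0 : 0 < g 0.
Proof.
rewrite ltNge; apply/negP => g0; apply: density_not_cst => w.
exact: le_trans g0 _.
Qed.

Lemma wL1_res_re a b : a != 0 -> wL1 leb setT g (res_re a b).
Proof.
move=> a0; apply: (wL1_bnd pw (B := `|a|^-1)).
  by apply: continuous_measurable_fun; exact: continuous_res_re.
by move=> w _; case: (res_bnd b w a0).
Qed.

Lemma wL1_res_im a b : a != 0 -> wL1 leb setT g (res_im a b).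
Proof.
move=> a0; apply: (wL1_bnd pw (B := `|a|^-1)).
  by apply: continuous_measurable_fun; exact: continuous_res_im.
by move=> w _; case: (res_bnd b w a0).
Qed.

(** Reflecting about [b] turns the integral of [g * res_im] into that of
[(g w - g (2 b - w)) * res_im a b w / 2], whose integrand has the sign of [- b]
by monotonicity.  If it vanishes, [g] is invariant under [w |-> 2 b - w]; being
even it is then [2 b]-periodic, and monotonicity makes it constant. *)
Lemma wint_res_im_neq0 a b : a != 0 -> b != 0 -> wint leb setT g (res_im a b) != 0.
Proof.
move=> a0 b0; apply/negP => /eqP H0.
have cr := continuous_res_im (b := b) a0.
have [mr Ir] := wL1_res_im b a0.
have cg2 : continuous (fun w => g (2 * b - w)).
  move=> w; apply: (@continuous_comp _ _ _ (fun w => 2 * b - w) g); last exact: g_cont.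
  by apply: cvgB; [exact: cvg_cst|exact: cvg_id].
have im2 w : res_im a b (2 * b - w) = - res_im a b w.
  rewrite /res_im (_ : 2 * b - w - b = - (w - b)); last by ring.
  by rewrite sqrrN mulNr.
have Ir2 : leb.-integrable setT (EFin \o (fun w => res_im a b w * g (2 * b - w))).
  have := integrable_reflect (2 * b) Ir => /integrableN.
  apply: eq_integrable => // w _ /=.
  by rewrite im2 mulNr opprK.
have H1 : \int[leb]_w (res_im a b w * g (2 * b - w)) = 0.
  move: H0; rewrite /wint (Rintegral_reflect (2 * b))//.
  under eq_Rintegral do rewrite im2 mulNr -mulrN1.
  rewrite RintegralZr//.
  by move=> /eqP; rewrite mulf_eq0 oppr_eq0 oner_eq0 orbF => /eqP.
(* twice the negated product of [b] with the symmetrized integrand *)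
pose F w := - b * ((g w - g (2 * b - w)) * res_im a b w).
have FE w : F w = - b * (res_im a b w * g w - res_im a b w * g (2 * b - w)).
  by rewrite /F mulrBl ![g _ * _]mulrC.
have F0 w : 0 <= F w.
  rewrite /F /res_im !mulrA mulr_ge0//; last first.
    by rewrite invr_ge0 addr_ge0// sqr_ge0.
  have [bw|bw] := leP 0 (b * (w - b)).
    suff : g w <= g (2 * b - w) by nra.
    by apply: density_homo; rewrite -ler_sqr ?nnegrE// !real_normK ?num_real//; nra.
  suff : g (2 * b - w) <= g w by nra.
  by apply: density_homo; rewrite -ler_sqr ?nnegrE// !real_normK ?num_real//; nra.
have cF : continuous F.
  move=> w; apply: cvgM; first exact: cvg_cst.
  by apply: cvgM; [apply: cvgB; [exact: g_cont|exact: cg2]|exact: cr].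
have IB := integrableB measurableT Ir Ir2.
have IF : leb.-integrable setT (EFin \o F).
  have := integrableZl measurableT (- b) IB; apply: eq_integrable => // w _ /=.
  by rewrite FE.
have iF : (\int[leb]_w (F w)%:E = 0)%E.
  rewrite -(fineK (integrable_fin_num measurableT IF)); congr EFin.
  rewrite -/(Rintegral leb setT F).
  rewrite (funext FE).
  by rewrite RintegralZl// RintegralB// -/(wint _ _ _ _) H0 H1 subrr mulr0.
have sym w : g (2 * b - w) = g w.
  have [->|wb] := eqVneq w b; first by congr g; ring.
  have := continuous_integral_eq0 cF F0 iF w.
  move/eqP; rewrite !mulf_eq0 oppr_eq0 (negbTE b0)/= !subr_eq0 (negbTE wb)/=.
  by rewrite invr_eq0 (gt_eqF (@res_den_gt0 _ a b w (or_introl a0))) orbF => /eqP.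
have per w : g (w + 2 * b) = g w.
  by rewrite -(sym (w + 2 * b)) (_ : _ - _ = - w) ?g_even//; ring.
have pern n : g ((2 * b) *+ n) = g 0.
  by elim: n => [|n IH]; rewrite ?mulr0n// mulrSr per.
apply: density_not_cst => w.
pose n := Num.bound (`|w| / `|2 * b|).
rewrite -(pern n); apply: density_homo.
rewrite normrMn -[leRHS]mulr_natl -ler_pdivrMr.
  by rewrite ltW// archi_boundP// divr_ge0.
by rewrite normr_gt0 mulf_neq0// pnatr_eq0.
Qed.

Lemma is_derive_atan_scale (a w : R) : 0 < a ->
  is_derive w 1 (fun w : R => atan (a^-1 * w)) (res_re a 0 w).
Proof.
move=> a0.
have H1 : is_derive w 1 (fun w : R => a^-1 * w) a^-1.
  have := is_deriveM (is_derive_cst a^-1 w (1 : R)) (is_derive_id w (1 : R)).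
  by rewrite /= scaler0 addr0 /GRing.scale/= mulr1.
have := is_derive1_comp (is_derive1_atan (a^-1 * w)) H1.
rewrite /comp; congr is_derive.
have an0 : a != 0 by rewrite gt_eqF.
have /gt_eqF/negbT : 0 < a ^+ 2 + (w - 0) ^+ 2 by apply: res_den_gt0; left.
have /gt_eqF/negbT : 0 < 1 + (a^-1 * w) ^+ 2 by rewrite ltr_pwDl// sqr_ge0.
rewrite /res_re subr0 => h1 h2; rewrite -invfM -[in RHS](invrK a) -invfM.
congr (_^-1); field; exact: an0.
Qed.

Lemma continuous_atan_scale (a : R) : continuous (fun w : R => atan (a^-1 * w)).
Proof.
move=> w; apply: (@continuous_comp _ _ _ (fun w => a^-1 * w) atan).
  by apply: cvgM; [exact: cvg_cst|exact: cvg_id].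
exact: continuous_atan.
Qed.

Lemma integral_poisson (a : R) : 0 < a ->
  (\int[leb]_w (res_re a 0 w)%:E = pi%:E)%E.
Proof.
move=> a0; have an0 : a != 0 by rewrite gt_eqF.
have re0 w : 0 <= res_re a 0 w.
  by rewrite /res_re divr_ge0 ?(ltW a0)// addr_ge0// sqr_ge0.
have cre := continuous_res_re (b := 0) an0.
rewrite ge0_symfun_integralT//; last first.
  by move=> w; rewrite /= /res_re !subr0 sqrrN.
rewrite -set_itvcy (@ge0_continuous_FTC2y _ _ (fun w => atan (a^-1 * w)) 0 (pi / 2)).
- by rewrite mulr0 atan0 sube0 -EFinM mulrC divfK ?pnatr_eq0.
- by [].
- exact: continuous_subspaceT.
- apply: (@cvg_comp _ _ _ (fun w => a^-1 * w) atan _ +oo%R); last exact: cvgy_atan.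
  by apply: gt0_cvgMry; [rewrite invr_gt0|exact: cvg_id].
- by move=> w _; have [] := is_derive_atan_scale w a0.
- exact/cvg_at_right_filter/continuous_atan_scale.
- by move=> w _; rewrite derive1E; have [_ ->] := is_derive_atan_scale w a0.
Qed.

Lemma integrable_poisson (a : R) : 0 < a ->
  leb.-integrable setT (EFin \o res_re a 0).
Proof.
move=> a0; have cre : continuous (res_re a 0) by apply: continuous_res_re; rewrite gt_eqF.
apply/integrableP; split; first by apply/measurable_EFinP; exact: continuous_measurable_fun.
have -> : (\int[leb]_w `|(EFin \o res_re a 0) w| = \int[leb]_w (res_re a 0 w)%:E)%E.
  apply: eq_integral => w _; rewrite /= ger0_norm// /res_re divr_ge0 ?(ltW a0)//.
  by rewrite addr_ge0// sqr_ge0.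
by rewrite integral_poisson// ltry.
Qed.

Lemma wint_res_re_ge0 (a b : R) : 0 <= a -> 0 <= wint leb setT g (res_re a b).
Proof.
move=> a0; apply: wint_ge0; first exact: pw.
by move=> w _; rewrite /res_re divr_ge0// addr_ge0// sqr_ge0.
Qed.

(** [I(a) <= g(0) int res_re], and equality would force [g] to be constant. *)
Lemma wint_res_re_lt (a : R) : 0 < a -> wint leb setT g (res_re a 0) < pi * g 0.
Proof.
move=> a0; have an0 : a != 0 by rewrite gt_eqF.
have cre := continuous_res_re (b := 0) an0.
have [_ Ig] := wL1_res_re 0 an0.
have Ip := integrable_poisson a0.
have Ig0 : leb.-integrable setT (EFin \o (fun w => g 0 * res_re a 0 w)).
  exact: (integrableZl measurableT (g 0) Ip).
pose F w := g 0 * res_re a 0 w - res_re a 0 w * g w.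
have IF : leb.-integrable setT (EFin \o F).
  exact: (integrableB measurableT Ig0 Ig).
have EF : \int[leb]_w F w = pi * g 0 - wint leb setT g (res_re a 0).
  rewrite RintegralB// RintegralZl// mulrC; congr (_ * _ - _).
  by rewrite /Rintegral integral_poisson.
have F0 w : 0 <= F w.
  rewrite /F [g 0 * _]mulrC -mulrBr mulr_ge0 ?subr_ge0 ?density_le0//.
  by rewrite /res_re divr_ge0 ?(ltW a0)// addr_ge0// sqr_ge0.
rewrite -subr_gt0 -EF lt_neqAle Rintegral_ge0// andbT eq_sym; apply/negP => /eqP iF.
apply: density_not_cst => w.
have cF : continuous F.
  move=> x; apply: cvgB; apply: cvgM; [exact: cvg_cst|exact: cre|exact: cre|exact: g_cont].
have iF0 : (\int[leb]_w (F w)%:E = 0)%E.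
  by rewrite -(fineK (integrable_fin_num measurableT IF)); congr EFin.
have := continuous_integral_eq0 cF F0 iF0 w.
rewrite /F [g 0 * _]mulrC -mulrBr => /eqP; rewrite mulf_eq0 subr_eq0.
rewrite gt_eqF/=; first by move=> /eqP ->.
by rewrite /res_re divr_gt0//; apply: res_den_gt0; left.
Qed.

Lemma wint_res_re_dist (a c : R) : 0 < a -> 0 < c ->
  `|wint leb setT g (res_re a 0) - wint leb setT g (res_re c 0)| <= `|a - c| / (a * c).
Proof.
move=> a0 c0; have an0 : a != 0 by rewrite gt_eqF.
have cn0 : c != 0 by rewrite gt_eqF.
rewrite -(wintB pw); [|exact: wL1_res_re|exact: wL1_res_re].
apply: (wint_bnd pw); first by apply: (wL1B pw); exact: wL1_res_re.
move=> w _; rewrite /res_re subr0.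
have da : 0 < a ^+ 2 + w ^+ 2 by rewrite ltr_pwDl ?sqr_ge0 ?exprn_gt0.
have dc : 0 < c ^+ 2 + w ^+ 2 by rewrite ltr_pwDl ?sqr_ge0 ?exprn_gt0.
have -> : a / (a ^+ 2 + w ^+ 2) - c / (c ^+ 2 + w ^+ 2) =
   (a - c) * ((w ^+ 2 - a * c) / ((a ^+ 2 + w ^+ 2) * (c ^+ 2 + w ^+ 2))).
  by field; rewrite !gt_eqF.
rewrite normrM ler_wpM2l// normrM normfV (gtr0_norm (mulr_gt0 da dc)).
rewrite ler_pdivrMr ?(mulr_gt0 da dc)// ler_pdivlMl ?(mulr_gt0 a0 c0)//.
have ac : 0 < a * c by rewrite mulr_gt0.
have H : `|w ^+ 2 - a * c| <= w ^+ 2 + a * c.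
  by rewrite ler_norml; have ? := sqr_ge0 w; apply/andP; split; lra.
apply: le_trans (ler_wpM2l (ltW ac) H) _.
have := sqr_ge0 w; have := sqr_ge0 (w * (a - c)); have := sqr_ge0 (w ^+ 2); nra.
Qed.

(** As [a] tends to [0] the Poisson kernel concentrates at [0], where [g] is close
to [g(0)].  The scale [a] is chosen so that the kernel has on [[- d, d]] exactly the
mass [2 th = t / g1], with [g1] a lower bound for [g] there. *)
Lemma wint_res_re_ge (t : R) : 0 < t -> t < pi * g 0 ->
  exists2 a : R, 0 < a & t <= wint leb setT g (res_re a 0).
Proof.
move=> t0 tg; have g0 := density0_gt0; have pi0 := pi_gt0 R.
(* any level strictly between [t / pi] and [g(0)] works *)
pose g1 := (g 0 + t / pi) / 2.
have tp : t / pi < g 0 by rewrite ltr_pdivrMr// mulrC.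
have tp0 : 0 < t / pi by rewrite divr_gt0.
have g1l : t / pi < g1 by rewrite /g1; lra.
have g1u : g1 < g 0 by rewrite /g1; lra.
have g10 : 0 < g1 by exact: lt_trans tp0 g1l.
have /cvgrPdist_lt /(_ (g 0 - g1)) : g y @[y --> 0] --> g 0 by exact: g_cont.
rewrite subr_gt0 => /(_ g1u) /nbhs_ballP[e /= e0 he].
pose d := e / 2; have d0 : 0 < d by rewrite divr_gt0.
have gd w : - d <= w <= d -> g1 <= g w.
  move=> /andP[w1 w2]; have /he : ball (0 : R) e w.
    by rewrite /ball/= sub0r normrN ltr_norml; apply/andP; split; rewrite /d in w1 w2; lra.
  by rewrite ltr_norml => /andP[? ?]; lra.
pose th := t / g1 / 2.
have th0 : 0 < th by rewrite /th; apply: divr_gt0 => //; exact: divr_gt0.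
have thp : th < pi / 2.
  rewrite /th ltr_pM2r ?invr_gt0// ltr_pdivrMr// mulrC -ltr_pdivrMr//.
have tan0 : 0 < tan th.
  rewrite /tan divr_gt0//.
    by rewrite sin_gt0_pi// th0; apply: lt_trans thp _; lra.
  by rewrite cos_gt0_pihalf// thp andbT; lra.
pose a := d / tan th; have a0 : 0 < a by rewrite divr_gt0.
have an0 : a != 0 by rewrite gt_eqF.
exists a => //.
have cre := continuous_res_re (b := 0) an0.
have dN : - d < d by lra.
have FTC : (\int[leb]_(w in `[(- d)%R, d]) (res_re a 0 w)%:E = (th *+ 2)%:E)%E.
  rewrite (@continuous_FTC2 _ _ (fun w => atan (a^-1 * w)))//.
  - rewrite mulrN atanN -EFinB opprK -mulr2n; congr (EFin (_ *+ 2)).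
    rewrite /a invfM invrK mulrAC mulVf ?gt_eqF// mul1r tanK//.
    by rewrite in_itv/= thp andbT; lra.
  - exact: continuous_subspaceT.
  - split.
    + by move=> w _; have [] := is_derive_atan_scale w a0.
    + exact/cvg_at_right_filter/continuous_atan_scale.
    + exact/cvg_at_left_filter/continuous_atan_scale.
  - by move=> w _; rewrite derive1E; have [_ ->] := is_derive_atan_scale w a0.
have re0 w : 0 <= res_re a 0 w.
  by rewrite /res_re divr_ge0 ?(ltW a0)// addr_ge0// sqr_ge0.
have [mr Ir] := wL1_res_re 0 an0.
rewrite -lee_fin /wint /Rintegral fineK; last exact: integrable_fin_num.
have -> : t%:E = (\int[leb]_(w in `[(- d)%R, d]) (g1 * res_re a 0 w)%:E)%E.
  under eq_integral do rewrite EFinM.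
  rewrite ge0_integralZl_EFin//.
  - rewrite FTC -EFinM; congr EFin; rewrite /th; field.
    by rewrite gt_eqF.
  - by move=> w _; rewrite lee_fin.
  - by apply/measurable_EFinP; apply: measurable_funS mr.
  - exact: ltW.
apply: (@le_trans _ _ (\int[leb]_(w in `[(- d)%R, d]) (res_re a 0 w * g w)%:E)%E).
  apply: ge0_le_integral => //.
  - by move=> w _; rewrite lee_fin mulr_ge0// ltW.
  - apply/measurable_EFinP/measurable_funM => //; exact: measurable_funS mr.
  - apply/measurable_EFinP/measurable_funM; first exact: measurable_funS mr.
    apply: measurable_funTS; exact: continuous_measurable_fun.
  - move=> w; rewrite /= in_itv/= lee_fin => /gd H.
    by rewrite mulrC ler_wpM2l.
apply: ge0_subset_integral => //; first by have /integrableP[] := Ir.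
by move=> w _; rewrite lee_fin mulr_ge0.
Qed.

(** [I] is continuous, reaches [t] near [0] and is at most [1 / a]. *)
Lemma wint_res_re_ivt (t : R) : 0 < t -> t < pi * g 0 ->
  exists2 a : R, 0 < a & wint leb setT g (res_re a 0) = t.
Proof.
move=> t0 tg; pose f a := wint leb setT g (res_re a 0).
have [c c0 tc] := wint_res_re_ge t0 tg.
have fle a : 0 < a -> f a <= a^-1.
  move=> a0; apply: le_trans (ler_norm _) _.
  apply: (wint_bnd pw); first by apply: wL1_res_re; rewrite gt_eqF.
  move=> w _; have an0 : a != 0 by rewrite gt_eqF.
  by have [+ _] := res_bnd 0 w an0; rewrite (gtr0_norm a0).
pose b := Num.max c t^-1.
have b0 : 0 < b by rewrite /b lt_max c0.
have cb : c <= b by rewrite /b le_max lexx.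
have fb : f b <= t.
  by apply: le_trans (fle _ b0) _; rewrite invf_ple ?posrE// /b le_max lexx orbT.
have cf : {within `[c, b], continuous f}.
  apply: continuous_in_subspaceT => x; rewrite inE/= in_itv/= => /andP[cx xb].
  have x0 : 0 < x by exact: lt_le_trans cx.
  apply/cvgrPdist_le => /= e e0; near=> y.
  have yx : x / 2 < y.
    near: y; apply: lt_nbhsr; lra.
  have y0 : 0 < y by apply: lt_trans yx; rewrite divr_gt0.
  apply: le_trans (wint_res_re_dist x0 y0) _.
  rewrite ler_pdivrMr ?mulr_gt0//.
  apply: (@le_trans _ _ (e * (x * (x / 2)))).
    near: y; apply: (@cvgr_dist_le _ _ _ _ _ (@id R)); first exact: cvg_id.
    by rewrite !mulr_gt0// invr_gt0.
  by rewrite ler_wpM2l ?(ltW e0)// ler_wpM2l ?(ltW x0)// ltW.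
have [|a + fa] := @IVT _ f c b t cb cf.
  by rewrite ge_min fb orbT /= le_max tc.
rewrite in_itv/= => /andP[ca _]; exists a => //.
exact: lt_le_trans ca.
Unshelve. all: end_near. Qed.

End density.

(** * Lipschitz functions and the grid on the unit interval *)

Section wint_sum.
Context d (T : measurableType d) (R : realType).
Variables (mu : {measure set T -> \bar R}) (D : set T) (w : T -> R).
Hypothesis pw : prob_weight mu D w.

Lemma wL1_sum (I : Type) (r : seq I) (P : pred I) (f : I -> T -> R) :
  (forall i, wL1 mu D w (f i)) -> wL1 mu D w (fun x => \sum_(i <- r | P i) f i x).
Proof.
move=> Lf; elim: r => [|i r IH].
  rewrite (_ : (fun _ => _) = cst 0); first exact: wL1_cst.
  by apply/funext => x; rewrite big_nil.
case: (boolP (P i)) => Pi.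
  rewrite (_ : (fun _ => _) = fun x => f i x + \sum_(i <- r | P i) f i x).
    exact: wL1D.
  by apply/funext => x; rewrite big_cons Pi.
rewrite (_ : (fun _ => _) = fun x => \sum_(i <- r | P i) f i x)//.
by apply/funext => x; rewrite big_cons (negbTE Pi).
Qed.

Lemma wint_sum (I : Type) (r : seq I) (P : pred I) (f : I -> T -> R) :
  (forall i, wL1 mu D w (f i)) ->
  wint mu D w (fun x => \sum_(i <- r | P i) f i x) =
  \sum_(i <- r | P i) wint mu D w (f i).
Proof.
move=> Lf; elim: r => [|i r IH].
  rewrite (_ : (fun _ => _) = cst 0) ?wint_cst ?big_nil//.
  by apply/funext => x; rewrite big_nil.
case: (boolP (P i)) => Pi.
  rewrite (_ : (fun _ => _) = fun x => f i x + \sum_(i <- r | P i) f i x).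
    rewrite wintD//; last exact: wL1_sum.
    by rewrite IH big_cons Pi.
  by apply/funext => x; rewrite big_cons Pi.
rewrite (_ : (fun _ => _) = fun x => \sum_(i <- r | P i) f i x).
  by rewrite IH big_cons (negbTE Pi).
by apply/funext => x; rewrite big_cons (negbTE Pi).
Qed.

End wint_sum.

Lemma le0_div_natS (R : realType) (x C : R) :
  (forall n, x <= C / n.+1%:R) -> x <= 0.
Proof.
move=> xC; rewrite leNgt; apply/negP => x0.
have C0 : 0 <= C / x by rewrite divr_ge0 ?(ltW x0)//; have := xC 0%N; rewrite divr1; lra.
have := archi_boundP C0; set n := Num.bound _ => Cn.
have := xC n; rewrite ler_pdivlMr ?ltr0n// leNgt => /negP; apply.
rewrite ltr_pdivrMr// in Cn; apply: lt_le_trans Cn _.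
by rewrite mulrC ler_wpM2l ?(ltW x0)// ler_nat.
Qed.

Section unit_interval.
Context (R : realType).
Local Notation leb := (@lebesgue_measure R).
Local Notation I01 := (@unitI R).
Local Notation wI := (wint leb I01 (cst 1)).
Local Notation L1I := (wL1 leb I01 (cst 1)).

Lemma unitIP (x : R) : I01 x <-> 0 <= x <= 1.
Proof. by rewrite /unitI/= in_itv. Qed.

Lemma measurable_unitI : measurable I01.
Proof. exact: measurable_itv. Qed.

Lemma unit_weight : prob_weight leb I01 (cst 1).
Proof.
split=> //; first exact: measurable_unitI.
rewrite (_ : (\int[leb]_(x in I01) (cst 1 x)%:E)%E = (\int[leb]_(x in I01) (cst 1%E x))%E)//.
rewrite integral_cst; last exact: measurable_unitI.
have := @lebesgue_measure_itv R `[0, 1].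
by rewrite /= lte01 oppr0 adde0 mul1e => <-.
Qed.
Let pw := unit_weight.

Definition lipI (f : R -> R) (C : R) : Prop :=
  forall x y, I01 x -> I01 y -> `|f x - f y| <= C * `|x - y|.

(** The function extends continuously to the line by clipping its argument. *)
Lemma lipI_measurable f C : lipI f C -> measurable_fun I01 f.
Proof.
move=> fC; have C1 : 0 < `|C| + 1 by rewrite ltr_wpDl.
pose cl (x : R) : R := Num.max 0 (Num.min x 1).
have clI x : I01 (cl x) by rewrite unitIP /cl le_max lexx ge_max ler01 ge_min lexx orbT.
have cl_id x : I01 x -> cl x = x.
  by move=> /unitIP/andP[x0 x1]; rewrite /cl (min_idPl x1) (max_idPr x0).
have cl_dist x y : `|cl x - cl y| <= `|x - y|.
  rewrite /cl; case: (lerP x 1); case: (lerP y 1); case: (lerP 0 x); case: (lerP 0 y) => *;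
    rewrite ?(max_idPr ler01) ?subrr ?normr0//; try lra;
    case: (ger0P (x - y)) => *; case: ger0P => *; try lra.
apply: (@eq_measurable_fun _ _ _ _ _ (f \o cl)).
  by move=> x; rewrite inE => Ix /=; rewrite cl_id.
apply: measurable_funTS; apply: continuous_measurable_fun => x.
apply/cvgrPdist_lt => /= e e0; near=> y.
apply: le_lt_trans (fC _ _ (clI _) (clI _)) _.
apply: (@le_lt_trans _ _ ((`|C| + 1) * `|x - y|)).
  apply: (@le_trans _ _ ((`|C| + 1) * `|cl x - cl y|)).
    by rewrite ler_wpM2r//; apply: le_trans (ler_norm _) _; rewrite lerDl.
  by rewrite ler_wpM2l ?(ltW C1)// cl_dist.
rewrite mulrC -ltr_pdivlMr//.
near: y; apply: (@cvgr_dist_lt _ _ _ _ _ (@id R)); first exact: cvg_id.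
by rewrite divr_gt0.
Unshelve. all: end_near. Qed.

Lemma lipI_bnd f C : lipI f C -> forall x, I01 x -> `|f x| <= `|f 0| + `|C|.
Proof.
move=> fC x Ix; have I0 : I01 0 by rewrite unitIP lexx ler01.
rewrite -[f x](subrK (f 0)) addrC; apply: le_trans (ler_normD _ _) _.
rewrite lerD2l; apply: le_trans (fC _ _ Ix I0) _; rewrite subr0.
move: Ix => /unitIP/andP[x0 x1]; rewrite (ger0_norm x0).
have := ler_norm C; have := normr_ge0 C; nra.
Qed.

Lemma lipI_L1 f C : lipI f C -> L1I f.
Proof.
move=> fC; apply: (wL1_bnd pw (B := `|f 0| + `|C|)); first exact: lipI_measurable fC.
exact: lipI_bnd fC.
Qed.

(** The cells are half-open, so the point [1] lies in a cell of its own: cells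
[0 .. n.+1] are needed to cover the interval, whence the bounds [n.+2]. *)
Definition node n (j : nat) : R := j%:R / n.+1%:R.
Definition cell n (j : nat) : R -> R := \1_(`[node n j, node n j.+1[).
Definition cell_index n (x : R) : nat := Num.truncn (n.+1%:R * x).

Lemma cellE n j x : 0 <= x -> cell n j x = (cell_index n x == j)%:R.
Proof.
move=> x0; rewrite /cell indicE /cell_index truncn_eq; last by rewrite mulr_ge0.
congr (_%:R : R); congr nat_of_bool; apply/idP/idP.
  by rewrite inE/= in_itv/= /node ler_pdivrMr// ltr_pdivlMr// ![x * _]mulrC.
by rewrite inE/= in_itv/= /node ler_pdivrMr// ltr_pdivlMr// ![x * _]mulrC.
Qed.

Lemma measurable_cell n j : measurable_fun I01 (cell n j).
Proof. exact: measurable_indic. Qed.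

Lemma cell_le1 n j x : `|cell n j x| <= 1.
Proof. by rewrite /cell indicE; case: (_ \in _); rewrite ?normr1 ?normr0. Qed.

Lemma cell_index_lt n x : I01 x -> (cell_index n x < n.+2)%N.
Proof.
move=> /unitIP/andP[x0 x1]; rewrite truncn_lt_nat ?mulr_ge0//.
apply: (@le_lt_trans _ _ n.+1%:R); last by rewrite ltr_nat.
by rewrite -[leRHS]mulr1 ler_wpM2l.
Qed.

Lemma node_unitI n j : (j < n.+2)%N -> I01 (node n j).
Proof.
by move=> jn; rewrite unitIP /node divr_ge0//= ler_pdivrMr// mul1r ler_nat.
Qed.

Lemma cell_index_dist n x : I01 x -> `|x - node n (cell_index n x)| <= n.+1%:R^-1.
Proof.
move=> /unitIP/andP[x0 x1].
have /andP[h1 h2] := truncn_itv (mulr_ge0 (ler0n R n.+1) x0).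
rewrite /node /cell_index; set j := Num.truncn _ in h1 h2 *.
have N0 : (0 : R) < n.+1%:R by rewrite ltr0n.
rewrite (_ : x - j%:R / n.+1%:R = (n.+1%:R * x - j%:R) / n.+1%:R); last first.
  by field; rewrite gt_eqF.
rewrite normrM normfV (gtr0_norm N0) ler_piMl ?invr_ge0 ?(ltW N0)//.
by rewrite ger0_norm ?subr_ge0// lerBlDl natr1 ltW.
Qed.

Lemma sum_cell n (u : nat -> R) x : I01 x ->
  \sum_(j < n.+2) u j * cell n j x = u (cell_index n x).
Proof.
move=> Ix; have x0 : 0 <= x by move: Ix => /unitIP/andP[].
rewrite (bigD1 (Ordinal (cell_index_lt n Ix)))//= cellE// eqxx mulr1 big1 ?addr0//.
move=> i /negP ij; rewrite cellE//; case: eqP; rewrite ?mulr0// => E.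
by exfalso; apply: ij; apply/eqP/val_inj.
Qed.

End unit_interval.

(** * The integral operator with a Lipschitz kernel *)

Section kernel.
Context (R : realType).
Variables (W : R -> R -> R) (M L : R).
Local Notation leb := (@lebesgue_measure R).
Local Notation I01 := (@unitI R).
Local Notation wI := (wint leb I01 (cst 1)).
Local Notation L1I := (wL1 leb I01 (cst 1)).
Let pw := unit_weight R.

Definition lip_kernel : Prop := [/\ 0 <= M, 0 <= L,
  forall x y, I01 x -> I01 y -> `|W x y| <= M,
  forall x x' y, I01 x -> I01 x' -> I01 y -> `|W x y - W x' y| <= L * `|x - x'| &
  forall x y, I01 x -> I01 y -> W x y = W y x].

Definition kop (f : R -> R) (x : R) : R := wI (fun y => W x y * f y).

Hypothesis HW : lip_kernel.

Let M0 : 0 <= M. Proof. by case: HW. Qed.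
Let L0 : 0 <= L. Proof. by case: HW. Qed.
Let WM x y : I01 x -> I01 y -> `|W x y| <= M. Proof. by case: HW => _ _ H _ _; exact: H. Qed.
Let WL x x' y : I01 x -> I01 x' -> I01 y -> `|W x y - W x' y| <= L * `|x - x'|.
Proof. by case: HW => _ _ _ H _; exact: H. Qed.
Let Wsym x y : I01 x -> I01 y -> W x y = W y x.
Proof. by case: HW => _ _ _ _ H; exact: H. Qed.

Lemma kernel_measurable x : I01 x -> measurable_fun I01 (W x).
Proof.
move=> Ix; apply: (@lipI_measurable _ _ L) => y y' Iy Iy'.
by rewrite (Wsym Ix Iy) (Wsym Ix Iy'); exact: WL.
Qed.

Lemma kernelM_L1 x f : I01 x -> L1I f -> L1I (fun y => W x y * f y).
Proof.
move=> Ix; apply: (wL1_bndM pw (B := M)); first exact: kernel_measurable.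
by move=> y Iy; exact: WM.
Qed.

Lemma kopD f h x : I01 x -> L1I f -> L1I h ->
  kop (fun y => f y + h y) x = kop f x + kop h x.
Proof.
move=> Ix Lf Lh; rewrite /kop -(wintD pw); [|exact: kernelM_L1|exact: kernelM_L1].
by congr wint; apply/funext => y; rewrite mulrDr.
Qed.

Lemma kopZ c f x : I01 x -> L1I f -> kop (fun y => c * f y) x = c * kop f x.
Proof.
move=> Ix Lf; rewrite /kop -(wintZ pw); last exact: kernelM_L1.
by congr wint; apply/funext => y; rewrite mulrCA.
Qed.

Lemma eq_kop f h x : (forall y, I01 y -> f y = h y) -> kop f x = kop h x.
Proof. by move=> fh; apply: eq_wint => y Iy; rewrite fh. Qed.

Lemma kop_bnd f x : I01 x -> L1I f -> `|kop f x| <= M * wI (fun y => `|f y|).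
Proof.
move=> Ix Lf; have Lf' := wL1_norm pw Lf.
rewrite -(wintZ pw)//; apply: (le_norm_wint pw).
- exact: kernelM_L1.
- exact: (wL1Z pw).
- by move=> y Iy; rewrite normrM ler_wpM2r// WM.
Qed.

Lemma kop_lip f : L1I f -> lipI (kop f) (L * wI (fun y => `|f y|)).
Proof.
move=> Lf x x' Ix Ix'; have Lf' := wL1_norm pw Lf.
rewrite /kop -(wintB pw); [|exact: kernelM_L1|exact: kernelM_L1].
rewrite mulrAC -(wintZ pw)//; apply: (le_norm_wint pw).
- by apply: (wL1B pw); exact: kernelM_L1.
- exact: (wL1Z pw).
- by move=> y Iy; rewrite -mulrBl normrM ler_wpM2r// WL.
Qed.

Lemma wint_norm_bnd (f : R -> R) B : measurable_fun I01 f ->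
  (forall y, I01 y -> `|f y| <= B) -> wI (fun y => `|f y|) <= B.
Proof.
move=> mf fB; rewrite -(wint_cst pw B); apply: (le_wint pw) => //.
  exact/(wL1_norm pw)/(wL1_bnd pw mf fB).
exact: wL1_cst.
Qed.

(** The symmetry of the kernel, by discretizing one variable instead of exchanging
the integrals: with that variable at the nodes of a grid both sides become the
same finite sum, and the Lipschitz bound makes the error [O(1 / n)]. *)
Lemma kop_sym f h : L1I f -> L1I h ->
  wI (fun x => f x * kop h x) = wI (fun x => h x * kop f x).
Proof.
move=> Lf Lh.
set F := wI (fun y => `|f y|); set H := wI (fun y => `|h y|).
have F0 : 0 <= F by apply: (wint_ge0 pw).
have H0 : 0 <= H by apply: (wint_ge0 pw).
have kL1 u : L1I u -> L1I (kop u) by move=> /kop_lip; exact: lipI_L1.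
have MkL1 u v : L1I u -> L1I v -> L1I (fun x => u x * kop v x).
  move=> Lu Lv; rewrite (_ : (fun x => _) = fun x => kop v x * u x).
    apply: (wL1_bndM pw (B := M * wI (fun y => `|v y|))) => //.
      exact: lipI_measurable (kop_lip Lv).
    by move=> x Ix; exact: kop_bnd.
  by apply/funext => x; rewrite mulrC.
have cL1 n j u : L1I u -> L1I (fun x => cell n j x * u x).
  apply: (wL1_bndM pw (B := 1)) => [|x _]; first exact: measurable_cell.
  exact: cell_le1.
have key n : `|wI (fun x => f x * kop h x) - wI (fun x => h x * kop f x)|
    <= (L * F * H *+ 2) / n.+1%:R.
  have N0 : (0 : R) < n.+1%:R by rewrite ltr0n.
  pose hj j := wI (fun y => cell n j y * h y).
  (* [S] freezes [y] at a node in [kop h]; [P] freezes [x] at a node in [kop f] *)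
  pose S x := \sum_(j < n.+2) hj j * W (node R n j) x.
  pose P x := \sum_(j < n.+2) kop f (node R n j) * cell n j x.
  have fSE : (fun x => f x * S x) =
      fun x => \sum_(j < n.+2) hj j * (W (node R n j) x * f x).
    by apply/funext => x; rewrite mulr_sumr; apply: eq_bigr => j _; ring.
  have hPE : (fun x => h x * P x) =
      fun x => \sum_(j < n.+2) kop f (node R n j) * (cell n j x * h x).
    by apply/funext => x; rewrite mulr_sumr; apply: eq_bigr => j _; ring.
  have fSL1 : L1I (fun x => f x * S x).
    rewrite fSE; apply: (wL1_sum pw) => j; apply/(wL1Z pw)/kernelM_L1 => //.
    exact: node_unitI.
  have hPL1 : L1I (fun x => h x * P x).
    by rewrite hPE; apply: (wL1_sum pw) => j; apply/(wL1Z pw)/cL1.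
  have mid : wI (fun x => f x * S x) = wI (fun x => h x * P x).
    have Ij (j : 'I_n.+2) : I01 (node R n j) by exact: node_unitI.
    rewrite fSE hPE !(wint_sum pw).
    - apply: eq_bigr => j _; rewrite !(wintZ pw) 1?mulrC//; first exact: cL1.
      exact: kernelM_L1.
    - by move=> j; apply/(wL1Z pw)/cL1.
    - by move=> j; apply/(wL1Z pw)/kernelM_L1.
  have SE x : I01 x -> `|kop h x - S x| <= L * H / n.+1%:R.
    move=> Ix; have -> : S x = wI (fun y => \sum_(j < n.+2) W (node R n j) x * (cell n j y * h y)).
      rewrite (wint_sum pw); last by move=> j; apply/(wL1Z pw)/cL1.
      by apply: eq_bigr => j _; rewrite (wintZ pw); [rewrite [RHS]mulrC|exact: cL1].
    have LS : L1I (fun y => \sum_(j < n.+2) W (node R n j) x * (cell n j y * h y)).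
      by apply: (wL1_sum pw) => j; apply/(wL1Z pw)/cL1.
    have LH := wL1_norm pw Lh.
    rewrite -(wintB pw)//; last exact: kernelM_L1.
    rewrite mulrAC -(wintZ pw)//; apply: (le_norm_wint pw).
    - by apply: (wL1B pw) => //; exact: kernelM_L1.
    - exact: (wL1Z pw).
    move=> y Iy.
    rewrite (_ : \sum_(j < n.+2) _ = W (node R n (cell_index n y)) x * h y); last first.
      rewrite -(sum_cell n (fun j => W (node R n j) x) Iy) mulr_suml.
      by apply: eq_bigr => j _; rewrite mulrA.
    have Ij := node_unitI R (cell_index_lt n Iy).
    rewrite -mulrBl normrM ler_wpM2r// (Wsym Ix Iy).
    by apply: le_trans (WL Iy Ij Ix) _; rewrite ler_wpM2l// cell_index_dist.
  have PE x : I01 x -> `|kop f x - P x| <= L * F / n.+1%:R.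
    move=> Ix; rewrite /P (sum_cell n (fun j => kop f (node R n j)) Ix).
    have Ij := node_unitI R (cell_index_lt n Ix).
    apply: le_trans (kop_lip Lf Ix Ij) _.
    by rewrite ler_wpM2l ?mulr_ge0// cell_index_dist.
  have step u v w B : L1I u -> L1I (fun x => u x * v x) -> L1I (fun x => u x * w x) ->
      (forall x, I01 x -> `|v x - w x| <= B) ->
      `|wI (fun x => u x * v x) - wI (fun x => u x * w x)| <= B * wI (fun x => `|u x|).
    move=> Lu Luv Luw vw; have Lu' := wL1_norm pw Lu.
    rewrite -(wintB pw)// -(wintZ pw)//; apply: (le_norm_wint pw).
    - exact: (wL1B pw).
    - exact: (wL1Z pw).
    - by move=> x Ix; rewrite -mulrBr normrM mulrC ler_wpM2r// vw.
  have s1 : `|wI (fun x => f x * kop h x) - wI (fun x => f x * S x)| <=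
      L * H / n.+1%:R * F := step f (kop h) S _ Lf (MkL1 _ _ Lf Lh) fSL1 SE.
  have s2 : `|wI (fun x => h x * kop f x) - wI (fun x => h x * P x)| <=
      L * F / n.+1%:R * H := step h (kop f) P _ Lh (MkL1 _ _ Lh Lf) hPL1 PE.
  apply: le_trans (ler_distD (wI (fun x => f x * S x)) _ _) _.
  rewrite [X in _ + X]distrC mid; apply: le_trans (lerD _ s2) _.
    by rewrite -mid; exact: s1.
  rewrite le_eqVlt; apply/orP; left; apply/eqP; set v := _^-1; ring.
apply/eqP; rewrite -subr_eq0 -normr_le0.
exact: le0_div_natS key.
Qed.

End kernel.

(** * Complex moduli *)

Section complex_modulus.
Context (R : realType).
Implicit Types z u : R[i].

Lemma cnormE z : normc z = Num.sqrt (csqr_norm z).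
Proof. by case: z. Qed.

Lemma csqr_norm_ge0 z : 0 <= csqr_norm z.
Proof. by rewrite /csqr_norm addr_ge0// sqr_ge0. Qed.

Lemma normc_sqr z : normc z ^+ 2 = csqr_norm z.
Proof. by rewrite cnormE sqr_sqrtr// csqr_norm_ge0. Qed.

Lemma normc_ge0 z : 0 <= normc z.
Proof. by rewrite cnormE sqrtr_ge0. Qed.

Lemma cReD z u : complex.Re (z + u) = complex.Re z + complex.Re u.
Proof. by case: z u => [? ?] []. Qed.
Lemma cImD z u : complex.Im (z + u) = complex.Im z + complex.Im u.
Proof. by case: z u => [? ?] []. Qed.
Lemma cReN z : complex.Re (- z) = - complex.Re z.
Proof. by case: z. Qed.
Lemma cImN z : complex.Im (- z) = - complex.Im z.
Proof. by case: z. Qed.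
Lemma cReM z u : complex.Re (z * u) =
  complex.Re z * complex.Re u - complex.Im z * complex.Im u.
Proof. by case: z u => [? ?] []. Qed.
Lemma cImM z u : complex.Im (z * u) =
  complex.Re z * complex.Im u + complex.Im z * complex.Re u.
Proof. by case: z u => [? ?] []. Qed.

Definition ReImE := (cReD, cImD, cReN, cImN, cReM, cImM).

Lemma complex_ext z u : complex.Re z = complex.Re u ->
  complex.Im z = complex.Im u -> z = u.
Proof. by case: z u => [? ?] [? ?] /= -> ->. Qed.

Lemma cnorm_ge_Re z : `|complex.Re z| <= normc z.
Proof. by rewrite cnormE -sqrtr_sqr ler_wsqrtr// lerDl sqr_ge0. Qed.

Lemma cnorm_ge_Im z : `|complex.Im z| <= normc z.
Proof. by rewrite cnormE -sqrtr_sqr ler_wsqrtr// lerDr sqr_ge0. Qed.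

Lemma normc_le z : normc z <= `|complex.Re z| + `|complex.Im z|.
Proof.
rewrite -(@ler_pXn2r _ 2) ?nnegrE ?normc_ge0 ?addr_ge0// normc_sqr /csqr_norm.
rewrite -(real_normK (num_real (complex.Re z))) -(real_normK (num_real (complex.Im z))).
by have := mulr_ge0 (normr_ge0 (complex.Re z)) (normr_ge0 (complex.Im z)); nra.
Qed.

Lemma normc_eq0 z : (normc z == 0) = (z == 0).
Proof.
apply/eqP/eqP => [/Normc.eq0_normc//|->]; exact: Normc.normc0.
Qed.

Lemma normc_gt0 z : (0 < normc z) = (z != 0).
Proof. by rewrite lt_neqAle eq_sym normc_eq0 normc_ge0 andbT. Qed.

Lemma normc_distC z u : normc (z - u) = normc (u - z).
Proof. by rewrite -normcN opprB. Qed.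

Lemma normc_real (a : R) : normc a%:C%C = `|a|.
Proof. by rewrite cnormE /csqr_norm/= expr0n addr0 sqrtr_sqr. Qed.

Lemma normc_le0_eq0 z : (forall e : R, 0 < e -> normc z <= e) -> z = 0.
Proof.
move=> H; apply/eqP; rewrite -normc_eq0 eq_le normc_ge0 andbT.
by apply/ler_addgt0Pr => e e0; rewrite add0r H.
Qed.

End complex_modulus.

(** * Limits of bounded sequences along an ultrafilter *)

Section ultralimit.
Context (R : realType) (U : set_system nat).
Hypothesis UU : UltraFilter U.

(** The limit is the supremum of the numbers that eventually (for [U]) bound [a]
from below. *)
Lemma ultralimit (a : nat -> R) (B : R) : (forall n, `|a n| <= B) ->
  exists l, forall e, 0 < e -> U [set n | `|a n - l| <= e].
Proof.
move=> aB; pose S := [set t : R | U [set n | t <= a n]].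
have UT : U setT by exact: filterT.
have SB : S (- B).
  by apply: filterS UT => n _ /=; have := aB n; rewrite ler_norml => /andP[].
have uS : ubound S B.
  move=> t St; have [n /= tn] := filter_ex St.
  by apply: le_trans tn _; have := aB n; rewrite ler_norml => /andP[].
have hS : has_sup S by split; [exists (- B)|exists B].
exists (sup S) => e e0.
have [t St te] := sup_adherent e0 hS.
have U2 : U [set n | a n < sup S + e].
  have [//|H] := in_ultra_setVsetC [set n | a n < sup S + e] UU.
  have : S (sup S + e).
    by apply: filterS H => n /= /negP; rewrite -leNgt.
  move=> /(ub_le_sup (proj2 hS)) H'; exfalso; lra.
by apply: filterS2 St U2 => n /= h1 h2; rewrite ler_norml; apply/andP; split; lra.
Qed.

Lemma ultralimitc (a : nat -> R[i]) (B : R) : (forall n, normc (a n) <= B) ->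
  exists l, forall e, 0 < e -> U [set n | normc (a n - l) <= e].
Proof.
move=> aB.
have [l1 H1] : exists l, forall e, 0 < e -> U [set n | `|complex.Re (a n) - l| <= e].
  by apply: (@ultralimit _ B) => n; exact: le_trans (cnorm_ge_Re _) _.
have [l2 H2] : exists l, forall e, 0 < e -> U [set n | `|complex.Im (a n) - l| <= e].
  by apply: (@ultralimit _ B) => n; exact: le_trans (cnorm_ge_Im _) _.
exists (l1 +i* l2)%C => e e0.
have e2 : 0 < e / 2 by rewrite divr_gt0.
apply: filterS2 (H1 _ e2) (H2 _ e2) => n /= h1 h2.
apply: le_trans (normc_le _) _; rewrite !ReImE /=; lra.
Qed.

End ultralimit.

(** The function stays away from zero on a subinterval of positive length; this
converts pointwise nonvanishing into nonvanishing as a vector. *)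
Lemma lipI_sq_gt0 (R : realType) (f : R -> R) C x0 : lipI f C -> unitI x0 ->
  f x0 != 0 -> 0 < wint (@lebesgue_measure R) (@unitI R) (cst 1) (fun x => f x * f x).
Proof.
move=> fC Ix0 f0; have pw := unit_weight R.
have a0 : 0 < `|f x0| by rewrite normr_gt0.
have C1 : 0 < `|C| + 1 by rewrite ltr_wpDl.
pose d := `|f x0| / 2 / (`|C| + 1).
have d0 : 0 < d by rewrite /d !divr_gt0.
have /unitIP/andP[x00 x01] := Ix0.
pose u := Num.max 0 (x0 - d); pose v := Num.min 1 (x0 + d).
have u0 : 0 <= u by rewrite /u le_max lexx.
have v1 : v <= 1 by rewrite /v ge_min lexx.
have uv : u < v.
  by rewrite /u /v gt_max !lt_min ltr01/=; apply/andP; split; [|apply/andP; split]; lra.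
have mf := lipI_measurable fC.
have Lff : wL1 (@lebesgue_measure R) (@unitI R) (cst 1) (fun x => f x * f x).
  by apply: (wL1_bndM pw mf _ (lipI_L1 fC)) => x; exact: lipI_bnd fC x.
have c0 : 0 < `|f x0| ^+ 2 / 4 by rewrite divr_gt0// exprn_gt0.
apply: (@lt_le_trans _ _ (`|f x0| ^+ 2 / 4 * (v - u))).
  by rewrite mulr_gt0// subr_gt0.
rewrite -lee_fin (wintE pw Lff).
apply: integral_ge_itv => //.
- exact: measurable_unitI.
- by apply: measurable_funM => //; exact: measurable_funM.
- by move=> x _; rewrite mulr1 -expr2 sqr_ge0.
- exact: ltW.
- by move=> x; rewrite /unitI /= !in_itv/= => /andP[ux xv]; apply/andP; split; lra.
- move=> x /andP[ux xv].
  have Ix : unitI x by rewrite unitIP; apply/andP; split; lra.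
  have xd : `|x0 - x| <= d.
    rewrite /u ge_max in ux; rewrite /v le_min in xv.
    by move: ux xv => /andP[_ ux] /andP[_ xv]; rewrite ler_norml; apply/andP; split; lra.
  have h1 : `|f x0 - f x| <= `|f x0| / 2.
    apply: le_trans (fC _ _ Ix0 Ix) _.
    apply: (@le_trans _ _ ((`|C| + 1) * d)).
      apply: (@le_trans _ _ ((`|C| + 1) * `|x0 - x|)); last by rewrite ler_wpM2l// ltW.
      by rewrite ler_wpM2r//; apply: le_trans (ler_norm _) _; rewrite lerDl.
    by rewrite /d mulrC divfK// gt_eqF.
  have h2 : `|f x0| / 2 <= `|f x|.
    by have := ler_normD (f x0 - f x) (f x); rewrite subrK; lra.
  rewrite mulr1 -expr2 -(real_normK (num_real (f x))); nra.
Qed.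

(** * The Fredholm alternative *)

Section complex_kernel.
Context (R : realType).
Variables (W : R -> R -> R) (M L : R).
Local Notation leb := (@lebesgue_measure R).
Local Notation I01 := (@unitI R).
Local Notation wI := (wint leb I01 (cst 1)).
Local Notation L1I := (wL1 leb I01 (cst 1)).
Hypothesis HW : lip_kernel W M L.
Let pw := unit_weight R.

Let M0 : 0 <= M. Proof. by case: HW. Qed.
Let L0 : 0 <= L. Proof. by case: HW. Qed.

Definition ckop (p : R -> R[i]) (x : R) : R[i] :=
  (kop W (fun y => complex.Re (p y)) x +i* kop W (fun y => complex.Im (p y)) x)%C.

Definition bddI (p : R -> R[i]) (B : R) : Prop :=
  [/\ measurable_fun I01 (fun y => complex.Re (p y)),
      measurable_fun I01 (fun y => complex.Im (p y)) &
      forall x, I01 x -> normc (p x) <= B].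

Definition clipI (p : R -> R[i]) (C : R) : Prop :=
  forall x y, I01 x -> I01 y -> normc (p x - p y) <= C * `|x - y|.

Lemma clipI_bdd p C : clipI p C -> bddI p (normc (p 0) + `|C|).
Proof.
move=> pC; split.
- apply: (@lipI_measurable _ _ C) => x y Ix Iy.
  by rewrite -cReN -cReD; apply: le_trans (cnorm_ge_Re _) _; exact: pC.
- apply: (@lipI_measurable _ _ C) => x y Ix Iy.
  by rewrite -cImN -cImD; apply: le_trans (cnorm_ge_Im _) _; exact: pC.
- move=> x Ix; have I0 : I01 0 by rewrite unitIP lexx ler01.
  rewrite -[p x](subrK (p 0)) addrC; apply: le_trans (le_normcD _ _) _.
  rewrite lerD2l; apply: le_trans (pC _ _ Ix I0) _; rewrite subr0.
  move: Ix => /unitIP/andP[x0 x1]; rewrite (ger0_norm x0).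
  have := ler_norm C; have := normr_ge0 C; nra.
Qed.

Lemma bddI_L1 p B : bddI p B ->
  L1I (fun y => complex.Re (p y)) /\ L1I (fun y => complex.Im (p y)).
Proof.
move=> [m1 m2 pB]; split; apply: (wL1_bnd pw (B := B)) => // x Ix.
  exact: le_trans (cnorm_ge_Re _) (pB _ Ix).
exact: le_trans (cnorm_ge_Im _) (pB _ Ix).
Qed.

Lemma bddID p B p' B' : bddI p B -> bddI p' B' -> bddI (fun x => p x + p' x) (B + B').
Proof.
move=> [m1 m2 pB] [m1' m2' pB']; split.
- rewrite (_ : (fun y => _) = fun y => complex.Re (p y) + complex.Re (p' y)).
    exact: measurable_funD.
  by apply/funext => y; rewrite cReD.
- rewrite (_ : (fun y => _) = fun y => complex.Im (p y) + complex.Im (p' y)).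
    exact: measurable_funD.
  by apply/funext => y; rewrite cImD.
- by move=> x Ix; apply: le_trans (le_normcD _ _) _; rewrite lerD ?pB ?pB'.
Qed.

Lemma bddIZ c p B : bddI p B -> bddI (fun x => c * p x) (normc c * B).
Proof.
move=> [m1 m2 pB]; split.
- rewrite (_ : (fun y => _) = fun y =>
    complex.Re c * complex.Re (p y) - complex.Im c * complex.Im (p y)).
    by apply: measurable_funB; apply: measurable_funM => //; exact: measurable_cst.
  by apply/funext => y; rewrite cReM.
- rewrite (_ : (fun y => _) = fun y =>
    complex.Re c * complex.Im (p y) + complex.Im c * complex.Re (p y)).
    by apply: measurable_funD; apply: measurable_funM => //; exact: measurable_cst.
  by apply/funext => y; rewrite cImM.
- by move=> x Ix; rewrite Normc.normcM ler_wpM2l ?normc_ge0// pB.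
Qed.

Lemma ckopD p B p' B' x : I01 x -> bddI p B -> bddI p' B' ->
  ckop (fun y => p y + p' y) x = ckop p x + ckop p' x.
Proof.
move=> Ix /bddI_L1[a1 a2] /bddI_L1[b1 b2]; apply: complex_ext; rewrite ReImE /=.
  by rewrite -(kopD HW)//; apply: eq_kop => y _; rewrite cReD.
by rewrite -(kopD HW)//; apply: eq_kop => y _; rewrite cImD.
Qed.

Lemma ckopZ c p B x : I01 x -> bddI p B -> ckop (fun y => c * p y) x = c * ckop p x.
Proof.
move=> Ix /bddI_L1[a1 a2]; apply: complex_ext; rewrite ReImE /=.
  rewrite -!(kopZ HW)// -mulN1r -(kopZ HW)//; last exact: (wL1Z pw).
  rewrite -(kopD HW)//; [|exact: (wL1Z pw)|by do 2 apply: (wL1Z pw)].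
  by apply: eq_kop => y _; rewrite cReM mulN1r.
rewrite -!(kopZ HW)// -(kopD HW)//; [|exact: (wL1Z pw)|exact: (wL1Z pw)].
by apply: eq_kop => y _; rewrite cImM.
Qed.

Lemma ckop_bnd p B x : I01 x -> bddI p B -> normc (ckop p x) <= 2 * M * B.
Proof.
move=> Ix pB; have [a1 a2] := bddI_L1 pB; have [m1 m2 b] := pB.
apply: le_trans (normc_le _) _ => /=.
rewrite (_ : 2 * M * B = M * B + M * B); last by ring.
apply: lerD; apply: le_trans (kop_bnd HW Ix _) _ => //; apply: ler_wpM2l => //.
  by apply: wint_norm_bnd => // y Iy; exact: le_trans (cnorm_ge_Re _) (b _ Iy).
by apply: wint_norm_bnd => // y Iy; exact: le_trans (cnorm_ge_Im _) (b _ Iy).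
Qed.

Lemma ckop_lip p B : bddI p B -> clipI (ckop p) (2 * L * B).
Proof.
move=> pB x y Ix Iy; have [a1 a2] := bddI_L1 pB; have [m1 m2 b] := pB.
apply: le_trans (normc_le _) _; rewrite !ReImE /=.
rewrite (_ : 2 * L * B * _ = L * B * `|x - y| + L * B * `|x - y|); last by ring.
apply: lerD; apply: le_trans (kop_lip HW _ Ix Iy) _ => //;
    apply: ler_wpM2r => //; apply: ler_wpM2l => //.
  by apply: wint_norm_bnd => // z Iz; exact: le_trans (cnorm_ge_Re _) (b _ Iz).
by apply: wint_norm_bnd => // z Iz; exact: le_trans (cnorm_ge_Im _) (b _ Iz).
Qed.

Lemma clipI_ge0 p C : clipI p C -> 0 <= C.
Proof.
move=> pC; have I0 : I01 0 by rewrite unitIP lexx ler01.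
have I1 : I01 1 by rewrite unitIP lexx ler01.
have := pC 0 1 I0 I1; rewrite sub0r normrN normr1 mulr1.
by apply: le_trans; exact: normc_ge0.
Qed.

Lemma clipID p C p' C' : clipI p C -> clipI p' C' -> clipI (fun x => p x + p' x) (C + C').
Proof.
move=> pC pC' x y Ix Iy; rewrite opprD addrACA mulrDl.
by apply: le_trans (le_normcD _ _) _; rewrite lerD ?pC ?pC'.
Qed.

Lemma clipIZ c p C : clipI p C -> clipI (fun x => c * p x) (normc c * C).
Proof.
move=> pC x y Ix Iy; rewrite -mulrBr Normc.normcM -mulrA ler_wpM2l ?normc_ge0//.
exact: pC.
Qed.

(** Equi-Lipschitz functions converge uniformly along an ultrafilter: the
pointwise limit is Lipschitz, and a finite grid controls the whole interval. *)
Lemma ultralimit_unif (U : set_system nat) (u : nat -> R -> R[i]) (B C : R) :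
  UltraFilter U -> 0 <= C ->
  (forall n x, I01 x -> normc (u n x) <= B) -> (forall n, clipI (u n) C) ->
  exists2 v : R -> R[i], clipI v C &
    forall e, 0 < e -> U [set n | forall x, I01 x -> normc (u n x - v x) <= e].
Proof.
move=> UU C0 uB uC.
have /choice[v vP] : forall x, exists l, I01 x ->
    forall e, 0 < e -> U [set n | normc (u n x - l) <= e].
  move=> x; have [Ix|] := pselect (I01 x); last by exists 0.
  have [l lP] := ultralimitc UU (fun n => uB n x Ix).
  by exists l => _.
have vC : clipI v C.
  move=> x y Ix Iy; apply/ler_addgt0Pr => e e0.
  have e2 : 0 < e / 2 by rewrite divr_gt0.
  have [n [/= h1 h2]] := filter_ex (filterI (vP x Ix _ e2) (vP y Iy _ e2)).
  rewrite (_ : v x - v y = (u n x - u n y) + ((v x - u n x) + (u n y - v y))); last by ring.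
  apply: le_trans (le_normcD _ _) _; apply: lerD; first exact: uC.
  apply: le_trans (le_normcD _ _) _; rewrite [normc (v x - _)]normc_distC (splitr e).
  exact: lerD h1 h2.
exists v => // e e0.
pose m := Num.bound (3 * C / e).
have mC : C * m.+1%:R^-1 <= e / 3.
  have : 3 * C / e < m%:R by rewrite archi_boundP// divr_ge0 ?(ltW e0)// mulr_ge0.
  rewrite ltr_pdivrMr// ler_pdivrMr ?ltr0n// => h.
  have : (m%:R : R) <= m.+1%:R by rewrite ler_nat.
  by nra.
have e3 : 0 < e / 3 by rewrite divr_gt0.
have : U [set n | forall j : 'I_m.+2, normc (u n (node R m j) - v (node R m j)) <= e / 3].
  by apply: filter_forall => j; apply: vP => //; exact: node_unitI.
apply: filterS => n /= H x Ix.
have jl := cell_index_lt m Ix; set t := node R m (cell_index m x).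
have It : I01 t by exact: node_unitI.
have xt : C * `|x - t| <= e / 3.
  by apply: le_trans mC; rewrite ler_wpM2l// cell_index_dist.
rewrite (_ : u n x - v x = (u n x - u n t) + ((u n t - v t) + (v t - v x))); last by ring.
apply: le_trans (le_normcD _ _) _.
have h1 := le_trans (uC n x t Ix It) xt.
have h2 : normc (v t - v x) <= e / 3.
  by rewrite normc_distC; exact: le_trans (vC x t Ix It) xt.
have := H (Ordinal jl); rewrite /= -/t => h3.
rewrite (_ : e = e / 3 + (e / 3 + e / 3)); last by field.
apply: lerD => //; apply: le_trans (le_normcD _ _) _; exact: lerD h3 h2.
Qed.

(** Compactness.  The images [W (p n)] are equi-Lipschitz, so they converge
uniformly along an ultrafilter, and the equation carries the convergence over to
[p n] itself.  The scalars [s n] are carried along because collocation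
produces solutions that are homogeneous in the pair [(s, p)]; the lower bound
[eta] survives in the limit, in one of the two components. *)
Lemma approx_solution_cvg (c : R[i]) (cc s : nat -> R[i]) (q : R -> R[i]) (Q : R)
    (p : nat -> R -> R[i]) (eta : R) (e : nat -> R) :
  clipI q Q -> (forall n, bddI (p n) 1) -> (forall n, normc (s n) <= 1) ->
  (forall d, 0 < d -> \forall n \near \oo, normc (cc n - c) <= d) ->
  (forall d, 0 < d -> \forall n \near \oo, e n <= d) ->
  (forall n x, I01 x -> normc (p n x - (s n * q x + cc n * ckop (p n) x)) <= e n) ->
  0 < eta ->
  (forall n, eta <= normc (s n) \/ exists2 x, I01 x & eta <= normc (p n x)) ->
  exists s0, exists P, [/\ exists C, clipI P C,
    forall x, I01 x -> P x = s0 * q x + c * ckop P x,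
    (forall n, s n = 0) -> s0 = 0 &
    s0 != 0 \/ exists2 x, I01 x & P x != 0].
Proof.
move=> qQ p1 s1 ccc e0 pe eta0 big.
have [U [UU FU]] := ultraFilterLemma (@eventually_filter).
pose u n := ckop (p n).
have uB n x : I01 x -> normc (u n x) <= 2 * M * 1 by move=> Ix; exact: ckop_bnd.
have uC n : clipI (u n) (2 * L * 1) by exact: ckop_lip.
have C0 : 0 <= 2 * L * 1 by rewrite mulr1 mulr_ge0.
have [v vC vP] := ultralimit_unif UU C0 uB uC.
have [s0 sP] := ultralimitc UU s1.
have qb := clipI_bdd qQ; set B := normc (q 0) + `|Q| in qb.
have B0 : 0 <= B by rewrite addr_ge0// normc_ge0.
pose P x := s0 * q x + c * v x.
have PC : clipI P (normc s0 * Q + normc c * (2 * L * 1)).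
  by apply: clipID; apply: clipIZ.
have Pb := clipI_bdd PC.
have pP d : 0 < d -> U [set n | forall x, I01 x -> normc (p n x - P x) <= d].
  move=> d0; pose m := 1 + B + 2 * M + normc c; pose k := 4 * m.
  have m0 : 0 < m by rewrite /m; have := normc_ge0 c; have := M0; lra.
  have k0 : 0 < k by rewrite /k mulr_gt0.
  have dk : 0 < d / k by rewrite divr_gt0.
  have cdk := FU _ (ccc _ dk); have edk := FU _ (e0 _ dk).
  apply: filterS2 (filterI (vP _ dk) (sP _ dk)) (filterI cdk edk).
  move=> n [/= h1 h2] [h3 h4] x Ix.
  rewrite (_ : p n x - P x = (p n x - (s n * q x + cc n * u n x)) +
     ((s n - s0) * q x + ((cc n - c) * u n x + c * (u n x - v x)))); last by rewrite /P; ring.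
  apply: le_trans (le_normcD _ _) _.
  apply: (@le_trans _ _ (d / k + (d / k * B + (d / k * (2 * M * 1) + normc c * (d / k))))).
    apply: lerD; first exact: le_trans (pe n x Ix) h4.
    apply: le_trans (le_normcD _ _) _; rewrite Normc.normcM; apply: lerD.
      by case: qb => _ _ qb; apply: ler_pM => //; [exact: normc_ge0|exact: normc_ge0|exact: qb].
    apply: le_trans (le_normcD _ _) _; rewrite !Normc.normcM; apply: lerD.
      by apply: ler_pM => //; [exact: normc_ge0|exact: normc_ge0|exact: uB].
    by apply: ler_wpM2l; [exact: normc_ge0|exact: h1].
  have -> : d / k + (d / k * B + (d / k * (2 * M * 1) + normc c * (d / k))) = d / 4.
    transitivity (d / k * m); first by rewrite /m; ring.
    by rewrite /k; field; rewrite gt_eqF.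
  lra.
have vE x : I01 x -> v x = ckop P x.
  move=> Ix; apply/eqP; rewrite -subr_eq0; apply/eqP; apply: normc_le0_eq0 => d d0.
  pose k := 2 * (1 + 2 * M).
  have k0 : 0 < k by rewrite /k; have := M0; lra.
  have dk : 0 < d / k by rewrite divr_gt0.
  have [n [/= h1 h2]] := filter_ex (filterI (vP _ dk) (pP _ dk)).
  have dpb : bddI (fun y => p n y + (-1) * P y) (d / k).
    have [m1 m2 _] := bddID (p1 n) (bddIZ (-1) Pb).
    by split=> // y Iy; rewrite mulN1r; exact: h2.
  have -> : v x - ckop P x = (v x - u n x) + ckop (fun y => p n y + (-1) * P y) x.
    by rewrite (ckopD Ix (p1 n) (bddIZ (-1) Pb)) (ckopZ _ Ix Pb) /u; ring.
  apply: le_trans (le_normcD _ _) _.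
  apply: (@le_trans _ _ (d / k + 2 * M * (d / k))).
    by apply: lerD; [rewrite normc_distC; exact: h1|exact: ckop_bnd].
  rewrite (_ : _ + _ = d / 2); first by lra.
  by rewrite /k; field; rewrite gt_eqF//; have := M0; lra.
exists s0, P; split; first by eexists; exact: PC.
  by move=> x Ix; rewrite /P vE.
  move=> sn0; apply: normc_le0_eq0 => d d0; have [n /=] := filter_ex (sP _ d0).
  by rewrite sn0 sub0r normcN.
have [s00|s00] := eqVneq s0 0; last by left.
right; apply: contrapT => P0.
have PE x : I01 x -> P x = 0.
  by move=> Ix; apply/eqP/negPn/negP => Px; apply: P0; exists x.
have [n [/= h1 h2]] : exists n, normc (s n - s0) <= eta / 2 /\
    forall x, I01 x -> normc (p n x - P x) <= eta / 2.
  have eta2 : 0 < eta / 2 by rewrite divr_gt0.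
  by have [n [/= h1 h2]] := filter_ex (filterI (sP _ eta2) (pP _ eta2)); exists n.
case: (big n) => [h|[x Ix h]].
  by move: h1; rewrite s00 subr0; lra.
by have := h2 x Ix; rewrite PE// subr0; lra.
Qed.

Definition ckop_inj (c : R[i]) : Prop := forall P C, clipI P C ->
  (forall x, I01 x -> P x = c * ckop P x) -> forall x, I01 x -> P x = 0.

(** More unknowns than equations. *)
Lemma exists_kernel_row (F : fieldType) (m n : nat) (A : 'M[F]_(m, n)) :
  (n < m)%N -> exists2 v : 'rV[F]_m, v != 0 & v *m A = 0.
Proof.
move=> nm; exists (nz_row (kermx A)).
  rewrite nz_row_eq0 kermx_eq0 /row_free; apply/negP => /eqP rA.
  by have := rank_leq_col A; rewrite rA leqNgt nm.
by apply/sub_kermxP; exact: nz_row_sub.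
Qed.

(** The grid function with values [z j], on which collocation turns [W] into a
matrix. *)
Definition step n (z : nat -> R[i]) (x : R) : R[i] :=
  \sum_(j < n.+2) z j * (cell n j x)%:C%C.

Lemma stepE n z x : I01 x -> step n z x = z (cell_index n x).
Proof.
move=> Ix; apply: complex_ext; rewrite /step.
  rewrite -(sum_cell n (fun j => complex.Re (z j)) Ix).
  elim/big_ind2: _ => [//|? ? ? ? <- <-|j _]; first by rewrite cReD.
  by rewrite cReM /= mulr0 subr0.
rewrite -(sum_cell n (fun j => complex.Im (z j)) Ix).
elim/big_ind2: _ => [//|? ? ? ? <- <-|j _]; first by rewrite cImD.
by rewrite cImM /= mulr0 add0r.
Qed.

Lemma cell_bdd n j : bddI (fun x => (cell n j x)%:C%C) 1.
Proof.
split; [exact: measurable_cell|exact: measurable_cst|].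
by move=> x _; rewrite normc_real cell_le1.
Qed.

Lemma step_bdd n z B : (forall j, (j < n.+2)%N -> normc (z j) <= B) -> bddI (step n z) B.
Proof.
move=> zB.
have : bddI (step n z) (\sum_(j < n.+2) normc (z j) * 1).
  rewrite /step; elim: (index_enum _) => [|j r IH].
    rewrite (_ : (fun x => _) = fun=> 0); last by apply/funext => x; rewrite big_nil.
    by split=> [||x _]; [exact: measurable_cst|exact: measurable_cst|rewrite big_nil Normc.normc0].
  rewrite (_ : (fun x => _) = fun x => z j * (cell n j x)%:C%C + \sum_(j <- r) z j * (cell n j x)%:C%C).
    by rewrite big_cons; apply: bddID => //; apply: bddIZ; exact: cell_bdd.
  by apply/funext => x; rewrite big_cons.
by move=> [m1 m2 _]; split=> // x Ix; rewrite stepE// zB// cell_index_lt.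
Qed.

Lemma ckop_step n z x : I01 x ->
  ckop (step n z) x = \sum_(j < n.+2) z j * ckop (fun y => (cell n j y)%:C%C) x.
Proof.
move=> Ix; rewrite /step.
suff [_ ->] : (exists B, bddI (fun x => \sum_(j < n.+2) z j * (cell n j x)%:C%C) B) /\
   ckop (fun x => \sum_(j < n.+2) z j * (cell n j x)%:C%C) x =
   \sum_(j < n.+2) z j * ckop (fun y => (cell n j y)%:C%C) x by [].
elim: (index_enum _) => [|j r [[B IB] IH]].
  rewrite (_ : (fun x => _) = fun y => 0 * (cell n 0 y)%:C%C); last first.
    by apply/funext => y; rewrite big_nil mul0r.
  split; first by eexists; apply: bddIZ; exact: cell_bdd.
  by rewrite (ckopZ _ Ix (cell_bdd _ _)) mul0r big_nil.
rewrite (_ : (fun x => _) = fun x => z j * (cell n j x)%:C%C + \sum_(j <- r) z j * (cell n j x)%:C%C).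
  have zb := bddIZ (z j) (cell_bdd n j).
  split; first by eexists; apply: bddID; [exact: zb|exact: IB].
  by rewrite (ckopD Ix zb IB) IH (ckopZ _ Ix (cell_bdd _ _)) big_cons.
by apply/funext => y; rewrite big_cons.
Qed.

Lemma cell_index_node n j : cell_index n (node R n j) = j.
Proof. by rewrite /cell_index /node mulrCA divff ?pnatr_eq0// mulr1 natrK. Qed.

(** The equations at the [n.+2] nodes are homogeneous in the [n.+3] unknowns
[(s, z)], so they have a nonzero solution; it is scaled to maximum modulus [1]. *)
Lemma collocation (c : R[i]) (q : R -> R[i]) n : exists s z,
  [/\ forall j, (j < n.+2)%N -> normc (z j) <= 1, normc s <= 1,
   normc s = 1 \/ exists2 j, (j < n.+2)%N & normc (z j) = 1 &
   forall j, (j < n.+2)%N ->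
     z j = s * q (node R n j) + c * ckop (step n z) (node R n j)].
Proof.
pose a (j i : 'I_n.+2) := ckop (fun y => (cell n j y)%:C%C) (node R n i).
pose A : 'M[R[i]]_(1 + n.+2, n.+2) := col_mx (\row_i (- q (node R n i)))
   (\matrix_(j, i) ((j == i)%:R - c * a j i)).
have [v0 v00 vA0] := @exists_kernel_row _ _ _ A (leqnn _).
have [k vk] : exists k, v0 0 k != 0.
  by apply/existsP; move: v00; apply: contraR => /existsPn H;
     apply/eqP/rowP => k; rewrite mxE; apply/eqP; have := H k; rewrite negbK.
pose kk := [arg max_(i > k) normc (v0 0 i)]%O.
have kkP i : normc (v0 0 i) <= normc (v0 0 kk).
  by rewrite /kk; case: arg_maxP => // j _; apply.
have kk0 : 0 < normc (v0 0 kk) by apply: lt_le_trans (kkP k); rewrite normc_gt0.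
pose v := (v0 0 kk)^-1 *: v0.
have vA : v *m A = 0 by rewrite -scalemxAl vA0 scaler0.
have nv i : normc (v 0 i) = normc (v0 0 i) / normc (v0 0 kk).
  by rewrite mxE Normc.normcM Normc.normcV mulrC.
have v1 i : normc (v 0 i) <= 1 by rewrite nv ler_pdivrMr// mul1r.
have vkk : normc (v 0 kk) = 1 by rewrite nv divff// gt_eqF.
pose s := v 0 (lshift n.+2 (0 : 'I_1)).
pose z (j : nat) := v 0 (rshift 1 (inord j : 'I_n.+2)).
have zE (j : 'I_n.+2) : z j = v 0 (rshift 1 j) by rewrite /z inord_val.
exists s, z; split.
- by move=> j jn; rewrite (zE (Ordinal jn)).
- exact: v1.
- have := vkk; case: (split_ordP kk) => [j ->|j ->] h.
    by left; rewrite /s -h; congr (normc (v 0 (lshift _ _))); rewrite ord1.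
  by right; exists j; rewrite ?ltn_ord// zE.
- move=> j jn; have Ij := @node_unitI R n j jn.
  have := congr1 (fun m : 'rV[R[i]]_n.+2 => m 0 (Ordinal jn)) vA.
  rewrite -[v]hsubmxK mul_row_col !mxE big_ord1 !mxE.
  have -> : (v0 0 kk)^-1 * v0 0 (lshift n.+2 ord0) = s by rewrite /s mxE.
  have -> : \sum_(i < n.+2) rsubmx v 0 i *
      (\matrix_(j1, i) ((j1 == i)%:R - c * a j1 i)) i (Ordinal jn) =
      z j - c * ckop (step n z) (node R n j).
    rewrite (ckop_step _ _ Ij) mulr_sumr.
    transitivity (\sum_(i < n.+2) (z i * (i == Ordinal jn)%:R - c * (z i * a i (Ordinal jn)))).
      apply: eq_bigr => i _; rewrite [rsubmx v 0 i]mxE -zE.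
      by rewrite [X in _ * X = _]mxE mulrBr mulrCA.
    rewrite sumrB; congr (_ - _).
    rewrite (bigD1 (Ordinal jn))//= eqxx mulr1 big1 ?addr0// => i /negbTE ->.
    by rewrite mulr0.
  by move=> /eqP; rewrite mulrN addrCA -opprD subr_eq0 => /eqP ->.
Qed.

(** The collocation solutions [(s, z)] accumulate at a nonzero solution of
[P = s q + c W P], and injectivity excludes [s = 0]. *)
Lemma fredholm_solve c q Q : ckop_inj c -> clipI q Q ->
  exists P, (exists C, clipI P C) /\ forall x, I01 x -> P x = q x + c * ckop P x.
Proof.
move=> inj qQ.
have /choice[s /choice[z szP]] : forall n, exists s, exists z, _ := collocation c q.
have pb n : bddI (step n (z n)) 1 by apply: step_bdd; case: (szP n).
(* Lipschitz constant of the right-hand side: it bounds the error between nodes *)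
pose D := Q + normc c * (2 * L * 1).
have [||||||s0 [P [PL PE _ nz]]] := @approx_solution_cvg c (fun=> c) s q Q
  (fun n => step n (z n)) 1 (fun n => `|D| / n.+1%:R) qQ pb.
- by move=> n; case: (szP n).
- by move=> d d0; near=> n; rewrite subrr Normc.normc0 ltW.
- move=> d d0; near=> n.
  rewrite ler_pdivrMr ?ltr0n// mulrC -ler_pdivrMr//.
  apply: (@le_trans _ _ n%:R); last by rewrite ler_nat.
  by near: n; exact: nbhs_infty_ger.
- move=> n x Ix; rewrite stepE//; set j := cell_index n x.
  have jn : (j < n.+2)%N by exact: cell_index_lt.
  have It := node_unitI R jn.
  case: (szP n) => _ sn _ /(_ j jn) ->.
  rewrite (_ : _ - _ = s n * (q (node R n j) - q x) +
     c * (ckop (step n (z n)) (node R n j) - ckop (step n (z n)) x)); last by ring.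
  apply: le_trans (le_normcD _ _) _; rewrite !Normc.normcM.
  have xj : `|node R n j - x| <= n.+1%:R^-1 by rewrite distrC cell_index_dist.
  have Q0 := clipI_ge0 qQ.
  have D0 : 0 <= D by rewrite /D addr_ge0// mulr_ge0 ?normc_ge0// mulr1 mulr_ge0.
  rewrite (ger0_norm D0) /D mulrDl; apply: lerD.
    rewrite -[leRHS]mul1r; apply: ler_pM; rewrite ?normc_ge0//.
    by apply: le_trans (qQ _ _ It Ix) _; rewrite ler_wpM2l.
  rewrite -[leRHS]mulrA ler_wpM2l ?normc_ge0//.
  apply: le_trans (ckop_lip (pb n) It Ix) _.
  by rewrite ler_wpM2l// mulr1 mulr_ge0.
- exact: ltr01.
- move=> n; have [_ _ + _] := szP n => -[->|[j jn zj]]; first by left.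
  right; exists (node R n j); first exact: node_unitI.
  rewrite stepE; last exact: node_unitI.
  by rewrite cell_index_node zj.
have s00 : s0 != 0.
  case: nz => // -[x Ix Px]; apply/eqP => s00; case: PL => C PC.
  move/eqP: Px; apply; apply: (inj P C) => // y Iy.
  by rewrite PE// s00 mul0r add0r.
exists (fun x => s0^-1 * P x); split.
  by case: PL => C PC; eexists; apply: clipIZ PC.
move=> x Ix; case: PL => C PC.
rewrite (ckopZ _ Ix (clipI_bdd PC)) PE// mulrDr mulKf//; ring.
Unshelve. all: end_near. Qed.

Lemma bddI_sup p B x0 : bddI p B -> I01 x0 -> p x0 != 0 ->
  exists b, [/\ 0 < b, forall x, I01 x -> normc (p x) <= b &
    exists2 x, I01 x & b / 2 <= normc (p x)].
Proof.
move=> [_ _ pB] Ix0 px0; pose S := [set normc (p x) | x in I01].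
have S0 : S (normc (p x0)) by exists x0.
have hS : has_sup S.
  by split; [exists (normc (p x0))|exists B => _ [x Ix <-]; exact: pB].
have b0 : 0 < sup S.
  by apply: lt_le_trans (ub_le_sup (proj2 hS) S0); rewrite normc_gt0.
exists (sup S); split=> //.
  by move=> x Ix; apply: (ub_le_sup (proj2 hS)); exists x.
have sb : 0 < sup S / 2 by rewrite divr_gt0.
have [_ [x Ix <-] h] := sup_adherent sb hS.
by exists x => //; apply/ltW; move: h; lra.
Qed.

(** Otherwise normalized solutions with right-hand sides tending to [0] would
accumulate at a nonzero solution of [P = c W P]. *)
Lemma fredholm_stable c : ckop_inj c -> exists C, forall p q B eps, bddI p B ->
  (forall x, I01 x -> p x = q x + c * ckop p x) ->
  (forall x, I01 x -> normc (q x) <= eps) ->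
  forall x, I01 x -> normc (p x) <= C * eps.
Proof.
move=> inj; apply: contrapT => H.
have key n : exists p, [/\ bddI p 1,
    forall x, I01 x -> normc (p x - c * ckop p x) <= n.+1%:R^-1 &
    exists2 x, I01 x & 1 / 2 <= normc (p x)].
  apply: contrapT => Hn; apply: H; exists n.+1%:R => p q B eps pB pq qe x Ix.
  rewrite leNgt; apply/negP => px.
  have e0 : 0 <= eps by apply: le_trans (qe x Ix); exact: normc_ge0.
  have px0 : p x != 0.
    by rewrite -normc_gt0; apply: le_lt_trans px; rewrite mulr_ge0.
  have [b [b0 pb [y Iy py]]] := bddI_sup pB Ix px0.
  apply: Hn; exists (fun x => b^-1%:C%C * p x).
  have nb : normc (b^-1%:C%C) = b^-1 by rewrite normc_real gtr0_norm// invr_gt0.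
  split.
  - have [m1 m2 _] := bddIZ b^-1%:C%C pB; split=> // z Iz.
    by rewrite Normc.normcM nb ler_pdivrMl// mulr1 pb.
  - move=> z Iz; rewrite (ckopZ _ Iz pB) (pq z Iz) mulrDr [c * (_ * _)]mulrCA addrK.
    rewrite Normc.normcM nb ler_pdivrMl//.
    apply: le_trans (qe z Iz) _; rewrite ler_pdivlMr ?ltr0n// mulrC.
    by apply/ltW/(lt_le_trans px); exact: pb.
  - by exists y => //; rewrite Normc.normcM nb ler_pdivlMl// mul1r.
have /choice[p pP] := key.
have q0 : clipI (fun=> 0) 0 by move=> x y _ _; rewrite subrr Normc.normc0 mul0r.
have [|||||||s0 [P [[C PC] PE s00 nz]]] := @approx_solution_cvg c (fun=> c) (fun=> 0) (fun=> 0) 0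
  p (1 / 2) (fun n => n.+1%:R^-1) q0.
- by move=> n; case: (pP n).
- by move=> n; rewrite Normc.normc0.
- by move=> d d0; near=> n; rewrite subrr Normc.normc0 ltW.
- move=> d d0; near=> n; apply/ltW; near: n; exact: near_infty_natSinv_lt (PosNum d0).
- by move=> n x Ix; rewrite mul0r add0r; case: (pP n) => _ + _; exact.
- by rewrite divr_gt0.
- by move=> n; right; case: (pP n).
have P0 x : I01 x -> P x = 0.
  by apply: (inj P C PC) => y Iy; rewrite PE// mulr0 add0r.
case: nz => [|[x Ix]]; last by rewrite P0 ?eqxx.
by rewrite s00 ?eqxx.
Unshelve. all: end_near. Qed.

(** The fixed point is an eigenvector of the real symmetric operator [W] for
[1 / c].  Comparing [int p1 W p2] with [int p2 W p1], for the real and imaginary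
parts of [p], gives [Im (1 / c) * int |p| ^ 2 = 0]. *)
Lemma ckop_fix_real c p B x0 : bddI p B -> (forall x, I01 x -> p x = c * ckop p x) ->
  I01 x0 -> p x0 != 0 -> complex.Im c = 0 /\ complex.Re c != 0.
Proof.
move=> pB pE Ix0 px0.
have [a1 a2] := bddI_L1 pB.
have c0 : c != 0 by apply: contra px0 => /eqP c0; rewrite pE// c0 mul0r.
have kE x : I01 x -> ckop p x = c^-1 * p x by move=> Ix; rewrite [p x]pE// mulKf.
pose z1 := complex.Re c^-1; pose z2 := complex.Im c^-1.
pose p1 x := complex.Re (p x); pose p2 x := complex.Im (p x).
have k1 x : I01 x -> kop W p1 x = z1 * p1 x - z2 * p2 x.
  by move=> /kE /(congr1 (@complex.Re R)); rewrite cReM.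
have k2 x : I01 x -> kop W p2 x = z1 * p2 x + z2 * p1 x.
  by move=> /kE /(congr1 (@complex.Im R)); rewrite cImM.
have [m1 m2 pb] := pB.
have bM (f h : R -> R) : measurable_fun I01 f -> (forall x, I01 x -> `|f x| <= B) -> L1I h ->
    L1I (fun x => f x * h x) by move=> mf fB; exact: (wL1_bndM pw mf fB).
have b1 x : I01 x -> `|p1 x| <= B by move=> Ix; exact: le_trans (cnorm_ge_Re _) (pb _ Ix).
have b2 x : I01 x -> `|p2 x| <= B by move=> Ix; exact: le_trans (cnorm_ge_Im _) (pb _ Ix).
have L12 : L1I (fun x => p1 x * p2 x) by exact: bM.
have L11 : L1I (fun x => p1 x * p1 x) by exact: bM.
have L22 : L1I (fun x => p2 x * p2 x) by exact: bM.
have : wI (fun x => z1 * (p1 x * p2 x) + z2 * (p1 x * p1 x)) =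
       wI (fun x => z1 * (p1 x * p2 x) - z2 * (p2 x * p2 x)).
  transitivity (wI (fun x => p1 x * kop W p2 x)).
    by apply: eq_wint => x Ix; rewrite k2//; ring.
  transitivity (wI (fun x => p2 x * kop W p1 x)); first exact: (kop_sym HW a1 a2).
  by apply: eq_wint => x Ix; rewrite k1//; ring.
rewrite (wintD pw) ?(wintB pw) ?(wintZ pw)//; try exact: (wL1Z pw).
move=> /addrI /eqP; rewrite -subr_eq0 opprK -mulrDr mulf_eq0.
have S0 : 0 < wI (fun x => p1 x * p1 x) + wI (fun x => p2 x * p2 x).
  have cl x y : I01 x -> I01 y ->
      normc (p x - p y) <= normc c * (2 * L * B) * `|x - y|.
    move=> Ix Iy; rewrite (pE x Ix) (pE y Iy).
    by have := clipIZ c (ckop_lip pB); exact.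
  have sq0 f : 0 <= wI (fun x => f x * f x).
    by apply: (wint_ge0 pw) => x _; rewrite -expr2 sqr_ge0.
  have [h|h] := eqVneq (p1 x0) 0; last first.
    rewrite ltr_wpDr//; apply: (lipI_sq_gt0 _ Ix0 h) => x y Ix Iy.
    by rewrite /p1 -cReN -cReD; apply: le_trans (cnorm_ge_Re _) _; exact: cl.
  have h2 : p2 x0 != 0.
    by apply: contra px0 => /eqP h2; apply/eqP; apply: complex_ext.
  rewrite ltr_wpDl//; apply: (lipI_sq_gt0 _ Ix0 h2) => x y Ix Iy.
  by rewrite /p2 -cImN -cImD; apply: le_trans (cnorm_ge_Im _) _; exact: cl.
rewrite (gt_eqF S0) orbF => /eqP z20.
have zE : c^-1 = z1%:C%C by apply: complex_ext.
have z10 : z1 != 0.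
  by apply: contra c0 => /eqP z10; rewrite -(invrK c) zE z10 invr0.
have -> : c = (z1^-1)%:C%C by rewrite -(invrK c) zE fmorphV.
by rewrite /= invr_eq0.
Qed.

End complex_kernel.

(** * Complex square-integrable functions *)

Section complex_weighted_L2.
Context d (T : measurableType d) (R : realType).
Variables (mu : {measure set T -> \bar R}) (D : set T) (w : T -> R).
Hypothesis pw : prob_weight mu D w.
Let mD : measurable D. Proof. by case: pw. Qed.
Let w0 x : 0 <= w x. Proof. by case: pw. Qed.
Let mw : measurable_fun D w. Proof. by case: pw. Qed.

Lemma wL1_ltyP (f : T -> R) : measurable_fun D f -> (forall x, D x -> 0 <= f x) ->
  (\int[mu]_(x in D) (f x * w x)%:E < +oo)%E <-> wL1 mu D w f.
Proof.
move=> mf f0.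
have mfw : measurable_fun D (EFin \o (fun x => f x * w x)).
  by apply/measurable_EFinP; exact: measurable_funM.
have E : (\int[mu]_(x in D) `|(EFin \o (fun x => (f x * w x)%R)) x| =
          \int[mu]_(x in D) (f x * w x)%:E)%E.
  apply: eq_integral => x; rewrite inE => Dx /=.
  by rewrite ger0_norm// mulr_ge0// f0.
split=> [H|[_ /integrableP[_]]]; last by rewrite E.
by split=> //; apply/integrableP; rewrite E.
Qed.

Lemma L2E (f : T -> R[i]) : L2 mu D w f <->
  wL2 mu D w (fun x => complex.Re (f x)) /\ wL2 mu D w (fun x => complex.Im (f x)).
Proof.
have m2 (h : T -> R) : measurable_fun D h -> measurable_fun D (fun x => h x ^+ 2).
  by move=> mh; exact: measurable_funX.
split=> [[m1 mi H]|[/wL2E[m1 h1] /wL2E[mi h2]]].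
  have ms : measurable_fun D (fun x => csqr_norm (f x)).
    by apply: measurable_funD; exact: m2.
  have /(wL1_ltyP ms) Ls : forall x, D x -> 0 <= csqr_norm (f x).
    by move=> x _; exact: csqr_norm_ge0.
  move/Ls : H => {}Ls.
  split; apply/wL2E; split=> //; apply: (wL1_le pw _ Ls) => [|x _]; try exact: m2.
    by rewrite ger0_norm ?sqr_ge0// /csqr_norm lerDl sqr_ge0.
  by rewrite ger0_norm ?sqr_ge0// /csqr_norm lerDr sqr_ge0.
split=> //; apply/wL1_ltyP.
- by apply: measurable_funD; exact: m2.
- by move=> x _; exact: csqr_norm_ge0.
- exact: (wL1D pw h1 h2).
Qed.

Definition csq (f : T -> R[i]) : R :=
  wsq mu D w (fun x => complex.Re (f x)) + wsq mu D w (fun x => complex.Im (f x)).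

Lemma csq_ge0 f : 0 <= csq f.
Proof. by rewrite addr_ge0// (wsq_ge0 pw). Qed.

Lemma L2normE f : L2 mu D w f -> L2norm mu D w f = Num.sqrt (csq f).
Proof.
move=> /L2E[/wL2E[_ h1] /wL2E[_ h2]].
by rewrite /L2norm /csq /wsq -(wintD pw).
Qed.

Lemma L2norm_sqr f : L2 mu D w f -> L2norm mu D w f ^+ 2 = csq f.
Proof. by move=> /L2normE ->; rewrite sqr_sqrtr// csq_ge0. Qed.

Lemma L2norm_eq0 f : L2 mu D w f -> (L2norm mu D w f == 0) = (csq f == 0).
Proof. by move=> Lf; rewrite -(L2norm_sqr Lf) sqrf_eq0. Qed.

Lemma csq_eq0 f : csq f = 0 ->
  wsq mu D w (fun x => complex.Re (f x)) = 0 /\ wsq mu D w (fun x => complex.Im (f x)) = 0.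
Proof.
move=> /eqP; rewrite /csq paddr_eq0 ?(wsq_ge0 pw)//.
by move=> /andP[/eqP ? /eqP ?].
Qed.

Lemma eq_csq f h : (forall x, D x -> f x = h x) -> csq f = csq h.
Proof.
by move=> fh; rewrite /csq /wsq; congr (_ + _); apply: eq_wint => x Dx; rewrite fh.
Qed.

Lemma L2norm_zero f : (forall x, D x -> f x = 0) -> L2norm mu D w f = 0.
Proof.
move=> f0; rewrite /L2norm /Rintegral integral0_eq ?sqrtr0// => x Dx.
by rewrite f0// /csqr_norm /= expr0n addr0 mul0r.
Qed.

End complex_weighted_L2.

(** * Eigenvalues of the graphon operator *)

Section graphon_spectrum.
Context (R : realType).
Variables (W : R -> R -> R) (M L : R).
Local Notation leb := (@lebesgue_measure R).
Local Notation I01 := (@unitI R).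
Local Notation wI := (wint leb I01 (cst 1)).
Hypothesis HW : lip_kernel W M L.
Let pw := unit_weight R.

Let M0 : 0 <= M. Proof. by case: HW. Qed.
Let L0 : 0 <= L. Proof. by case: HW. Qed.

(** Real Lipschitz eigenfunctions suffice, by [keig_L2]; they make nonvanishing a
pointwise condition. *)
Definition keig (z : R) : Prop := exists p C x0,
  [/\ lipI p C, I01 x0, p x0 != 0 & forall x, I01 x -> kop W p x = z * p x].

Lemma graphon_actE f x : op_act (graphon_op W) f x = ckop W f x.
Proof.
rewrite /= /cintegral /ckop /kop /wint; congr Complex; apply: eq_Rintegral => y _.
  by rewrite cReM /= mul0r subr0 mulr1.
by rewrite cImM /= mul0r addr0 mulr1.
Qed.

Lemma keig_ckop z : z != 0 -> keig z -> exists P C x0,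
  [/\ clipI P C, I01 x0, P x0 != 0 &
   forall x, I01 x -> P x = z^-1%:C%C * ckop W P x].
Proof.
move=> z0 [p [C [x0 [pC Ix0 px0 pE]]]]; exists (fun x => (p x)%:C%C), C, x0; split=> //.
- by move=> x y Ix Iy; rewrite -rmorphB normc_real pC.
- by rewrite fmorph_eq0.
move=> x Ix; rewrite /ckop /=; apply: complex_ext; rewrite !ReImE /=.
  by rewrite mul0r subr0 pE// mulKf.
rewrite mul0r addr0 (@eq_kop _ _ _ (fun y => 0 * p y)).
  by rewrite (kopZ HW 0 Ix (lipI_L1 pC)) mul0r mulr0.
by move=> y _; rewrite mul0r.
Qed.

Lemma ckop_keig c P C x0 : clipI P C -> I01 x0 -> P x0 != 0 ->
  (forall x, I01 x -> P x = c * ckop W P x) ->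
  [/\ complex.Im c = 0, complex.Re c != 0 & keig (complex.Re c)^-1].
Proof.
move=> PC Ix0 Px0 PE; have Pb := clipI_bdd PC.
have [c2 c1] := ckop_fix_real HW Pb PE Ix0 Px0; split=> //.
have lR : lipI (fun x => complex.Re (P x)) C.
  by move=> x y Ix Iy; rewrite -cReN -cReD; apply: le_trans (cnorm_ge_Re _) _; exact: PC.
have lI : lipI (fun x => complex.Im (P x)) C.
  by move=> x y Ix Iy; rewrite -cImN -cImD; apply: le_trans (cnorm_ge_Im _) _; exact: PC.
have [h|h] := eqVneq (complex.Re (P x0)) 0.
  exists (fun x => complex.Im (P x)), C, x0; split=> //.
    by apply: contra Px0 => /eqP h'; apply/eqP; exact: complex_ext.
  by move=> x Ix; rewrite [in RHS]PE// cImM c2 mul0r addr0 /= mulKf.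
exists (fun x => complex.Re (P x)), C, x0; split=> //.
by move=> x Ix; rewrite [in RHS]PE// cReM c2 mul0r subr0 /= mulKf.
Qed.

Lemma keig_bnd z : keig z -> `|z| <= 2 * M.
Proof.
move=> [p [C [x0 [pC Ix0 px0 pE]]]].
have pb : bddI (fun x => (p x)%:C%C) (`|p 0| + `|C|).
  have := @clipI_bdd _ (fun x => (p x)%:C%C) C; rewrite normc_real; apply.
  by move=> x y Ix Iy; rewrite -rmorphB normc_real pC.
have [|b [b0 bP [x Ix xb]]] := @bddI_sup _ _ _ x0 pb Ix0; first by rewrite fmorph_eq0.
rewrite normc_real in xb.
have kb : `|kop W p x| <= M * b.
  apply: le_trans (kop_bnd HW Ix (lipI_L1 pC)) _; rewrite ler_wpM2l//.
  apply: wint_norm_bnd; first exact: lipI_measurable pC.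
  by move=> y Iy; rewrite -normc_real bP.
rewrite pE// normrM in kb.
rewrite -(ler_pM2r b0); have := normr_ge0 z; nra.
Qed.

(** Normalized eigenvectors for eigenvalues that approach the supremum accumulate at
an eigenvector for it. *)
Lemma keig_max : (exists2 z, 0 < z & keig z) ->
  exists z, [/\ 0 < z, keig z & forall y, 0 < y -> keig y -> y <= z].
Proof.
move=> [z0 z00 kz0]; pose S := [set z | 0 < z /\ keig z].
have hS : has_sup S.
  split; first by exists z0.
  by exists (2 * M) => z [_ /keig_bnd]; apply: le_trans; exact: ler_norm.
have zS : z0 <= sup S by apply: (ub_le_sup (proj2 hS)).
have s0 : 0 < sup S by apply: lt_le_trans zS.
exists (sup S); split=> //; last by move=> y y0 ky; apply: (ub_le_sup (proj2 hS)).
have key n : exists zp : R * (R -> R[i]), [/\ 0 < zp.1, `|zp.1^-1 - (sup S)^-1| <= n.+1%:R^-1,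
    bddI zp.2 1, forall x, I01 x -> zp.2 x = zp.1^-1%:C%C * ckop W zp.2 x &
    exists2 x, I01 x & 1 / 2 <= normc (zp.2 x)].
  pose e := Num.min (sup S / 2) (sup S ^+ 2 / 2 / n.+1%:R).
  have e0 : 0 < e by rewrite /e lt_min !divr_gt0// ?exprn_gt0.
  have [z [z0' kz] ez] := sup_adherent e0 hS.
  have zle : z <= sup S by apply: (ub_le_sup (proj2 hS)).
  have zn0 : z != 0 by rewrite gt_eqF.
  have [P [C [x0 [PC Ix0 Px0 PE]]]] := keig_ckop zn0 kz.
  have PB := clipI_bdd PC.
  have [b [b0 Pb [y Iy Py]]] := bddI_sup PB Ix0 Px0.
  exists (z, fun x => b^-1%:C%C * P x); split=> //=.
  - have z2 : sup S / 2 <= z.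
      have : e <= sup S / 2 by rewrite /e ge_min lexx.
      by move: ez; lra.
    have ze : sup S - z <= sup S ^+ 2 / 2 / n.+1%:R.
      have : e <= sup S ^+ 2 / 2 / n.+1%:R by rewrite /e ge_min lexx orbT.
      by apply: le_trans; rewrite lerBlDr addrC -lerBlDr ltW.
    have -> : z^-1 - (sup S)^-1 = (sup S - z) / (z * sup S) by field; rewrite !gt_eqF.
    have zs : 0 < z * sup S by rewrite mulr_gt0.
    rewrite normrM normfV (gtr0_norm zs) ger0_norm ?subr_ge0// ler_pdivrMr//.
    apply: le_trans ze _; rewrite mulrC ler_wpM2l ?invr_ge0//; nra.
  - have [m1 m2 _] := bddIZ b^-1%:C%C PB; split=> // x Ix.
    by rewrite Normc.normcM normc_real gtr0_norm ?invr_gt0// ler_pdivrMl// mulr1 Pb.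
  - by move=> x Ix; rewrite (ckopZ HW _ Ix PB) mulrCA -PE.
  - exists y => //.
    by rewrite Normc.normcM normc_real gtr0_norm ?invr_gt0// ler_pdivlMl// mul1r.
have /choice[zp zpP] := key.
have q0 : clipI (fun=> 0 : R[i]) 0 by move=> x y _ _; rewrite subrr Normc.normc0 mul0r.
have [|||||||s1 [P [[C PC] PE s10 nz]]] := @approx_solution_cvg _ _ _ _ HW
  (sup S)^-1%:C%C (fun n => (zp n).1^-1%:C%C) (fun=> 0) (fun=> 0) 0
  (fun n => (zp n).2) (1 / 2) (fun=> 0) q0.
- by move=> n; case: (zpP n).
- by move=> n; rewrite Normc.normc0.
- move=> e e0; near=> n; rewrite -rmorphB normc_real.
  case: (zpP n) => _ h _ _ _; apply: le_trans h _.
  by apply/ltW; near: n; exact: near_infty_natSinv_lt (PosNum e0).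
- by move=> e e0; near=> n; exact: ltW.
- by move=> n x Ix; rewrite mul0r add0r; case: (zpP n) => _ _ _ + _ => <-//; rewrite subrr Normc.normc0.
- by rewrite divr_gt0.
- by move=> n; right; case: (zpP n).
have [x Ix Px] : exists2 x, I01 x & P x != 0 by case: nz => //; rewrite s10// eqxx.
have PE' y : I01 y -> P y = (sup S)^-1%:C%C * ckop W P y.
  by move=> Iy; rewrite PE// mulr0 add0r.
by have [_ _] := ckop_keig PC Ix Px PE'; rewrite /= invrK.
Unshelve. all: end_near. Qed.

(** An eigenfunction in the mean-square sense agrees almost everywhere with its image
divided by [z], which is Lipschitz; the image is the eigenfunction that is used. *)
Lemma keig_L2 z h : z != 0 -> wL2 leb I01 (cst 1) h -> wsq leb I01 (cst 1) h != 0 ->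
  wsq leb I01 (cst 1) (fun x => kop W h x - z * h x) = 0 -> keig z.
Proof.
move=> z0 Lh h0 hz; have Lh1 := wL2_L1 pw Lh.
have kl := kop_lip HW Lh1; set C := L * _ in kl.
have Lk1 := lipI_L1 kl.
have Lk2 : wL2 leb I01 (cst 1) (kop W h).
  by apply: (wL2_bnd pw (lipI_measurable kl) (B := _)); exact: lipI_bnd kl.
have Ldiff : wL2 leb I01 (cst 1) (fun x => kop W h x - z * h x).
  by apply: (wL2B pw) => //; exact: (wL2Z pw).
have kk x : I01 x -> kop W (kop W h) x = z * kop W h x.
  move=> Ix; apply/eqP; rewrite -subr_eq0 -mulNr -(kopZ HW)// -(kopD HW)//; last exact: (wL1Z pw).
  apply/eqP; rewrite (@eq_kop _ _ _ (fun x => kop W h x - z * h x)).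
    exact: (wsq0_wint pw (kernel_measurable HW Ix) Ldiff hz).
  by move=> y _; rewrite mulNr.
exists (kop W h), C.
have [[x [Ix kx]]|kh0] := pselect (exists x, I01 x /\ kop W h x != 0).
  by exists x; split.
exfalso; move/eqP: h0; apply.
have : wsq leb I01 (cst 1) (fun x => (- z) * h x) = 0.
  rewrite -hz /wsq; apply: eq_wint => x Ix; congr (_ ^+ 2).
  have -> : kop W h x = 0 by apply/eqP/negPn/negP => kx; apply: kh0; exists x.
  by rewrite sub0r mulNr.
by rewrite (wsqZ pw)// sqrrN => /eqP; rewrite mulf_eq0 sqrf_eq0 (negbTE z0) => /eqP.
Qed.

Lemma graphon_point_spectrum z : z != 0 ->
  point_spectrum (graphon_op W) z%:C%C <-> keig z.
Proof.
move=> z0; split.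
  move=> [f [/= Lf f0 fz]].
  have /(L2E pw)[Lf1 Lf2] := Lf.
  have L11 := wL2_L1 pw Lf1; have L12 := wL2_L1 pw Lf2.
  have kL h : wL2 leb I01 (cst 1) h -> wL2 leb I01 (cst 1) (fun x => kop W h x - z * h x).
    move=> Lh; have kl := kop_lip HW (wL2_L1 pw Lh).
    apply: (wL2B pw); last exact: (wL2Z pw).
    by apply: (wL2_bnd pw (lipI_measurable kl) (B := _)); exact: lipI_bnd kl.
  have RE : (fun x => complex.Re (op_shift (graphon_op W) z%:C%C f x)) =
      fun x => kop W (fun y => complex.Re (f y)) x - z * complex.Re (f x).
    by apply/funext => x; rewrite /op_shift graphon_actE !ReImE /= mul0r subr0.
  have IE : (fun x => complex.Im (op_shift (graphon_op W) z%:C%C f x)) =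
      fun x => kop W (fun y => complex.Im (f y)) x - z * complex.Im (f x).
    by apply/funext => x; rewrite /op_shift graphon_actE !ReImE /= mul0r addr0.
  have Ls : L2 leb I01 (cst 1) (op_shift (graphon_op W) z%:C%C f).
    by apply/(L2E pw); rewrite RE IE; split; exact: kL.
  move: fz => /eqP; rewrite (L2norm_eq0 pw Ls) => /eqP /(csq_eq0 pw).
  rewrite RE IE => -[h1 h2].
  move: f0; rewrite (L2norm_eq0 pw Lf) /csq.
  have [s1|s1] := eqVneq (wsq leb I01 (cst 1) (fun x => complex.Re (f x))) 0; last first.
    by move=> _; exact: keig_L2 h1.
  by rewrite s1 add0r => s2; exact: keig_L2 h2.
move=> [p [C [x0 [pC Ix0 px0 pE]]]].
have mp := lipI_measurable pC.
have Lp : L2 leb I01 (cst 1) (fun x => (p x)%:C%C).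
  apply/(L2E pw); split=> /=.
    by apply: (wL2_bnd pw mp (B := _)); exact: lipI_bnd pC.
  by apply: (wL2_bnd pw (B := 0)) => // x _; rewrite normr0.
exists (fun x => (p x)%:C%C); split=> //=.
  rewrite (L2norm_eq0 pw Lp) gt_eqF// /csq ltr_wpDr ?(wsq_ge0 pw)//.
  exact: (lipI_sq_gt0 pC Ix0 px0).
apply: L2norm_zero => x Ix; rewrite /op_shift graphon_actE.
apply: complex_ext; rewrite !ReImE /= ?(mul0r, subr0, addr0) ?pE ?subrr//.
rewrite mulr0 subr0 (@eq_kop _ _ _ (fun y => 0 * p y)).
  by rewrite (kopZ HW 0 Ix (lipI_L1 pC)) mul0r.
by move=> y _; rewrite mul0r.
Qed.

End graphon_spectrum.

(** * The weighted strip *)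

Section strip.
Context (R : realType).
Local Notation leb := (@lebesgue_measure R).
Local Notation leb2 := (@lebesgue_measure R \x @lebesgue_measure R)%E.
Local Notation I01 := (@unitI R).
Local Notation RR := (measurableTypeR R * measurableTypeR R)%type.
Local Notation SX := (@stripX R : set RR).

Lemma measurable_stripX : measurable SX.
Proof. by apply: measurableX => //; exact: measurable_unitI. Qed.

Lemma measurable_strip_fst (f : R -> R) : measurable_fun setT f ->
  measurable_fun SX (fun p : RR => f p.1).
Proof. by move=> mf; apply: (measurableT_comp mf); exact: measurable_funTS. Qed.

Lemma measurable_strip_snd (f : R -> R) : measurable_fun I01 f ->
  measurable_fun SX (fun p : RR => f p.2).
Proof.
move=> mf; apply: (@measurable_comp _ _ _ _ _ _ I01 f SX snd) => //.
- exact: measurable_unitI.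
- by move=> _ [p [_ Ip] <-].
- exact: measurable_funTS.
Qed.

Lemma strip_fubini (h : RR -> R) : leb2.-integrable SX (EFin \o h) ->
  \int[leb]_(y in I01) \int[leb]_l h (l, y) = \int[leb2]_(p in SX) h p.
Proof.
move=> Ih; have mX := measurable_stripX.
pose f := (EFin \o h) \_ SX.
have If : leb2.-integrable setT f by exact: ((integrable_mkcond (EFin \o h) mX).1 Ih).
pose G y := (\int[leb]_l f (l, y))%E.
have GI y : I01 y -> G y = (\int[leb]_l (h (l, y))%:E)%E.
  move=> Iy; apply: eq_integral => l _.
  by rewrite /f patchE mem_set.
have GN y : ~ I01 y -> G y = 0%E.
  by move=> Iy; apply: integral0_eq => l _; rewrite /f patchE memNset// => -[].
have mG : measurable_fun setT G by exact: (measurable_fubini_G If).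
transitivity (fine (\int[leb]_y G y)); last first.
  by rewrite /Rintegral [in RHS]integral_mkcond -(integral21_prod_meas1 If).
rewrite /Rintegral integral_mkcond; congr fine.
apply: ae_eq_integral => //.
  apply: (@eq_measurable_fun _ _ _ _ _ (EFin \o (fine \o G))).
    move=> y _; rewrite /= patchE; case: ifPn => [|/negP] Iy.
      by rewrite GI// -inE.
    by rewrite GN ?inE//=; move=> H; apply: Iy; rewrite inE.
  by apply/measurable_EFinP; apply: measurableT_comp => //; exact: fine_measurable.
have := ae_integrable2 If; apply: filterS => y Iy _.
have Gf : G y \is a fin_num by exact: integrable_fin_num.
rewrite patchE; case: ifPn => [|/negP] Iyy.
  have Iy' : I01 y by move: Iyy; rewrite inE.
  by rewrite -(GI y Iy') fineK.
by rewrite GN// => H; apply: Iyy; rewrite inE.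
Qed.

Lemma strip_tonelli_prod (a b : R -> R) : measurable_fun setT a ->
  measurable_fun I01 b -> (forall l, 0 <= a l) -> (forall y, I01 y -> 0 <= b y) ->
  (\int[leb2]_(p in SX) (a p.1 * b p.2)%:E =
   \int[leb]_l (a l)%:E * \int[leb]_(y in I01) (b y)%:E)%E.
Proof.
move=> ma mb a0 b0; have mX := measurable_stripX; have mI := @measurable_unitI R.
pose h p : R := a p.1 * b p.2.
have mh : measurable_fun SX h.
  by apply: measurable_funM; [exact: measurable_strip_fst|exact: measurable_strip_snd].
rewrite integral_mkcond; set f := (_ \_ _).
have mf : measurable_fun setT f.
  by apply/(measurable_restrictT _ mX); exact/measurable_EFinP.
have f0 p : (0 <= f p)%E.
  rewrite /f patchE; case: ifPn => //; rewrite inE => -[_ Ip].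
  by rewrite lee_fin mulr_ge0// b0.
rewrite (fubini_tonelli1 _ mf f0).
have B0 : (0 <= \int[leb]_(y in I01) (b y)%:E)%E.
  by apply: integral_ge0 => y Iy; rewrite lee_fin b0.
rewrite -ge0_integralZr//; [|exact/measurable_EFinP|by move=> l _; rewrite lee_fin].
apply: eq_integral => l _; rewrite /fubini_F.
rewrite -ge0_integralZl_EFin//; last exact/measurable_EFinP.
rewrite [RHS]integral_mkcond; apply: eq_integral => y _; rewrite /f !patchE.
case: ifPn => [|/negP] Il; case: ifPn => [|/negP] Iy.
- by rewrite EFinM.
- by exfalso; apply: Iy; move: Il; rewrite !inE => -[].
- by exfalso; apply: Il; move: Iy; rewrite !inE => Iy; split.
- by [].
Qed.

End strip.

Section strip_L2.
Context (R : realType) (g : R -> R).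
Local Notation leb := (@lebesgue_measure R).
Local Notation leb2 := (@lebesgue_measure R \x @lebesgue_measure R)%E.
Local Notation I01 := (@unitI R).
Local Notation RR := (measurableTypeR R * measurableTypeR R)%type.
Local Notation SX := (@stripX R : set RR).
Hypothesis pg : prob_weight leb setT g.
Let g0 x : 0 <= g x. Proof. by case: pg. Qed.
Let mg : measurable_fun setT g. Proof. by case: pg. Qed.
Let pI := unit_weight R.
Local Notation gX := (fun p : RR => g p.1).
Local Notation XL1 := (wL1 leb2 SX gX).
Local Notation XL2 := (wL2 leb2 SX gX).
Local Notation Xint := (wint leb2 SX gX).
Local Notation Xsq := (wsq leb2 SX gX).
Local Notation gL1 := (wL1 leb setT g).
Local Notation gL2 := (wL2 leb setT g).
Local Notation gint := (wint leb setT g).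
Local Notation IL1 := (wL1 leb I01 (cst 1)).
Local Notation IL2 := (wL2 leb I01 (cst 1)).
Local Notation Iint := (wint leb I01 (cst 1)).

Lemma strip_weight : prob_weight leb2 SX gX.
Proof.
split=> //; [exact: measurable_stripX|exact: measurable_strip_fst|].
have := @strip_tonelli_prod R g (cst 1) mg (measurable_cst _) g0 (fun _ _ => ler01).
case: pg => _ _ _ ->; case: pI => _ _ _ ->; rewrite mule1 => <-.
by apply: eq_integral => p _; rewrite mulr1.
Qed.
Let pX := strip_weight.

Lemma strip_prod_L1 (k f : R -> R) : gL1 k -> IL1 f -> XL1 (fun p => k p.1 * f p.2).
Proof.
move=> Lk Lf; have [mk Ik] := Lk; have [mf If] := Lf.
have mkf : measurable_fun SX (fun p : RR => k p.1 * f p.2).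
  by apply: measurable_funM; [exact: measurable_strip_fst|exact: measurable_strip_snd].
split=> //; apply/integrableP; split.
  by apply/measurable_EFinP/measurable_funM => //; exact: measurable_strip_fst.
rewrite (_ : (\int[leb2]_(p in SX) _)%E =
   (\int[leb2]_(p in SX) ((`|k p.1| * g p.1) * `|f p.2|)%:E)%E); last first.
  apply: eq_integral => p _ /=; congr EFin.
  by rewrite !normrM (ger0_norm (g0 _)); ring.
rewrite (@strip_tonelli_prod R (fun l => `|k l| * g l) (fun y => `|f y|))//.
- rewrite -(wintE pg (wL1_norm pg Lk)).
  have := wintE pI (wL1_norm pI Lf); under eq_integral do rewrite mulr1.
  by move=> <-; rewrite -EFinM ltry.
- by apply: measurable_funM => //; exact: measurableT_comp.
- exact: measurableT_comp.
- by move=> l; rewrite mulr_ge0.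
Qed.

Lemma strip_prod_L2 (k f : R -> R) : gL2 k -> IL2 f -> XL2 (fun p => k p.1 * f p.2).
Proof.
move=> /wL2E[mk Lk] /wL2E[mf Lf]; apply/wL2E; split.
  by apply: measurable_funM; [exact: measurable_strip_fst|exact: measurable_strip_snd].
by have := strip_prod_L1 Lk Lf; congr wL1; apply/funext => p; rewrite exprMn.
Qed.

(** By Tonelli the integral of the square is a product; as its second factor is
positive, the first one is finite. *)
Lemma strip_prod_L2_fst (k f : R -> R) : measurable_fun setT k -> measurable_fun I01 f ->
  XL2 (fun p => k p.1 * f p.2) -> wsq leb I01 (cst 1) f != 0 -> gL2 k.
Proof.
move=> mk mf /wL2E[_ Lkf] f0; apply/wL2E; split=> //.
have mk2 : measurable_fun setT (fun x => k x ^+ 2) by exact: measurable_funX.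
have mf2 : measurable_fun I01 (fun x => f x ^+ 2) by exact: measurable_funX.
apply/(wL1_ltyP pg) => //; first by move=> x _; exact: sqr_ge0.
have H : (\int[leb]_l (k l ^+ 2 * g l)%:E * \int[leb]_(y in I01) (f y ^+ 2)%:E < +oo)%E.
  rewrite -(@strip_tonelli_prod R (fun l => k l ^+ 2 * g l) (fun y => f y ^+ 2))//.
  - have [_ /integrable_lty] := Lkf => /(_ (@measurable_stripX R)).
    congr (_ < _)%E; apply: eq_integral => p _ /=; congr EFin; rewrite exprMn; ring.
  - exact: measurable_funM.
  - by move=> l; rewrite mulr_ge0// sqr_ge0.
  - by move=> y _; exact: sqr_ge0.
rewrite ltNge leye_eq; apply/negP => /eqP iy.
move: H; rewrite iy gt0_mulye ?ltxx//.
rewrite lt_neqAle integral_ge0 ?andbT; last by move=> y _; rewrite lee_fin sqr_ge0.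
rewrite eq_sym; apply: contra f0 => /eqP i0.
rewrite /wsq /wint /Rintegral; under eq_integral do rewrite mulr1.
by rewrite i0.
Qed.

Lemma strip_prod_int (k f : R -> R) : gL1 k -> IL1 f ->
  Xint (fun p => k p.1 * f p.2) = gint k * Iint f.
Proof.
move=> Lk Lf; have [_ Ikf] := strip_prod_L1 Lk Lf.
rewrite /wint -(strip_fubini Ikf) /=.
have [_ Ik] := Lk; have [_ If] := Lf.
have mI : measurable (I01 : set (measurableTypeR R)) by case: pI.
rewrite -(RintegralZl _ mI If).
apply: eq_Rintegral => y _; rewrite /= mulr1 mulrC.
rewrite -(RintegralZl _ measurableT Ik).
by apply: eq_Rintegral => l _; ring.
Qed.

Variables (W : R -> R -> R) (M L : R).
Hypothesis HW : lip_kernel W M L.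
Let M0 : 0 <= M. Proof. by case: HW. Qed.
Let L0 : 0 <= L. Proof. by case: HW. Qed.

Definition strip_op (A : RR -> R) (x : R) : R := Xint (fun p => W x p.2 * A p).

Lemma kernel_strip_measurable x : I01 x -> measurable_fun SX (fun p : RR => W x p.2).
Proof. by move=> Ix; apply: measurable_strip_snd; exact: (kernel_measurable HW). Qed.

Lemma kernel_strip_L1 A x : I01 x -> XL1 A -> XL1 (fun p => W x p.2 * A p).
Proof.
move=> Ix; apply: (wL1_bndM pX (B := M)); first exact: kernel_strip_measurable.
by move=> p [_ Ip]; case: HW => _ _ + _ _; exact.
Qed.

Lemma strip_opD A B x : I01 x -> XL1 A -> XL1 B ->
  strip_op (fun p => A p + B p) x = strip_op A x + strip_op B x.
Proof.
move=> Ix LA LB; rewrite /strip_op -(wintD pX); [|exact: kernel_strip_L1|exact: kernel_strip_L1].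
by congr wint; apply/funext => p; rewrite mulrDr.
Qed.

Lemma strip_opZ c A x : I01 x -> XL1 A ->
  strip_op (fun p => c * A p) x = c * strip_op A x.
Proof.
move=> Ix LA; rewrite /strip_op -(wintZ pX); last exact: kernel_strip_L1.
by congr wint; apply/funext => p; rewrite mulrCA.
Qed.

Lemma strip_op_bnd A x : I01 x -> XL2 A -> `|strip_op A x| <= M * Num.sqrt (Xsq A).
Proof.
move=> Ix LA; have LA1 := wL2_L1 pX LA; have LA' := wL1_norm pX LA1.
apply: le_trans (ler_wpM2l M0 (wint_norm_sqrt pX LA)).
rewrite -(wintZ pX)//; apply: (le_norm_wint pX).
- exact: kernel_strip_L1.
- exact: (wL1Z pX).
- by move=> p [_ Ip]; rewrite normrM ler_wpM2r//; case: HW => _ _ + _ _; exact.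
Qed.

Lemma strip_op_lip A : XL2 A -> lipI (strip_op A) (L * Num.sqrt (Xsq A)).
Proof.
move=> LA x x' Ix Ix'; have LA1 := wL2_L1 pX LA; have LA' := wL1_norm pX LA1.
rewrite /strip_op -(wintB pX); [|exact: kernel_strip_L1|exact: kernel_strip_L1].
rewrite mulrAC; apply: le_trans (ler_wpM2l _ (wint_norm_sqrt pX LA)); last first.
  by rewrite mulr_ge0.
rewrite -(wintZ pX)//; apply: (le_norm_wint pX).
- by apply: (wL1B pX); exact: kernel_strip_L1.
- exact: (wL1Z pX).
- move=> p [_ Ip]; rewrite -mulrBl normrM ler_wpM2r//.
  by case: HW => _ _ _ + _; exact.
Qed.

Lemma strip_op_prod k f x : I01 x -> gL1 k -> IL1 f ->
  strip_op (fun p => k p.1 * f p.2) x = gint k * kop W f x.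
Proof.
move=> Ix Lk Lf; rewrite /kop -strip_prod_int//; last exact: (kernelM_L1 HW).
by congr wint; apply/funext => p; rewrite mulrCA.
Qed.

Lemma strip_op_null A B x : I01 x -> XL2 A -> XL2 B -> Xsq (fun p => A p - B p) = 0 ->
  strip_op A x = strip_op B x.
Proof.
move=> Ix LA LB AB.
have LAB : XL2 (fun p => A p - B p) by exact: (wL2B pX).
have : Xint (fun p => W x p.2 * A p - W x p.2 * B p) = 0.
  rewrite -(wsq0_wint pX (kernel_strip_measurable Ix) LAB AB); congr wint.
  by apply/funext => p; rewrite mulrBr.
rewrite (wintB pX); first by move=> /eqP; rewrite subr_eq0 => /eqP.
  exact/kernel_strip_L1/(wL2_L1 pX).
exact/kernel_strip_L1/(wL2_L1 pX).
Qed.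

Definition cstrip_op (Z : RR -> R[i]) (x : R) : R[i] :=
  (strip_op (fun p => complex.Re (Z p)) x +i* strip_op (fun p => complex.Im (Z p)) x)%C.

Definition cint (m : R -> R[i]) : R[i] :=
  (gint (fun l => complex.Re (m l)) +i* gint (fun l => complex.Im (m l)))%C.

Local Notation XC := (L2 leb2 SX gX).
Local Notation Xcsq := (csq leb2 SX gX).

(** The iterated integral of [calP] is a double integral, because [W x] is bounded and
[Z] is integrable for the weight. *)
Lemma calPE Z x : I01 x -> XC Z -> calP g W Z x = cstrip_op Z x.
Proof.
move=> Ix /(L2E pX)[L1 L2].
have [_ I1] := kernel_strip_L1 Ix (wL2_L1 pX L1).
have [_ I2] := kernel_strip_L1 Ix (wL2_L1 pX L2).
apply: complex_ext.
  transitivity (\int[leb]_(y in I01) \int[leb]_l (W x y * complex.Re (Z (l, y)) * g l)).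
    rewrite /calP /cintegral [LHS]/=.
    apply: eq_Rintegral => y _; apply: eq_Rintegral => l _.
    by rewrite !ReImE [complex.Re _%:C%C]/= [complex.Im _%:C%C]/= !(mul0r, mulr0, subr0).
  exact: (strip_fubini I1).
transitivity (\int[leb]_(y in I01) \int[leb]_l (W x y * complex.Im (Z (l, y)) * g l)).
  rewrite /calP /cintegral [LHS]/=.
  apply: eq_Rintegral => y _; apply: eq_Rintegral => l _.
  by rewrite !ReImE [complex.Re _%:C%C]/= [complex.Im _%:C%C]/= !(mul0r, mulr0, addr0, add0r).
exact: (strip_fubini I2).
Qed.

Lemma cstrip_opD Z Y x : I01 x -> XC Z -> XC Y ->
  cstrip_op (fun p => Z p + Y p) x = cstrip_op Z x + cstrip_op Y x.
Proof.
move=> Ix /(L2E pX)[a1 a2] /(L2E pX)[b1 b2]; apply: complex_ext; rewrite ReImE /=.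
  rewrite -strip_opD//; [|exact: (wL2_L1 pX)|exact: (wL2_L1 pX)].
  by congr strip_op; apply/funext => p; rewrite cReD.
rewrite -strip_opD//; [|exact: (wL2_L1 pX)|exact: (wL2_L1 pX)].
by congr strip_op; apply/funext => p; rewrite cImD.
Qed.

Lemma cstrip_opZ c Z x : I01 x -> XC Z ->
  cstrip_op (fun p => c * Z p) x = c * cstrip_op Z x.
Proof.
move=> Ix /(L2E pX)[/(wL2_L1 pX) a1 /(wL2_L1 pX) a2]; apply: complex_ext; rewrite ReImE /=.
  rewrite -!strip_opZ// -mulN1r -strip_opZ//; last exact: (wL1Z pX).
  rewrite -strip_opD//; [|exact: (wL1Z pX)|by do 2 apply: (wL1Z pX)].
  by congr strip_op; apply/funext => p; rewrite cReM mulN1r.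
rewrite -!strip_opZ// -strip_opD//; [|exact: (wL1Z pX)|exact: (wL1Z pX)].
by congr strip_op; apply/funext => p; rewrite cImM.
Qed.

Lemma cstrip_op_bnd Z x : I01 x -> XC Z ->
  normc (cstrip_op Z x) <= 2 * M * Num.sqrt (Xcsq Z).
Proof.
move=> Ix LZ; have /(L2E pX)[a1 a2] := LZ.
apply: le_trans (normc_le _) _ => /=.
rewrite (_ : 2 * M * _ = M * Num.sqrt (Xcsq Z) + M * Num.sqrt (Xcsq Z)); last by ring.
apply: lerD; apply: le_trans (strip_op_bnd Ix _) _ => //; apply: ler_wpM2l => //.
  by rewrite ler_wsqrtr// /csq lerDl (wsq_ge0 pX).
by rewrite ler_wsqrtr// /csq lerDr (wsq_ge0 pX).
Qed.

Lemma cstrip_op_lip Z : XC Z -> clipI (cstrip_op Z) (2 * L * Num.sqrt (Xcsq Z)).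
Proof.
move=> LZ x y Ix Iy; have /(L2E pX)[a1 a2] := LZ.
apply: le_trans (normc_le _) _; rewrite !ReImE /=.
rewrite (_ : 2 * L * _ * _ = L * Num.sqrt (Xcsq Z) * `|x - y| +
   L * Num.sqrt (Xcsq Z) * `|x - y|); last by ring.
apply: lerD; apply: le_trans (strip_op_lip _ Ix Iy) _ => //;
    apply: ler_wpM2r => //; apply: ler_wpM2l => //.
  by rewrite ler_wsqrtr// /csq lerDl (wsq_ge0 pX).
by rewrite ler_wsqrtr// /csq lerDr (wsq_ge0 pX).
Qed.

Lemma cstrip_op_null Z Y x : I01 x -> XC Z -> XC Y -> Xcsq (fun p => Z p - Y p) = 0 ->
  cstrip_op Z x = cstrip_op Y x.
Proof.
move=> Ix /(L2E pX)[a1 a2] /(L2E pX)[b1 b2] /(csq_eq0 pX)[h1 h2].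
rewrite /cstrip_op; congr Complex; apply: strip_op_null => //.
  by rewrite -h1; congr wsq; apply/funext => p; rewrite cReD cReN.
by rewrite -h2; congr wsq; apply/funext => p; rewrite cImD cImN.
Qed.

Lemma L2_strip_prod m p B : gL2 (fun l => complex.Re (m l)) ->
  gL2 (fun l => complex.Im (m l)) -> bddI p B -> XC (fun q => m q.1 * p q.2).
Proof.
move=> m1 m2 [p1 p2 pB].
have q1 : IL2 (fun y => complex.Re (p y)).
  by apply: (wL2_bnd pI (B := B)) => // y Iy; exact: le_trans (cnorm_ge_Re _) (pB _ Iy).
have q2 : IL2 (fun y => complex.Im (p y)).
  by apply: (wL2_bnd pI (B := B)) => // y Iy; exact: le_trans (cnorm_ge_Im _) (pB _ Iy).
apply/(L2E pX); split.
  have := wL2B pX (strip_prod_L2 m1 q1) (strip_prod_L2 m2 q2).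
  by congr wL2; apply/funext => q; rewrite cReM.
have := wL2D pX (strip_prod_L2 m1 q2) (strip_prod_L2 m2 q1).
by congr wL2; apply/funext => q; rewrite cImM.
Qed.

Lemma cstrip_op_prod m p B x : I01 x -> gL2 (fun l => complex.Re (m l)) ->
  gL2 (fun l => complex.Im (m l)) -> bddI p B ->
  cstrip_op (fun q => m q.1 * p q.2) x = cint m * ckop W p x.
Proof.
move=> Ix /(wL2_L1 pg) m1 /(wL2_L1 pg) m2 pb; have [p1 p2] := bddI_L1 pb.
apply: complex_ext; rewrite ReImE /=.
  have s1 := strip_prod_L1 m1 p1; have s2 := strip_prod_L1 m2 p2.
  rewrite -(strip_op_prod Ix m1 p1) -(strip_op_prod Ix m2 p2).
  rewrite -mulN1r -(strip_opZ _ Ix s2) -(strip_opD Ix s1); last exact: (wL1Z pX).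
  by congr strip_op; apply/funext => q; rewrite cReM mulN1r.
have s1 := strip_prod_L1 m1 p2; have s2 := strip_prod_L1 m2 p1.
rewrite -(strip_op_prod Ix m1 p2) -(strip_op_prod Ix m2 p1) -(strip_opD Ix s1 s2).
by congr strip_op; apply/funext => q; rewrite cImM.
Qed.

End strip_L2.

(** * Multipliers of square-integrable functions *)

Section complex_L2_closure.
Context d (T : measurableType d) (R : realType).
Variables (mu : {measure set T -> \bar R}) (D : set T) (w : T -> R).
Hypothesis pw : prob_weight mu D w.
Let mD : measurable D. Proof. by case: pw. Qed.
Local Notation L2w := (L2 mu D w).
Local Notation csqw := (csq mu D w).

Definition cmeas (f : T -> R[i]) : Prop :=
  measurable_fun D (fun x => complex.Re (f x)) /\
  measurable_fun D (fun x => complex.Im (f x)).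

Lemma L2_cmeas f : L2w f -> cmeas f.
Proof. by move=> [m1 m2 _]. Qed.

Lemma cmeasM f h : cmeas f -> cmeas h -> cmeas (fun x => f x * h x).
Proof.
move=> [f1 f2] [h1 h2]; split.
  rewrite (_ : (fun x => _) = fun x =>
     complex.Re (f x) * complex.Re (h x) - complex.Im (f x) * complex.Im (h x)).
    by apply: measurable_funB; exact: measurable_funM.
  by apply/funext => x; rewrite cReM.
rewrite (_ : (fun x => _) = fun x =>
   complex.Re (f x) * complex.Im (h x) + complex.Im (f x) * complex.Re (h x)).
  by apply: measurable_funD; exact: measurable_funM.
by apply/funext => x; rewrite cImM.
Qed.

Lemma cmeas_real (f : T -> R) : measurable_fun D f -> cmeas (fun x => (f x)%:C%C).
Proof. by move=> mf; split=> //; exact: measurable_cst. Qed.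

Lemma cmeas_cst (c : R[i]) : cmeas (fun=> c).
Proof. by split; exact: measurable_cst. Qed.

Lemma measurable_csqr_norm f : cmeas f -> measurable_fun D (fun x => csqr_norm (f x)).
Proof. by move=> [m1 m2]; apply: measurable_funD; exact: measurable_funX. Qed.

Lemma csqE f : L2w f -> wL1 mu D w (fun x => csqr_norm (f x)) /\
  csqw f = wint mu D w (fun x => csqr_norm (f x)).
Proof.
move=> /(L2E pw)[/wL2E[_ h1] /wL2E[_ h2]]; split; first exact: (wL1D pw h1 h2).
by rewrite /csq /wsq -(wintD pw).
Qed.

Lemma L2_le f h B : cmeas f -> L2w h ->
  (forall x, D x -> csqr_norm (f x) <= B * csqr_norm (h x)) ->
  L2w f /\ csqw f <= B * csqw h.
Proof.
move=> mf Lh fh; have [Lh1 ->] := csqE Lh.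
have Lf : wL1 mu D w (fun x => csqr_norm (f x)).
  apply: (wL1_le pw (measurable_csqr_norm mf) (wL1Z pw B Lh1)) => x Dx.
  by rewrite ger0_norm ?csqr_norm_ge0// fh.
have L2f : L2w f.
  have [m1 m2] := mf; split=> //.
  apply/(wL1_ltyP pw (measurable_csqr_norm mf)) => //.
  by move=> x _; exact: csqr_norm_ge0.
split=> //; rewrite (csqE L2f).2 -(wintZ pw)//; apply: (le_wint pw) => //.
exact: (wL1Z pw).
Qed.

Lemma csqr_normM (z u : R[i]) : csqr_norm (z * u) = csqr_norm z * csqr_norm u.
Proof. by rewrite -!normc_sqr Normc.normcM exprMn. Qed.

Lemma L2_bM b B f : cmeas b -> (forall x, D x -> normc (b x) <= B) -> L2w f ->
  L2w (fun x => b x * f x) /\ csqw (fun x => b x * f x) <= B ^+ 2 * csqw f.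
Proof.
move=> mb bB Lf; apply: L2_le => //; first exact: cmeasM (L2_cmeas Lf).
move=> x Dx; rewrite csqr_normM ler_wpM2r ?csqr_norm_ge0// -normc_sqr.
by rewrite lerXn2r ?nnegrE ?normc_ge0 ?bB// (le_trans _ (bB _ Dx))// normc_ge0.
Qed.

Lemma L2_bnd b B : cmeas b -> (forall x, D x -> normc (b x) <= B) ->
  L2w b /\ csqw b <= B ^+ 2.
Proof.
move=> mb bB.
have L1' : L2w (fun=> 1).
  by apply/(L2E pw); split; [apply: (wL2_bnd pw (B := 1))|apply: (wL2_bnd pw (B := 0))] => //= x _;
     rewrite ?normr1 ?normr0.
have c1 : csqw (fun=> 1) = 1.
  rewrite (csqE L1').2 -[RHS](wint_cst pw); congr wint; apply/funext => x.
  by rewrite /csqr_norm /= expr1n expr0n addr0.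
have := L2_bM mb bB L1'; rewrite c1 mulr1.
by rewrite (_ : (fun x => b x * 1) = b)//; apply/funext => x; rewrite mulr1.
Qed.

Lemma L2Z c f : L2w f -> L2w (fun x => c * f x) /\ csqw (fun x => c * f x) <= normc c ^+ 2 * csqw f.
Proof. by apply: L2_bM => //; exact: cmeas_cst. Qed.

Lemma L2D f h : L2w f -> L2w h -> L2w (fun x => f x + h x).
Proof.
move=> /(L2E pw)[f1 f2] /(L2E pw)[h1 h2]; apply/(L2E pw); split.
  by have := wL2D pw f1 h1; congr wL2; apply/funext => x; rewrite cReD.
by have := wL2D pw f2 h2; congr wL2; apply/funext => x; rewrite cImD.
Qed.

Lemma L2N f : L2w f -> L2w (fun x => - f x).
Proof.
move=> /(L2Z (-1))[+ _]; congr L2; apply/funext => x; exact: mulN1r.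
Qed.

Lemma L2B f h : L2w f -> L2w h -> L2w (fun x => f x - h x).
Proof. by move=> Lf /L2N; exact: L2D. Qed.

Lemma csqD_le f h : L2w f -> L2w h ->
  csqw (fun x => f x + h x) <= 2 * csqw f + 2 * csqw h.
Proof.
move=> /(L2E pw)[f1 f2] /(L2E pw)[h1 h2]; rewrite /csq.
have := wsqD_le pw f1 h1; have := wsqD_le pw f2 h2.
rewrite (_ : (fun x => complex.Re (f x + h x)) = fun x => complex.Re (f x) + complex.Re (h x)).
  rewrite (_ : (fun x => complex.Im (f x + h x)) = fun x => complex.Im (f x) + complex.Im (h x)).
    lra.
  by apply/funext => x; rewrite cImD.
by apply/funext => x; rewrite cReD.
Qed.

Lemma csqN f : csqw (fun x => - f x) = csqw f.
Proof.
rewrite /csq /wsq; congr (_ + _); congr wint; apply/funext => x.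
  by rewrite cReN sqrrN.
by rewrite cImN sqrrN.
Qed.

(** The multiplier may be unbounded: a null vector vanishes almost everywhere. *)
Lemma csq0M h f : cmeas h -> L2w f -> csqw f = 0 ->
  L2w (fun x => h x * f x) /\ csqw (fun x => h x * f x) = 0.
Proof.
move=> mh Lf f0; have /(L2E pw)[f1 f2] := Lf; have [m1 m2] := L2_cmeas Lf.
have [n1 n2] := csq_eq0 pw f0; have [h1 h2] := mh.
pose s x := `|complex.Re (h x)| + `|complex.Im (h x)|.
have ms : measurable_fun D s.
  by apply: measurable_funD; exact: measurableT_comp.
have [a1 b1] := wsq0M pw ms f1 n1; have [a2 b2] := wsq0M pw ms f2 n2.
have Lg : L2w (fun x => (s x)%:C%C * f x).
  apply/(L2E pw); split.
    by move: a1; congr wL2; apply/funext => x; rewrite cReM /= mul0r subr0.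
  by move: a2; congr wL2; apply/funext => x; rewrite cImM /= mul0r addr0.
have g0 : csqw (fun x => (s x)%:C%C * f x) = 0.
  transitivity (0 + 0 : R); last exact: addr0.
  rewrite /csq -{1}b1 -{1}b2; congr (_ + _); congr wsq.
    by apply/funext => x; rewrite cReM /= mul0r subr0.
  by apply/funext => x; rewrite cImM /= mul0r addr0.
have [|L le0] := @L2_le (fun x => h x * f x) _ 1 (cmeasM mh (L2_cmeas Lf)) Lg.
  move=> x Dx; rewrite mul1r !csqr_normM ler_wpM2r ?csqr_norm_ge0//.
  rewrite -!normc_sqr normc_real lerXn2r ?nnegrE ?normc_ge0//.
  by rewrite ger0_norm ?addr_ge0// normc_le.
split=> //; apply/eqP; rewrite eq_le (csq_ge0 pw) andbT.
by move: le0; rewrite g0 mulr0.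
Qed.

Lemma eq_L2 f h : (forall x, D x -> f x = h x) -> L2w f -> L2w h.
Proof.
move=> fh Lf; have [m1 m2] := L2_cmeas Lf.
have mh : cmeas h.
  split.
    by apply: eq_measurable_fun m1 => x; rewrite inE => /fh ->.
  by apply: eq_measurable_fun m2 => x; rewrite inE => /fh ->.
by apply: (proj1 (@L2_le h f 1 mh Lf _)) => x Dx; rewrite fh// mul1r.
Qed.

Lemma eq_L2norm f h : (forall x, D x -> f x = h x) ->
  L2norm mu D w f = L2norm mu D w h.
Proof.
by move=> fh; rewrite /L2norm; congr Num.sqrt; apply: eq_Rintegral => x; rewrite inE => /fh ->.
Qed.

Lemma csq_ae0 f : cmeas f -> {ae mu, forall x, D x -> f x = 0} -> csqw f = 0.
Proof.
move=> [m1 m2] f0.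
suff H (h : T -> R) : measurable_fun D h -> {ae mu, forall x, D x -> h x = 0} -> wsq mu D w h = 0.
  rewrite /csq !H ?addr0//; apply: filterS f0 => x + Dx => /(_ Dx) -> //.
move=> mh h0; rewrite /wsq /wint /Rintegral (ae_eq_integral (cst 0%E)) ?integral0//.
  apply/measurable_EFinP; apply: measurable_funM; first exact: measurable_funX.
  by case: pw.
by apply: filterS h0 => x + Dx => /(_ Dx) ->; rewrite expr0n mul0r.
Qed.

End complex_L2_closure.

(** * Eigenvalues and resolvent of the Kuramoto operator *)

Section line.
Context (R : realType).
Local Notation leb := (@lebesgue_measure R).
Local Notation leb2 := (@lebesgue_measure R \x @lebesgue_measure R)%E.
Local Notation RR := (measurableTypeR R * measurableTypeR R)%type.

Lemma negligible_line (b : R) : {ae leb2, forall p : RR, p.1 != b}.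
Proof.
exists ([set b] `*` setT); split.
- by apply: measurableX.
- transitivity (leb [set b] * leb setT)%E; first exact: product_measure1E.
  by rewrite (lebesgue_measure_set1 b) mul0e.
- move=> p /= /negP; rewrite negbK => /eqP ->.
  by split.
Qed.

End line.

Section kuramoto_spectrum.
Context (R : realType) (g : R -> R) (W : R -> R -> R) (K M L : R).
Hypothesis g_ge0 : forall w, 0 <= g w.
Hypothesis g_int1 : (\int[@lebesgue_measure R]_(w in setT) (g w)%:E = 1)%E.
Hypothesis g_cont : continuous g.
Hypothesis g_even : forall w, g (- w) = g w.
Hypothesis g_decr : forall a b : R, 0 < a -> a <= b -> g b <= g a.
Hypothesis HW : lip_kernel W M L.
Local Notation leb := (@lebesgue_measure R).
Local Notation leb2 := (@lebesgue_measure R \x @lebesgue_measure R)%E.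
Local Notation I01 := (@unitI R).
Local Notation RR := (measurableTypeR R * measurableTypeR R)%type.
Local Notation SX := (@stripX R : set RR).
Local Notation gX := (fun p : RR => g p.1).
Local Notation gL2 := (wL2 leb setT g).
Local Notation gint := (wint leb setT g).
Local Notation XC := (L2 leb2 SX gX).
Local Notation Xcsq := (csq leb2 SX gX).
Local Notation Xmeas := (cmeas SX).
Local Notation P := (cstrip_op g W).
Local Notation T := (kuramoto_op g W K).
Let pg : prob_weight leb setT g := density_weight g_ge0 g_int1 g_cont.
Let pX := strip_weight pg.
Let k2 : R[i] := (K / 2)%:C%C.

(** [1 / (l - i w)], with the value [0] at the pole when [l] is imaginary. *)
Definition mres (l : R[i]) (w : R) : R[i] :=
  (res_re (complex.Re l) (complex.Im l) w +i* res_im (complex.Re l) (complex.Im l) w)%C.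

(** The product of [mres l] with [l - i w]: it differs from [1] only on the null set
where the symbol vanishes. *)
Definition offline (l : R[i]) (w : R) : R :=
  if (complex.Re l == 0) && (w == complex.Im l) then 0 else 1.

Lemma mresE l w : (l - 'i%C * w%:C%C) * mres l w = (offline l w)%:C%C.
Proof.
case: l => a b; rewrite /mres /offline /=.
have [/andP[/eqP -> /eqP ->]|H] := ifPn.
  by apply: complex_ext; rewrite !ReImE /= /res_re /res_im; rewrite !subrr expr0n; ring.
have d : a ^+ 2 + (w - b) ^+ 2 != 0.
  rewrite gt_eqF//; apply: res_den_gt0.
  by move: H; rewrite negb_and => /orP[]; [left|right].
apply: complex_ext; rewrite !ReImE /= /res_re /res_im; field => //.
Qed.

Lemma offline_neq0 l w : complex.Re l != 0 -> offline l w = 1.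
Proof. by move=> /negbTE H; rewrite /offline H. Qed.

Lemma offline01 l w : offline l w = 0 \/ offline l w = 1.
Proof. by rewrite /offline; case: ifP => _; [left|right]. Qed.

Lemma measurable_offline l : measurable_fun setT (offline l).
Proof.
apply: measurable_fun_ifT => //.
by apply: measurable_and => //; apply: measurable_fun_eqr => //; exact: measurable_cst.
Qed.

Lemma measurable_mres l : measurable_fun setT (fun w => complex.Re (mres l w)) /\
  measurable_fun setT (fun w => complex.Im (mres l w)).
Proof.
case: l => a b; rewrite /mres /=.
have [->|a0] := eqVneq a 0; last first.
  by split; apply: continuous_measurable_fun; [exact: continuous_res_re|exact: continuous_res_im].
have re0 : res_re 0 b = cst 0 by apply/funext => w; rewrite /res_re mul0r.
split; first by rewrite re0; exact: measurable_cst.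
apply: (@measurable_fun_cvg _ _ _ setT (fun n : nat => res_im n.+1%:R^-1 b)).
  move=> n; apply: continuous_measurable_fun; apply: continuous_res_im.
  by rewrite invr_neq0// pnatr_eq0.
move=> w _; rewrite /res_im.
have [->|wb] := eqVneq w b.
  by rewrite subrr mul0r; under eq_fun do rewrite mul0r; exact: cvg_cst.
apply: cvgM; first exact: cvg_cst.
apply: cvgV; first by rewrite gt_eqF//; apply: res_den_gt0; right.
apply: cvgD; last exact: cvg_cst.
apply: (cvg_comp _ (fun z : R => z ^+ 2)); first exact: cvg_harmonic.
exact: exprn_continuous.
Qed.

Lemma cmeas_strip_fst (m : R -> R[i]) : measurable_fun setT (fun w => complex.Re (m w)) ->
  measurable_fun setT (fun w => complex.Im (m w)) -> Xmeas (fun p => m p.1).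
Proof. by move=> m1 m2; split; [exact: (measurable_strip_fst m1)|exact: (measurable_strip_fst m2)]. Qed.

Lemma cmeas_mres l : Xmeas (fun p => mres l p.1).
Proof. by have [m1 m2] := measurable_mres l; exact: cmeas_strip_fst. Qed.

Lemma cmeas_offline l : Xmeas (fun p => (offline l p.1)%:C%C).
Proof. apply: cmeas_real; exact: (measurable_strip_fst (measurable_offline l)). Qed.

Lemma L2_strip_snd p B : bddI p B -> XC (fun q => p q.2) /\ Xcsq (fun q => p q.2) <= B ^+ 2.
Proof.
move=> [p1 p2 pB]; apply: (L2_bnd pX).
  by split; [exact: (measurable_strip_snd p1)|exact: (measurable_strip_snd p2)].
by move=> q [_ Iq]; exact: pB.
Qed.

Lemma offline_null l Y : XC Y -> XC (fun p => (1 - offline l p.1)%:C%C * Y p) /\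
  Xcsq (fun p => (1 - offline l p.1)%:C%C * Y p) = 0.
Proof.
move=> LY.
have mo : Xmeas (fun p => (1 - offline l p.1)%:C%C).
  apply: cmeas_real; apply: measurable_funB; first exact: measurable_cst.
  exact: (measurable_strip_fst (measurable_offline l)).
split.
  apply: (proj1 (L2_bM pX (B := 1) mo _ LY)) => p _; rewrite normc_real.
  by case: (offline01 l p.1) => ->; rewrite ?subr0 ?subrr ?normr0 ?normr1.
apply: (csq_ae0 pX); first exact: cmeasM (L2_cmeas LY).
have := negligible_line (complex.Im l); apply: filterS => p pb _.
by rewrite /offline (negbTE pb) andbF subrr mul0r.
Qed.

(** [T - l] on the whole plane, with [P] given by a double integral. *)
Definition shift_op (l : R[i]) (Z : RR -> R[i]) : RR -> R[i] :=
  fun p => ('i%C * p.1%:C%C - l) * Z p + k2 * P Z p.2.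

Definition kdom (Z : RR -> R[i]) : Prop := XC Z /\ XC (fun p => p.1%:C%C * Z p).

Lemma shiftE l Z p : XC Z -> SX p -> op_shift T l Z p = shift_op l Z p.
Proof.
move=> LZ [_ Ip]; by rewrite /op_shift /shift_op /= (calPE pg HW Ip LZ) mulrBl addrAC.
Qed.

Lemma P_bdd Z : XC Z -> bddI (P Z) (2 * M * Num.sqrt (Xcsq Z)).
Proof.
move=> LZ; have [m1 m2 _] := clipI_bdd (cstrip_op_lip pg HW LZ).
by split=> // x Ix; exact: (cstrip_op_bnd pg HW).
Qed.

Lemma shift_op_L2 l Z : kdom Z -> XC (shift_op l Z).
Proof.
move=> [LZ LwZ]; rewrite /shift_op.
have H1 := proj1 (L2Z pX 'i%C LwZ); have H2 := proj1 (L2Z pX l LZ).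
have H3 := proj1 (L2Z pX k2 (proj1 (L2_strip_snd (P_bdd LZ)))).
have := L2D pX (L2B pX H1 H2) H3; congr L2; apply/funext => p.
by rewrite mulrBl mulrA.
Qed.

(** The solution of [(T - l) Z = F] in terms of [p = P Z]. *)
Definition resv (l : R[i]) (p : R -> R[i]) (F : RR -> R[i]) : RR -> R[i] :=
  fun q => mres l q.1 * (k2 * p q.2 - F q).

Lemma resv_dom l p B F : gL2 (fun w => complex.Re (mres l w)) ->
  gL2 (fun w => complex.Im (mres l w)) -> bddI p B -> XC F ->
  XC (fun q => mres l q.1 * F q) -> kdom (resv l p F).
Proof.
move=> m1 m2 pB LF LmF.
have kpB := bddIZ k2 pB.
have LZ : XC (resv l p F).
  have := L2B pX (L2_strip_prod pg m1 m2 kpB) LmF; congr L2; apply/funext => q.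
  by rewrite /resv mulrBr.
split=> //.
have LY : XC (fun q => (offline l q.1)%:C%C * (k2 * p q.2 - F q)).
  apply: (proj1 (L2_bM pX (B := 1) (cmeas_offline l) _ _)).
    by move=> q _; rewrite normc_real; case: (offline01 l q.1) => ->; rewrite ?normr0 ?normr1.
  exact: (L2B pX (proj1 (L2_strip_snd kpB)) LF).
have H := proj1 (L2Z pX (- 'i%C) (L2B pX (proj1 (L2Z pX l LZ)) LY)).
move: H; congr L2; apply/funext => q.
rewrite -mresE /resv (_ : - 'i%C * _ = - ('i%C ^+ 2) * (q.1%:C%C * (mres l q.1 * (k2 * p q.2 - F q)))).
  by rewrite sqr_i opprK mul1r.
ring.
Qed.

Lemma P_resv l p B F x : I01 x -> gL2 (fun w => complex.Re (mres l w)) ->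
  gL2 (fun w => complex.Im (mres l w)) -> bddI p B ->
  XC (fun q => mres l q.1 * F q) ->
  P (resv l p F) x = k2 * cint g (mres l) * ckop W p x - P (fun q => mres l q.1 * F q) x.
Proof.
move=> Ix m1 m2 pB LmF; have kpB := bddIZ k2 pB.
have LmP := L2_strip_prod pg m1 m2 kpB.
rewrite (_ : resv l p F = fun q => mres l q.1 * (k2 * p q.2) + (-1) * (mres l q.1 * F q)).
  rewrite (cstrip_opD pg HW Ix LmP (proj1 (L2Z pX (-1) LmF))) (cstrip_opZ pg HW _ Ix LmF).
  rewrite (cstrip_op_prod pg HW Ix m1 m2 kpB) (ckopZ HW _ Ix pB); ring.
by apply/funext => q; rewrite /resv; ring.
Qed.

(** The Ansatz [resv] reduces the equation to one for [p] alone; what remains of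
[F - (T - l) Z] lives on the null line [w = Im l]. *)
Lemma resolvent_solve l F : gL2 (fun w => complex.Re (mres l w)) ->
  gL2 (fun w => complex.Im (mres l w)) -> XC F -> XC (fun q => mres l q.1 * F q) ->
  ckop_inj W (k2 * cint g (mres l)) ->
  exists2 Z, kdom Z & Xcsq (fun q => F q - shift_op l Z q) = 0 /\ XC (fun q => F q - shift_op l Z q).
Proof.
move=> m1 m2 LF LmF inj.
have qL := clipIZ (-1) (cstrip_op_lip pg HW LmF).
have [p [[C pC] pE]] := fredholm_solve HW inj qL.
have pB := clipI_bdd pC.
have dZ := resv_dom m1 m2 pB LF LmF.
exists (resv l p F) => //.
pose Y q := F q - k2 * p q.2.
have LY : XC Y by apply: (L2B pX LF); exact: (proj1 (L2_strip_snd (bddIZ k2 pB))).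
have [oL o0] := offline_null l LY.
have E q : SX q -> (1 - offline l q.1)%:C%C * Y q = F q - shift_op l (resv l p F) q.
  move=> [_ Iq]; rewrite /shift_op (P_resv Iq m1 m2 pB LmF).
  rewrite (_ : k2 * cint g (mres l) * ckop W p q.2 - _ = p q.2); last by rewrite pE//; ring.
  rewrite /resv mulrA (_ : ('i%C * q.1%:C%C - l) * mres l q.1 = - (offline l q.1)%:C%C).
    by rewrite /Y rmorphB; ring.
  by rewrite -mresE; ring.
split; last exact: (eq_L2 pX E oL).
by rewrite -o0; apply: eq_csq => q Sq; rewrite E.
Qed.

Lemma lipI_normc (p : R -> R[i]) C : clipI p C -> lipI (fun x => normc (p x)) C.
Proof.
move=> pC x y Ix Iy; apply: le_trans (pC x y Ix Iy).
have H (z u : R[i]) : normc z - normc u <= normc (z - u).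
  by rewrite lerBlDr -{1}(subrK u z); exact: le_normcD.
by rewrite ler_norml H andbT lerNl opprB normc_distC H.
Qed.

(** Where [p] is nonzero the product controls [m]; so if [m p] is a vector, then [m]
is square integrable for [g]. *)
Lemma L2_strip_prod_fst (m p : R -> R[i]) C x0 : measurable_fun setT (fun w => complex.Re (m w)) ->
  measurable_fun setT (fun w => complex.Im (m w)) -> clipI p C -> I01 x0 -> p x0 != 0 ->
  XC (fun q => m q.1 * p q.2) ->
  gL2 (fun w => complex.Re (m w)) /\ gL2 (fun w => complex.Im (m w)).
Proof.
move=> m1 m2 pC Ix0 px0 Lmp.
have np := lipI_normc pC; have mp := lipI_measurable np.
have p0 : wsq leb I01 (cst 1) (fun x => normc (p x)) != 0.
  by rewrite gt_eqF//; apply: (lipI_sq_gt0 np Ix0); rewrite normc_eq0.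
have key (k : R -> R) : measurable_fun setT k -> (forall w, k w ^+ 2 <= csqr_norm (m w)) -> gL2 k.
  move=> mk km; apply: (strip_prod_L2_fst pg mk mp _ p0).
  have mkp : measurable_fun SX (fun q : RR => k q.1 * normc (p q.2)).
    by apply: measurable_funM; [exact: (measurable_strip_fst mk)|exact: (measurable_strip_snd mp)].
  apply/wL2E; split=> //; apply: (wL1_le pX _ (csqE pX Lmp).1); first exact: measurable_funX.
  move=> q _; rewrite ger0_norm ?sqr_ge0// exprMn normc_sqr csqr_normM.
  by rewrite ler_wpM2r// csqr_norm_ge0.
by split; apply: key => // w; rewrite /csqr_norm ?lerDl ?lerDr sqr_ge0.
Qed.

(** An eigenvector is, up to a null function, [mres l * (K / 2) P Z], so that applying
[P] once more shows [P Z] to be a fixed point.  If [P Z] were zero, so would be the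
eigenvector. *)
Lemma point_spectrum_fix l : point_spectrum T l -> exists p C x0,
  [/\ clipI p C, I01 x0, p x0 != 0 &
   forall x, I01 x -> p x = k2 * cint g (mres l) * ckop W p x].
Proof.
move=> [Z [domZ nZ shZ]]; have dZ : kdom Z := domZ; have [LZ _] := dZ.
have LF := shift_op_L2 l dZ; set F := shift_op l Z in LF.
have F0 : Xcsq F = 0.
  apply/eqP; rewrite -(L2norm_eq0 pX LF) -[X in _ == X]shZ; apply/eqP.
  by apply: eq_L2norm => q Sq; rewrite shiftE.
have [LmF mF0] := csq0M pX (cmeas_mres l) LF F0.
have Loff : XC (fun q => (offline l q.1)%:C%C * Z q).
  apply: (proj1 (L2_bM pX (B := 1) (cmeas_offline l) _ LZ)) => q _; rewrite normc_real.
  by case: (offline01 l q.1) => ->; rewrite ?normr0 ?normr1.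
have offE : (fun q => (offline l q.1)%:C%C * Z q) = resv l (P Z) F.
  by apply/funext => q; rewrite -mresE /resv /F /shift_op; ring.
have [L1off off0] := offline_null l LZ.
have dE : (fun q => Z q - resv l (P Z) F q) = fun q => (1 - offline l q.1)%:C%C * Z q.
  by apply/funext => q; rewrite -offE rmorphB mulrBl mul1r.
have pL := cstrip_op_lip pg HW LZ; have pB := P_bdd LZ.
have LmP : XC (fun q => mres l q.1 * (k2 * P Z q.2)).
  have := L2D pX Loff LmF; congr L2; apply/funext => q.
  by rewrite -mresE /F /shift_op; ring.
have [[x0 [Ix0 px0]]|H] := pselect (exists x, I01 x /\ k2 * P Z x != 0); last first.
  exfalso; move/negP: nZ; apply.
  rewrite [op_norm _ _]/(L2norm leb2 SX gX Z) (L2norm_eq0 pX LZ) eq_le (csq_ge0 pX) andbT.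
  rewrite (_ : Z = fun q => (1 - offline l q.1)%:C%C * Z q + (offline l q.1)%:C%C * Z q); last first.
    by apply/funext => q; rewrite rmorphB; ring.
  apply: le_trans (csqD_le pX L1off Loff) _; rewrite off0.
  rewrite [X in _ + 2 * X](_ : _ = Xcsq (fun q => - (mres l q.1 * F q))).
    by rewrite csqN mF0 !mulr0 addr0.
  rewrite offE; apply: eq_csq => q [_ Iq].
  have -> : resv l (P Z) F q = mres l q.1 * (k2 * P Z q.2) - mres l q.1 * F q.
    by rewrite /resv mulrBr.
  have -> : k2 * P Z q.2 = 0 by apply/eqP/negPn/negP => h; apply: H; exists q.2.
  by rewrite mulr0 sub0r.
have [m1 m2] := measurable_mres l.
have [g1 g2] := L2_strip_prod_fst m1 m2 (clipIZ k2 pL) Ix0 px0 LmP.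
exists (P Z), (2 * L * Num.sqrt (Xcsq Z)), x0; split=> //.
  by apply: contra px0 => /eqP ->; rewrite mulr0.
move=> x Ix; have Lres : XC (resv l (P Z) F) by rewrite -offE.
rewrite [LHS](cstrip_op_null pg HW Ix LZ Lres); last by rewrite dE.
rewrite (P_resv Ix g1 g2 pB LmF).
have -> : P (fun q => mres l q.1 * F q) x = 0.
  apply/eqP; rewrite -normc_eq0 eq_le normc_ge0 andbT.
  by apply: le_trans (cstrip_op_bnd pg HW Ix LmF) _; rewrite mF0 sqrtr0 mulr0.
by rewrite subr0.
Qed.

Lemma Re_fix l : complex.Re (k2 * cint g (mres l)) =
  K / 2 * gint (res_re (complex.Re l) (complex.Im l)).
Proof. by rewrite cReM /= mul0r subr0. Qed.

Lemma Im_fix l : complex.Im (k2 * cint g (mres l)) =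
  K / 2 * gint (res_im (complex.Re l) (complex.Im l)).
Proof. by rewrite cImM /= mul0r addr0. Qed.

Lemma gint_res_re0 b : gint (res_re 0 b) = 0.
Proof.
rewrite /wint; under eq_Rintegral do rewrite /res_re mul0r mul0r.
by rewrite /Rintegral integral0.
Qed.

(** By the symmetry of [W] the constant is real and nonzero.  Its imaginary part
is zero only if [l] is real, and its real part is zero if [Re l = 0]. *)
Lemma fix_real l p C x0 : clipI p C -> I01 x0 -> p x0 != 0 ->
  (forall x, I01 x -> p x = k2 * cint g (mres l) * ckop W p x) ->
  [/\ l = (complex.Re l)%:C%C, complex.Re l != 0 &
   exists z, [/\ z != 0, keig W z & K / 2 * gint (res_re (complex.Re l) 0) * z = 1]].
Proof.
move=> pC Ix0 px0 pE.
have [] := ckop_keig HW pC Ix0 px0 pE.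
rewrite Re_fix Im_fix => /eqP i0 r0 kz.
have K0 : K / 2 != 0 by move: r0; rewrite mulf_eq0 negb_or => /andP[].
have a0 : complex.Re l != 0.
  by apply: contra r0 => /eqP ->; rewrite gint_res_re0 mulr0.
have b0 : complex.Im l = 0.
  apply/eqP; move: i0; rewrite mulf_eq0 (negbTE K0)/=; apply: contraLR.
  exact: wint_res_im_neq0.
rewrite b0 in r0 kz; split=> //; first exact: complex_ext.
exists (K / 2 * gint (res_re (complex.Re l) 0))^-1; split=> //.
  by rewrite invr_eq0.
by rewrite mulfV.
Qed.

Lemma gL2_mres l : complex.Re l != 0 -> gL2 (fun w => complex.Re (mres l w)) /\
  gL2 (fun w => complex.Im (mres l w)).
Proof.
move=> a0; have [m1 m2] := measurable_mres l; split.
  by apply: (wL2_bnd pg (B := `|complex.Re l|^-1)) => // w _; case: (res_bnd (complex.Im l) w a0).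
by apply: (wL2_bnd pg (B := `|complex.Re l|^-1)) => // w _; case: (res_bnd (complex.Im l) w a0).
Qed.

Lemma mres_bnd l w : complex.Re l != 0 -> normc (mres l w) <= 2 / `|complex.Re l|.
Proof.
move=> a0; apply: le_trans (normc_le _) _ => /=.
by have [] := res_bnd (complex.Im l) w a0; lra.
Qed.

Lemma L2_mres l F : complex.Re l != 0 -> XC F -> XC (fun q => mres l q.1 * F q) /\
  Xcsq (fun q => mres l q.1 * F q) <= (2 / `|complex.Re l|) ^+ 2 * Xcsq F.
Proof.
move=> a0 LF; apply: (L2_bM pX (cmeas_mres l)) => // q _; exact: mres_bnd.
Qed.

(** Conversely [mres l * (K / 2) p] is an eigenvector. *)
Lemma fix_point_spectrum l p C x0 : complex.Re l != 0 -> clipI p C -> I01 x0 ->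
  p x0 != 0 -> (forall x, I01 x -> p x = k2 * cint g (mres l) * ckop W p x) ->
  point_spectrum T l.
Proof.
move=> a0 pC Ix0 px0 pE; have pB := clipI_bdd pC.
have [m1 m2] := gL2_mres a0.
pose F : RR -> R[i] := fun=> 0.
have LF : XC F.
  by apply: (proj1 (L2_bnd pX (B := 0) (cmeas_cst _ _) _)) => q _; rewrite Normc.normc0.
have [LmF _] := L2_mres a0 LF.
have dZ := resv_dom m1 m2 pB LF LmF; have [LZ _] := dZ.
have PZ x : I01 x -> P (resv l p F) x = p x.
  move=> Ix; rewrite (P_resv Ix m1 m2 pB LmF) -pE//.
  rewrite (_ : (fun q => _) = fun q => 0 * F q); last first.
    by apply/funext => q; rewrite mulr0 mul0r.
  by rewrite (cstrip_opZ pg HW _ Ix LF) mul0r subr0.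
exists (resv l p F); split=> //.
  rewrite [op_norm _ _]/(L2norm leb2 SX gX _) (L2norm_eq0 pX LZ).
  apply: contra px0 => /eqP Z0; rewrite -PZ// -normc_eq0 eq_le normc_ge0 andbT.
  by apply: le_trans (cstrip_op_bnd pg HW Ix0 LZ) _; rewrite Z0 sqrtr0 mulr0.
apply: L2norm_zero => q Sq; rewrite shiftE//.
have [_ Iq] := Sq; rewrite /shift_op PZ// /resv /F subr0 mulrA.
rewrite (_ : ('i%C * q.1%:C%C - l) * mres l q.1 = - (offline l q.1)%:C%C).
  by rewrite offline_neq0// rmorph1; ring.
by rewrite -mresE; ring.
Qed.

Lemma not_point_inj l : complex.Re l != 0 -> ~ point_spectrum T l ->
  ckop_inj W (k2 * cint g (mres l)).
Proof.
move=> a0 npl p C pC pE x Ix; apply/eqP/negPn/negP => px.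
exact: npl (fix_point_spectrum a0 pC Ix px pE).
Qed.

Lemma L2normB_shift_op l Z F : kdom Z -> XC F -> Xcsq (fun q => F q - shift_op l Z q) = 0 ->
  op_norm T (fun q => F q - op_shift T l Z q) = 0.
Proof.
move=> dZ LF H; have LFs := L2B pX LF (shift_op_L2 l dZ).
transitivity (L2norm leb2 SX gX (fun q => F q - shift_op l Z q)).
  by apply: eq_L2norm => q Sq; rewrite shiftE//; case: dZ.
by apply/eqP; rewrite (L2norm_eq0 pX LFs) H.
Qed.

(** Here [mres l] is bounded, so that surjectivity and the bound on the inverse both
reduce to the equation for [P Z], where they are the two halves of the Fredholm
alternative. *)
Lemma resolvent_off_axis l : complex.Re l != 0 -> ~ point_spectrum T l -> resolvent_set T l.
Proof.
move=> a0 npl; have inj := not_point_inj a0 npl.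
have [m1 m2] := gL2_mres a0; split.
  move=> F LF; have LF' : XC F := LF.
  have [Z dZ [Z0 _]] := resolvent_solve m1 m2 LF' (proj1 (L2_mres a0 LF')) inj.
  by exists Z => //; exact: L2normB_shift_op.
have [C0 C0P] := fredholm_stable HW inj.
pose B := 2 / `|complex.Re l|.
have B0 : 0 <= B by rewrite divr_ge0.
pose C1 := C0 * (2 * M * B).
exists (Num.sqrt (2 * B ^+ 2 * (normc k2 * C1) ^+ 2 + 2 * B ^+ 2)) => Z domZ.
have dZ : kdom Z := domZ; have [LZ _] := dZ.
have LF := shift_op_L2 l dZ; set F := shift_op l Z in LF.
have -> : op_norm T (op_shift T l Z) = L2norm leb2 SX gX F.
  by apply: eq_L2norm => q Sq; rewrite shiftE.
have -> : op_norm T Z = L2norm leb2 SX gX Z by [].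
rewrite (L2normE pX LZ) (L2normE pX LF).
rewrite -sqrtrM; last first.
  have B2 : 0 <= 2 * B ^+ 2 by apply: mulr_ge0 => //; exact: sqr_ge0.
  by apply: addr_ge0 => //; apply: mulr_ge0 => //; exact: sqr_ge0.
rewrite ler_wsqrtr//.
have [LmF mFB] := L2_mres a0 LF; rewrite -/B in mFB.
have ZE : Z = resv l (P Z) F.
  apply/funext => q.
  have o1 : (offline l q.1)%:C%C = 1 by rewrite offline_neq0.
  by rewrite -[LHS]mul1r -[X in X * _]o1 -mresE /resv /F /shift_op; ring.
have pB := P_bdd LZ.
have pE x : I01 x -> P Z x = (-1) * P (fun q => mres l q.1 * F q) x +
    k2 * cint g (mres l) * ckop W (P Z) x.
  move=> Ix; rewrite [in LHS]ZE (P_resv Ix m1 m2 pB LmF); ring.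
have Pb x : I01 x -> normc (P Z x) <= C1 * Num.sqrt (Xcsq F).
  move=> Ix; rewrite /C1 -mulrA; apply: (C0P _ _ _ _ pB pE) => // y Iy.
  rewrite mulN1r normcN; apply: le_trans (cstrip_op_bnd pg HW Iy LmF) _.
  rewrite -[leRHS]mulrA ler_wpM2l ?mulr_ge0//; first by case: HW.
  rewrite -[leRHS](ger0_norm (mulr_ge0 B0 (sqrtr_ge0 _))) -sqrtr_sqr ler_wsqrtr//.
  by rewrite exprMn sqr_sqrtr// (csq_ge0 pX).
have PbB : bddI (fun x => k2 * P Z x) (normc k2 * (C1 * Num.sqrt (Xcsq F))).
  by apply: bddIZ; case: pB => ? ? _; split.
have [LP PP] := L2_strip_snd PbB.
have [LmP mPP] := L2_mres a0 LP; rewrite -/B in mPP.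
rewrite {1}ZE (_ : resv l (P Z) F = fun q => mres l q.1 * (k2 * P Z q.2) + - (mres l q.1 * F q)).
  apply: le_trans (csqD_le pX LmP (L2N pX LmF)) _; rewrite csqN [leRHS]mulrDl; apply: lerD.
    rewrite (_ : 2 * B ^+ 2 * (normc k2 * C1) ^+ 2 * Xcsq F =
        2 * (B ^+ 2 * ((normc k2 * C1) ^+ 2 * Xcsq F))); last by ring.
    apply: ler_wpM2l => //; apply: le_trans mPP _; apply: ler_wpM2l; first exact: sqr_ge0.
    by apply: le_trans PP _; rewrite mulrA exprMn sqr_sqrtr ?(csq_ge0 pX).
  by rewrite -[leRHS]mulrA ler_wpM2l.
by apply/funext => q; rewrite /resv mulrBr.
Qed.

(** * Density of the range on the imaginary axis *)

Definition cut (b : R) (n : nat) (w : R) : R :=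
  if n.+1%:R^-1 <= `|w - b| then 1 else 0.

Lemma cut01 b n w : cut b n w = 0 \/ cut b n w = 1.
Proof. by rewrite /cut; case: ifP => _; [right|left]. Qed.

Lemma cut_id b n : cut b n b = 0.
Proof. by rewrite /cut subrr normr0 leNgt invr_gt0 ltr0n. Qed.

Lemma measurable_cut b n : measurable_fun setT (cut b n).
Proof.
apply: measurable_fun_ifT => //; apply: measurable_fun_ler => //.
by apply: measurableT_comp => //; apply: measurable_funB => //; exact: measurable_cst.
Qed.

Lemma cut_cvg b w : w != b -> 1 - cut b n w @[n --> \oo] --> (0 : R).
Proof.
move=> wb; have d : 0 < `|w - b| by rewrite normr_gt0 subr_eq0.
apply/cvgrPdist_le => e e0; near=> n.
rewrite /cut (_ : n.+1%:R^-1 <= `|w - b|) ?subrr ?normr0 ?ltW//.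
by near: n; exact: near_infty_natSinv_lt (PosNum d).
Unshelve. all: end_near. Qed.

Lemma cut_bnd b n w : `|1 - cut b n w| <= 1.
Proof. by case: (cut01 b n w) => ->; rewrite ?subr0 ?subrr ?normr0 ?normr1. Qed.

Lemma cut_res_im b n w : `|cut b n w * res_im 0 b w| <= n.+1%:R.
Proof.
rewrite /cut; case: ifP => [h|_]; last by rewrite mul0r normr0.
have wb0 : 0 < `|w - b| by apply: lt_le_trans h; rewrite invr_gt0 ltr0n.
have wb : w - b != 0 by rewrite -normr_gt0.
rewrite mul1r /res_im expr0n add0r -{1}[w - b]mul1r expr2 -mulf_div divff// mulr1.
by rewrite div1r normfV invf_ple ?posrE// ltr0n.
Qed.

Lemma strip_cut_small b F (e : R) : XC F -> 0 < e ->
  exists n, Xcsq (fun q => (1 - cut b n q.1)%:C%C * F q) <= e.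
Proof.
move=> LF e0; have /(L2E pX)[F1 F2] := LF.
pose bb n (q : RR) : R := 1 - cut b n q.1.
have mbb n : measurable_fun SX (bb n).
  apply: measurable_funB; first exact: measurable_cst.
  exact: (measurable_strip_fst (measurable_cut b n)).
have b1 n (q : RR) : SX q -> `|bb n q| <= 1 by move=> _; exact: cut_bnd.
have b0 : {ae leb2, forall q : RR, SX q -> bb n q @[n --> \oo] --> (0 : R)}.
  by have := negligible_line b; apply: filterS => q qb _; exact: cut_cvg.
have e2 : 0 < e / 2 by rewrite divr_gt0.
have c1 := wsq_cutoff pX mbb b1 b0 F1; have c2 := wsq_cutoff pX mbb b1 b0 F2.
have [n [/= h1 h2]] : exists n, wsq leb2 SX gX (fun q => bb n q * complex.Re (F q)) <= e / 2 /\
    wsq leb2 SX gX (fun q => bb n q * complex.Im (F q)) <= e / 2.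
  have /cvgrPdist_le/(_ _ e2) h1 := c1; have /cvgrPdist_le/(_ _ e2) h2 := c2.
  have [n [h3 h4]] := filter_ex (filterI h1 h2); exists n.
  move: h3 h4 => /=; rewrite !sub0r !normrN.
  by split; [apply: le_trans (ler_norm _) _|apply: le_trans (ler_norm _) _].
exists n; rewrite /csq (splitr e); apply: lerD.
  apply: le_trans h1; rewrite le_eqVlt; apply/orP; left; apply/eqP; congr wsq.
  by apply/funext => q; rewrite cReM /= mul0r subr0.
apply: le_trans h2; rewrite le_eqVlt; apply/orP; left; apply/eqP; congr wsq.
by apply/funext => q; rewrite cImM /= mul0r addr0.
Qed.

(** If [1 / (w - b)] is not square integrable then the functional
[h |-> int h g / (w - b)] is unbounded, so its kernel is dense.  Concretely, [h] is
a cut-off of [1], corrected by a multiple of a finer cut-off [f] of [1 / (w - b)]: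
removing the value [E] of the functional costs [E ^ 2 / N] in squared norm, where
[N], the squared norm of [f], is as large as desired. *)
Lemma kernel_near1 b (e : R) : ~ gL2 (res_im 0 b) -> 0 < e ->
  exists (h : R -> R) (B : R), [/\ measurable_fun setT h, forall w, `|h w| <= B /\ `|h w * res_im 0 b w| <= B,
    h b = 0, gint (fun w => h w * res_im 0 b w) = 0 & wsq leb setT g (fun w => 1 - h w) <= e].
Proof.
move=> nL2 e0.
have mki : measurable_fun setT (res_im 0 b).
  by have [_] := measurable_mres (0 +i* b)%C.
pose N k := gint (fun w => (cut b k w * res_im 0 b w) ^+ 2).
have mck k : measurable_fun setT (fun w => cut b k w * res_im 0 b w).
  by apply: measurable_funM => //; exact: measurable_cut.
have Lck k : gL2 (fun w => cut b k w * res_im 0 b w).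
  by apply: (wL2_bnd pg (mck k)) => w _; exact: cut_res_im.
have Nunb C : exists k, C <= N k.
  apply: contrapT => H; apply: nL2; apply/wL2E; split=> //.
  apply/(wL1_ltyP pg); [exact: measurable_funX|by move=> w _; exact: sqr_ge0|].
  pose G k w := ((cut b k w * res_im 0 b w) ^+ 2 * g w)%:E.
  have mG k : measurable_fun setT (G k).
    apply/measurable_EFinP; apply: measurable_funM; first exact: measurable_funX.
    by case: pg.
  have G0 k w : (0 <= G k w)%E by rewrite lee_fin mulr_ge0// sqr_ge0.
  have Gnd w : nondecreasing_seq (G^~ w).
    move=> k j kj; rewrite lee_fin; apply: ler_wpM2r => //.
    have q0 : 0 <= res_im 0 b w ^+ 2 by exact: sqr_ge0.
    rewrite [leLHS]exprMn [leRHS]exprMn; apply: ler_wpM2r q0 _ _ _.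
    rewrite /cut; case: ifP => h1; case: ifP => h2 //; rewrite ?expr1n ?expr0n//=.
    move/negP: h2; case; apply: le_trans h1.
    by rewrite lef_pV2 ?posrE ?ltr0n// ler_nat ltnS.
  have Glim w : limn (G^~ w) = (res_im 0 b w ^+ 2 * g w)%:E.
    apply/cvg_lim => //; apply: cvg_EFin; first by near=> k.
    have [->|wb] := eqVneq w b.
      rewrite /comp /G /= /res_im subrr !mul0r.
      by under eq_fun do rewrite mulr0 expr0n mul0r; rewrite expr0n mul0r; exact: cvg_cst.
    have c1 : cut b k w @[k --> \oo] --> (1 : R).
      rewrite (_ : (fun k => cut b k w) = (fun k => 1 - (1 - cut b k w))); last first.
        by apply/funext => k; rewrite subKr.
      by rewrite -[X in _ --> X]subr0; apply: cvgB (cut_cvg wb); exact: cvg_cst.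
    rewrite (_ : _ \o _ = fun k => cut b k w * cut b k w * (res_im 0 b w ^+ 2 * g w)).
      rewrite -[X in _ --> X](mul1r _) -[X in _ --> (X * _ : R)](mul1r 1).
      by apply: cvgM; [exact: cvgM|exact: cvg_cst].
    by apply/funext => k; rewrite /= /G /=; ring.
  have := @monotone_convergence _ _ _ leb setT measurableT G mG (fun k w _ => G0 k w) (fun w _ => Gnd w).
  under eq_integral do rewrite Glim.
  move=> ->; apply: (@le_lt_trans _ _ C%:E); last by rewrite ltry.
  apply: lime_le.
    apply: ereal_nondecreasing_is_cvgn => k j kj; apply: ge0_le_integral => //.
    - exact: mG.
    - exact: mG.
    - by move=> w _; exact: Gnd.
  near=> k; rewrite /G -(wintE pg); last by have /wL2E[] := Lck k.
  by rewrite lee_fin leNgt; apply/negP => h; apply: H; exists k; exact: ltW.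
have e4 : 0 < e / 4 by rewrite divr_gt0.
have [n nE] : exists n, wsq leb setT g (fun w => (1 - cut b n w) * 1) <= e / 4.
  have b0 : {ae leb, forall w : measurableTypeR R, setT w -> 1 - cut b n w @[n --> \oo] --> (0 : R)}.
    have : {ae leb, forall w : measurableTypeR R, w != b}.
      exists [set b]; split; [by []|exact: lebesgue_measure_set1|].
      by move=> w /= /negP; rewrite negbK => /eqP.
    by apply: filterS => w wb _; exact: cut_cvg.
  have mb n : measurable_fun setT (fun w => 1 - cut b n w).
    by apply: measurable_funB; [exact: measurable_cst|exact: measurable_cut].
  have L1 : gL2 (fun=> 1) by apply: (wL2_bnd pg (B := `|1|)) => //; exact: measurable_cst.
  have /cvgrPdist_le/(_ _ e4) h1 := wsq_cutoff pg mb (fun n w _ => cut_bnd b n w) b0 L1.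
  have [n h3] := filter_ex h1; exists n; move: h3 => /=; rewrite sub0r normrN.
  by apply: le_trans; exact: ler_norm.
pose E := gint (fun w => cut b n w * res_im 0 b w).
have [k kE] := Nunb (1 + E ^+ 2 / (e / 4)).
have q0 : 0 <= E ^+ 2 / (e / 4) by apply: mulr_ge0; [exact: sqr_ge0|rewrite invr_ge0 ltW].
have Nk0 : 0 < N k by apply: lt_le_trans kE; rewrite ltr_pwDl.
pose t := E / N k.
exists (fun w => cut b n w - t * (cut b k w * res_im 0 b w)),
  (n.+1%:R + `|t| * (k.+1%:R ^+ 2) + 1 + `|t| * k.+1%:R).
have hk w : (cut b n w - t * (cut b k w * res_im 0 b w)) * res_im 0 b w =
    cut b n w * res_im 0 b w + (- t) * (cut b k w * res_im 0 b w) ^+ 2.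
  by case: (cut01 b k w) => ->; ring.
have /wL2E L2k := Lck k.
split.
- apply: measurable_funB; first exact: measurable_cut.
  by apply: measurable_funM; [exact: measurable_cst|].
- move=> w; have c1 := cut_res_im b n w; have c2 := cut_res_im b k w.
  have a0 : 0 <= `|t| by []. have k0 : 0 <= k.+1%:R :> R by [].
  have n0 : 0 <= n.+1%:R :> R by [].
  have k2' : 0 <= k.+1%:R ^+ 2 :> R by exact: sqr_ge0.
  have tk0 := mulr_ge0 a0 k0; have tk2 := mulr_ge0 a0 k2'.
  have c3 : `|cut b n w| <= 1 by case: (cut01 b n w) => ->; rewrite ?normr0 ?normr1.
  split; [apply: le_trans (ler_normB _ _) _|rewrite hk; apply: le_trans (ler_normD _ _) _].
    have c4 : `|t * (cut b k w * res_im 0 b w)| <= `|t| * k.+1%:R.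
      by rewrite normrM ler_wpM2l.
    lra.
  have c5 : `|- t * (cut b k w * res_im 0 b w) ^+ 2| <= `|t| * k.+1%:R ^+ 2.
    by rewrite normrM normrN normrX ler_wpM2l// lerXn2r// nnegrE.
  lra.
- by rewrite !cut_id; ring.
- transitivity (gint (fun w => cut b n w * res_im 0 b w + (- t) * (cut b k w * res_im 0 b w) ^+ 2)).
    by congr wint; apply/funext => w; exact: hk.
  rewrite (wintD pg); [|exact: (wL2_L1 pg (Lck n))|exact: (wL1Z pg _ L2k.2)].
  rewrite (wintZ pg _ L2k.2) -/(N k) -/E /t; field; by rewrite gt_eqF.
have -> : e = 2 * (e / 4) + 2 * (e / 4) by field.
rewrite (_ : (fun w => 1 - _) = fun w => (1 - cut b n w) * 1 + t * (cut b k w * res_im 0 b w)); last first.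
  by apply/funext => w; ring.
have L1n : gL2 (fun w => (1 - cut b n w) * 1).
  apply: (wL2_bnd pg (B := 1)).
    apply: measurable_funM; last exact: measurable_cst.
    by apply: measurable_funB; [exact: measurable_cst|exact: measurable_cut].
  by move=> w _; rewrite mulr1; exact: cut_bnd.
apply: le_trans (wsqD_le pg L1n (wL2Z pg t (Lck k))) _.
apply: lerD; rewrite ler_wpM2l//.
rewrite (wsqZ pg _ (Lck k)) -[wsq _ _ _ _]/(N k).
have -> : t ^+ 2 * N k = E ^+ 2 / N k by rewrite /t; field; rewrite gt_eqF.
rewrite ler_pdivrMr// mulrC -ler_pdivrMr//.
by apply: le_trans kE; rewrite lerDr.
Unshelve. all: end_near. Qed.

Lemma csq_strip_prod_le (a : R -> R) p B : gL2 a -> bddI p B ->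
  XC (fun q => (a q.1)%:C%C * p q.2) /\
  Xcsq (fun q => (a q.1)%:C%C * p q.2) <= B ^+ 2 * wsq leb setT g a.
Proof.
move=> La pB; have [m1 m2 bB] := pB.
have L0 : gL2 (fun=> 0).
  by apply: (wL2_bnd pg (B := 0)) => // w _; rewrite normr0.
have Lap : XC (fun q => (a q.1)%:C%C * p q.2).
  exact: (L2_strip_prod (m := fun w => (a w)%:C%C) pg La L0 pB).
split=> //; have /wL2E[_ La2] := La.
have one : wL1 leb I01 (cst 1) (cst (B ^+ 2)) := wL1_cst (unit_weight R) _.
rewrite (csqE pX Lap).2 mulrC -[B ^+ 2](wint_cst (unit_weight R)).
rewrite /wsq -(strip_prod_int pg La2 one); apply: (le_wint pX).
- exact: (csqE pX Lap).1.
- exact: (strip_prod_L1 pg La2 one).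
- move=> q [_ Iq]; rewrite csqr_normM /= -[csqr_norm (a q.1)%:C%C]normc_sqr normc_real real_normK ?num_real//.
  rewrite ler_wpM2l ?sqr_ge0// -normc_sqr lerXn2r ?nnegrE ?normc_ge0 ?bB//.
  by apply: le_trans (bB _ Iq); exact: normc_ge0.
Qed.

Lemma kdom_shift l Z : XC Z -> XC (fun q => ('i%C * q.1%:C%C - l) * Z q) -> kdom Z.
Proof.
move=> LZ LY; split=> //.
have := proj1 (L2Z pX (- 'i%C) (L2D pX LY (proj1 (L2Z pX l LZ)))).
congr L2; apply/funext => q.
rewrite (_ : - 'i%C * _ = - ('i%C ^+ 2) * (q.1%:C%C * Z q)).
  by rewrite sqr_i opprK mul1r.
ring.
Qed.

Section imaginary_axis.
Variable b : R.
Let l : R[i] := (0 +i* b)%C.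

Let res_re0 w : res_re 0 b w = 0. Proof. by rewrite /res_re !mul0r. Qed.

Let gL2_re : gL2 (fun w => complex.Re (mres l w)).
Proof.
by apply: (wL2_bnd pg (B := 0)); [case: (measurable_mres l)|move=> w _; rewrite /= res_re0 normr0].
Qed.

Let multiplier (a : R -> R) B F : measurable_fun setT a ->
  (forall w, `|a w * res_im 0 b w| <= B) -> XC F ->
  XC (fun q => mres l q.1 * ((a q.1)%:C%C * F q)).
Proof.
move=> ma aB LF.
have ma' : Xmeas (fun q : RR => (a q.1)%:C%C * mres l q.1).
  by apply: cmeasM (cmeas_mres l); apply: cmeas_real; exact: (measurable_strip_fst ma).
have [] // := L2_bM pX (B := B) ma' _ LF.
  move=> q _; have -> : (a q.1)%:C%C * mres l q.1 = (0 +i* (a q.1 * res_im 0 b q.1))%C.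
    by apply: complex_ext; rewrite ReImE /= res_re0; ring.
  apply: le_trans (aB q.1); apply: le_trans (normc_le _) _.
  by rewrite /= normr0 add0r.
by move=> + _; congr L2; apply/funext => q; ring.
Qed.

(** If [mres l] is square integrable the Ansatz [resv] applies to the cut-off of [F],
since [c] is purely imaginary.  If it is not, [Z1 = - mres l * F] solves the equation
up to [r = (K / 2) P Z1], which depends on [y] only; [Z2 = h * mres l * r] has
[P Z2 = 0] and removes all but [(1 - h) r]. *)
Lemma dense_range_csq F (e : R) : XC F -> 0 < e ->
  exists2 Z, kdom Z & Xcsq (fun q => F q - shift_op l Z q) <= e.
Proof.
move=> LF e0.
have e4 : 0 < e / 4 by rewrite divr_gt0.
have [n cn] := strip_cut_small b LF e4.
pose Fn (q : RR) := (cut b n q.1)%:C%C * F q.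
have mc := measurable_cut b n.
have LFn : XC Fn.
  apply: (proj1 (L2_bM pX (B := 1) _ _ LF)); first by apply: cmeas_real; exact: (measurable_strip_fst mc).
  by move=> q _; rewrite normc_real; case: (cut01 b n q.1) => ->; rewrite ?normr0 ?normr1.
have LFc : XC (fun q => (1 - cut b n q.1)%:C%C * F q).
  apply: (eq_L2 pX _ (L2B pX LF LFn)) => q _.
  by rewrite /Fn rmorphB mulrBl mul1r.
have LmF : XC (fun q => mres l q.1 * Fn q) := multiplier mc (cut_res_im b n) LF.
have [L2i|nL2i] := pselect (gL2 (res_im 0 b)).
  have inj : ckop_inj W (k2 * cint g (mres l)).
    move=> p C pC pE x Ix; apply/eqP/negPn/negP => px.
    by have [_ + _] := fix_real pC Ix px pE; rewrite eqxx.
  have [Z dZ [Z0 LZ0]] := resolvent_solve gL2_re L2i LFn LmF inj.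
  exists Z => //.
  have := csqD_le pX LFc LZ0; rewrite Z0 mulr0 addr0 => h.
  apply: le_trans (_ : 2 * (e / 4) <= e); last by lra.
  apply: le_trans (ler_wpM2l (ler0n _ 2) cn).
  apply: le_trans h; rewrite le_eqVlt; apply/orP; left; apply/eqP.
  by apply: eq_csq => q _; rewrite /Fn rmorphB; ring.
pose Z1 (q : RR) := - (mres l q.1 * Fn q).
have LZ1 : XC Z1 := L2N pX LmF.
pose r x := k2 * P Z1 x.
have rB := bddIZ k2 (P_bdd LZ1).
set B := normc k2 * _ in rB; rewrite -[fun x => _]/r in rB.
have B1 : 0 < B ^+ 2 + 1 by rewrite ltr_wpDl ?sqr_ge0.
have e4B : 0 < e / 4 / (B ^+ 2 + 1) by rewrite divr_gt0.
have [h [Bh [mh hB hb hi h1]]] := kernel_near1 nL2i e4B.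
pose hm w := (h w)%:C%C * mres l w.
have hm_re : gL2 (fun w => complex.Re (hm w)).
  apply: (wL2_bnd pg (B := 0)).
    rewrite (_ : (fun w => _) = cst 0); first exact: measurable_cst.
    by apply/funext => w; rewrite cReM /= res_re0; ring.
  by move=> w _; rewrite cReM /= res_re0 mulr0 mul0r subrr normr0.
have hm_imE w : complex.Im (hm w) = h w * res_im 0 b w.
  by rewrite cImM /=; ring.
have hm_im : gL2 (fun w => complex.Im (hm w)).
  apply: (wL2_bnd pg (B := Bh)).
    rewrite (_ : (fun w => _) = fun w => h w * res_im 0 b w); last exact/funext.
    by apply: measurable_funM => //; case: (measurable_mres l).
  by move=> w _; rewrite hm_imE; case: (hB w).
pose Z2 (q : RR) := hm q.1 * r q.2.
have LZ2 : XC Z2 := L2_strip_prod pg hm_re hm_im rB.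
have PZ2 x : I01 x -> P Z2 x = 0.
  move=> Ix; rewrite (cstrip_op_prod pg HW Ix hm_re hm_im rB).
  rewrite (_ : cint g hm = 0) ?mul0r//; apply: complex_ext => /=.
    rewrite -[RHS](wint_cst pg); congr wint; apply/funext => w.
    by rewrite res_re0 mulr0 mul0r subrr.
  by rewrite -[RHS]hi; congr wint; apply/funext => w; rewrite mul0r addr0.
have offE w : ('i%C * w%:C%C - l) * mres l w = - (offline l w)%:C%C.
  by rewrite -mresE; ring.
have off0 (a : R -> R) w : a b = 0 -> (offline l w)%:C%C * (a w)%:C%C = (a w)%:C%C.
  move=> ab; rewrite /offline /= eqxx /=; case: eqP => [->|_]; last by rewrite mul1r.
  by rewrite ab mulr0.
have s1 q : ('i%C * q.1%:C%C - l) * Z1 q = Fn q.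
  rewrite /Z1 mulrN mulrA offE mulNr opprK /Fn mulrA off0//; exact: cut_id.
have s2 q : ('i%C * q.1%:C%C - l) * Z2 q = - ((h q.1)%:C%C * r q.2).
  rewrite /Z2 /hm (_ : _ * _ = ('i%C * q.1%:C%C - l) * mres l q.1 * ((h q.1)%:C%C * r q.2)); last by ring.
  by rewrite offE mulNr mulrA off0.
have Lh : gL2 h by apply: (wL2_bnd pg (B := Bh)) => // w _; case: (hB w).
have dZ : kdom (fun q => Z1 q + Z2 q).
  apply: (@kdom_shift l); first exact: (L2D pX).
  have := L2B pX LFn (csq_strip_prod_le Lh rB).1; congr L2; apply/funext => q.
  by rewrite mulrDr s1 s2.
exists (fun q => Z1 q + Z2 q) => //.
have L1h : gL2 (fun w => 1 - h w).
  have L1 : gL2 (fun=> 1) by apply: (wL2_bnd pg (B := 1)) => // w _; rewrite normr1.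
  exact: (wL2B pg L1 Lh).
have [LE cE] := csq_strip_prod_le L1h rB.
have := csqD_le pX LFc (L2N pX LE); rewrite csqN => H.
apply: le_trans (_ : 2 * (e / 4) + 2 * (e / 4) <= e); last by lra.
have cE' := le_trans cE (_ : _ <= e / 4).
apply: le_trans (lerD (ler_wpM2l (ler0n _ 2) cn) (ler_wpM2l (ler0n _ 2) (cE' _))); last first.
  apply: le_trans (_ : (B ^+ 2 + 1) * _ <= _).
    by apply: ler_wpM2r; [exact: (wsq_ge0 pg)|rewrite lerDl].
  by rewrite mulrC -ler_pdivlMr.
apply: le_trans H; rewrite le_eqVlt; apply/orP; left; apply/eqP.
apply: eq_csq => q [_ Iq].
rewrite /shift_op (cstrip_opD pg HW Iq LZ1 LZ2) PZ2// mulrDr s1 s2 /Fn /r !rmorphB; ring.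
Qed.

End imaginary_axis.

Lemma dense_range_axis l : complex.Re l = 0 -> op_dense_range T l.
Proof.
move=> l0 F LF e e0; have LF' : XC F := LF.
have e2 : 0 < e ^+ 2 / 4 by rewrite divr_gt0// exprn_gt0.
have [Z dZ Zs] := dense_range_csq (complex.Im l) LF' e2.
have lE : (0 +i* complex.Im l)%C = l by apply: complex_ext.
rewrite lE in Zs.
exists Z => //; rewrite [ltLHS](_ : _ = L2norm leb2 SX gX (fun q => F q - shift_op l Z q)); last first.
  by apply: eq_L2norm => q Sq; rewrite shiftE//; case: dZ.
rewrite (L2normE pX (L2B pX LF' (shift_op_L2 l dZ))).
apply: le_lt_trans (_ : Num.sqrt (e ^+ 2 / 4) < e); first by rewrite ler_wsqrtr.
rewrite -[ltRHS]ger0_norm ?ltW// -sqrtr_sqr ltr_sqrt ?exprn_gt0//.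
have := exprn_gt0 2 e0; lra.
Qed.

(** * Zero is in the continuous spectrum *)

Let bump n w : R := 1 - cut 0 n w.

Let bump_id n w : bump n w * bump n w = bump n w.
Proof. by rewrite /bump; case: (cut01 0 n w) => ->; ring. Qed.

Let measurable_bump n : measurable_fun setT (bump n).
Proof. by apply: measurable_funB; [exact: measurable_cst|exact: measurable_cut]. Qed.

Let gL2_bump n : gL2 (bump n).
Proof. by apply: (wL2_bnd pg (B := 1) (measurable_bump n)) => w _; exact: cut_bnd. Qed.

Lemma gint_bump_gt0 n : 0 < gint (bump n).
Proof.
have g00 := density0_gt0 g_ge0 g_int1 g_cont g_even g_decr.
have [d /= d0 dP] : exists2 d : R, 0 < d & forall x, `|x| < d -> g 0 / 2 <= g x.
  have h2 : 0 < g 0 / 2 by rewrite divr_gt0.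
  have /cvgrPdist_lt/(_ _ h2)/nbhs_ballP[d /= d0 dB] : g y @[y --> 0] --> g 0 by exact: g_cont.
  exists d => // x xd; have := dB x; rewrite /ball /= sub0r normrN => /(_ xd).
  by rewrite ltr_norml => /andP[]; lra.
have n0 : 0 < n.+1%:R^-1 :> R by rewrite invr_gt0 ltr0n.
pose v := Num.min d n.+1%:R^-1 / 2.
have m0 : 0 < Num.min d n.+1%:R^-1 by rewrite lt_min d0.
have v0 : 0 < v by rewrite divr_gt0.
have vd : v < d by apply: lt_le_trans (_ : Num.min d n.+1%:R^-1 <= d); [rewrite /v; lra|rewrite ge_min lexx].
have vn : v < n.+1%:R^-1.
  by apply: lt_le_trans (_ : Num.min d n.+1%:R^-1 <= _); [rewrite /v; lra|rewrite ge_min lexx orbT].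
rewrite -lte_fin (wintE pg); last exact: (wL2_L1 pg (gL2_bump n)).
apply: lt_le_trans (_ : ((g 0 / 2 * (v - 0))%:E <= _)%E).
  by rewrite lte_fin subr0 mulr_gt0// divr_gt0.
apply: integral_ge_itv => //.
- by apply: measurable_funM => //; case: pg.
- by move=> x _; apply: mulr_ge0 => //; rewrite /bump; case: (cut01 0 n x) => ->; rewrite ?subrr ?subr0.
- by apply: divr_ge0 => //; exact: ltW.
- exact: ltW.
- move=> x /andP[x0 xv]; rewrite /bump /cut subr0 ger0_norm// ifF.
    by rewrite subr0 mul1r dP// ger0_norm//; exact: le_lt_trans vd.
  by apply/negbTE; rewrite -ltNge; exact: le_lt_trans vn.
Qed.

Lemma gint_bump_cvg : gint (bump n) @[n --> \oo] --> (0 : R).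
Proof.
have b0 : {ae leb, forall w : measurableTypeR R, setT w -> bump n w @[n --> \oo] --> (0 : R)}.
  exists [set 0]; split; [by []|exact: lebesgue_measure_set1|].
  move=> w /= h; apply: contrapT => /eqP w0; apply: h => _; exact: cut_cvg.
have L1 : gL2 (fun=> 1) by apply: (wL2_bnd pg (B := 1)) => // w _; rewrite normr1.
have := wsq_cutoff pg measurable_bump (fun n w _ => cut_bnd 0 n w) b0 L1.
rewrite (_ : (fun n => wsq _ _ _ _) = fun n => gint (bump n))//.
by apply/funext => n; congr wint; apply/funext => w; rewrite mulr1 expr2 bump_id.
Qed.

(** For the indicator [Z] of [|w| < 1 / n.+1], of squared norm [G], the squared norm of
[T Z] is at most [2 G / n.+1 ^ 2 + O(G ^ 2)], and [G] tends to [0]. *)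
Lemma zero_not_bounded : ~ op_bounded_inverse T 0.
Proof.
move=> [C CP].
pose B0 := normc k2 * (2 * M).
pose u n : R := n.+1%:R^-1.
pose G n := gint (bump n).
have bB : bddI (fun=> 1 : R[i]) 1.
  by split=> [||x _]; [exact: measurable_cst|exact: measurable_cst|rewrite Normc.normc1].
have key n : 1 <= C ^+ 2 * (2 * u n ^+ 2 + 2 * (B0 ^+ 2 * G n)).
  pose Z (q : RR) : R[i] := (bump n q.1)%:C%C * 1.
  have [LZ _] := csq_strip_prod_le (gL2_bump n) bB.
  have bL1 := wL2_L1 pg (gL2_bump n).
  have cZ : Xcsq Z = G n.
    have one : wL1 leb I01 (cst 1) (cst 1) := wL1_cst (unit_weight R) _.
    rewrite (csqE pX LZ).2 -[G n]mulr1 -[X in _ * X](wint_cst (unit_weight R)).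
    rewrite -(strip_prod_int pg bL1 one); congr wint; apply/funext => q.
    by rewrite mulr1 /= mulr1 /csqr_norm /= expr0n addr0 expr2 bump_id.
  have mZ : Xmeas (fun q => q.1%:C%C * Z q).
    apply: cmeasM (L2_cmeas LZ); apply: cmeas_real.
    exact: (measurable_strip_fst (@measurable_id _ _ setT)).
  have un0 : 0 < u n by rewrite invr_gt0 ltr0n.
  have [LwZ wZ] : XC (fun q => q.1%:C%C * Z q) /\
      Xcsq (fun q => q.1%:C%C * Z q) <= u n ^+ 2 * Xcsq Z.
    apply: (L2_le pX mZ LZ) => q _; rewrite csqr_normM -normc_sqr normc_real.
    rewrite /Z /bump /cut subr0; case: ifP => [_|/negbT].
      by rewrite subrr mul0r /csqr_norm /= expr0n addr0 !mulr0.
    rewrite -ltNge => h; apply: ler_wpM2r; first exact: csqr_norm_ge0.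
    by rewrite lerXn2r ?nnegrE// ltW.
  have dZ : kdom Z by [].
  have PZ x : I01 x -> normc (k2 * P Z x) <= B0 * G n.
    move=> Ix; have L0 : gL2 (fun=> 0).
      by apply: (wL2_bnd pg (B := 0)) => // w _; rewrite normr0.
    have -> : P Z x = (G n)%:C%C * ckop W (fun=> 1) x.
      rewrite (cstrip_op_prod (m := fun w => (bump n w)%:C%C) pg HW Ix (gL2_bump n) L0 bB).
      congr (_ * _); apply: complex_ext => //=; rewrite /wint.
      by under eq_Rintegral do rewrite mul0r; rewrite /Rintegral integral0.
    rewrite Normc.normcM Normc.normcM normc_real ger0_norm; last exact: ltW (gint_bump_gt0 n).
    rewrite /B0 -mulrA; apply: ler_wpM2l; first exact: normc_ge0.
    rewrite mulrC; apply: ler_wpM2r; first exact: ltW (gint_bump_gt0 n).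
    by have := ckop_bnd HW Ix bB; rewrite mulr1.
  have [pm1 pm2 _] := bddIZ k2 (P_bdd LZ).
  have kB : bddI (fun x => k2 * P Z x) (B0 * G n) by split.
  have [LkP kP] := L2_strip_snd kB.
  have [LiwZ iwZ] := L2Z pX 'i%C LwZ.
  have ni : normc ('i%C : R[i]) = 1 by rewrite /normc expr0n expr1n add0r sqrtr1.
  have cF : Xcsq (shift_op 0 Z) <= 2 * (u n ^+ 2 * G n) + 2 * (B0 * G n) ^+ 2.
    have := csqD_le pX LiwZ LkP.
    rewrite (_ : (fun q => _) = shift_op 0 Z); last by apply/funext => q; rewrite /shift_op subr0 mulrA.
    move/le_trans; apply; apply: lerD; apply: ler_wpM2l => //.
    by apply: le_trans iwZ _; rewrite ni expr1n mul1r -cZ.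
  have LF := shift_op_L2 0 dZ.
  have := CP Z dZ.
  have -> : op_norm T (op_shift T 0 Z) = L2norm leb2 SX gX (shift_op 0 Z).
    by apply: eq_L2norm => q Sq; rewrite shiftE.
  have -> : op_norm T Z = L2norm leb2 SX gX Z by [].
  rewrite (L2normE pX LZ) (L2normE pX LF) => h.
  have h2 : Xcsq Z <= C ^+ 2 * Xcsq (shift_op 0 Z).
    rewrite -[leLHS]sqr_sqrtr ?(csq_ge0 pX)// -[X in _ * X]sqr_sqrtr ?(csq_ge0 pX)// -exprMn.
    by rewrite lerXn2r ?nnegrE ?sqrtr_ge0// (le_trans _ h)// sqrtr_ge0.
  have G0 : 0 < G n := gint_bump_gt0 n.
  rewrite cZ in h2; have C2 : 0 <= C ^+ 2 by exact: sqr_ge0.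
  have := le_trans h2 (ler_wpM2l C2 cF).
  have -> : C ^+ 2 * (2 * (u n ^+ 2 * G n) + 2 * (B0 * G n) ^+ 2) =
    (C ^+ 2 * (2 * u n ^+ 2 + 2 * (B0 ^+ 2 * G n))) * G n by ring.
  by rewrite -{1}[G n]mul1r ler_pM2r.
have c0 : C ^+ 2 * (2 * u n ^+ 2 + 2 * (B0 ^+ 2 * G n)) @[n --> \oo] -->
    C ^+ 2 * (2 * (0 * 0) + 2 * (B0 ^+ 2 * 0)).
  apply: cvgM; first exact: cvg_cst.
  apply: cvgD; (apply: cvgM; first exact: cvg_cst).
    by apply: cvgM; exact: cvg_harmonic.
  by apply: cvgM; [exact: cvg_cst|exact: gint_bump_cvg].
have : 1 <= (0 : R).
  rewrite -(_ : C ^+ 2 * (2 * (0 * 0) + 2 * (B0 ^+ 2 * 0)) = 0); last by rewrite !(mulr0, addr0).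
  by apply: cvgr_to_ge c0 _; near=> n; exact: key.
by rewrite ler10.
Unshelve. all: end_near. Qed.

Lemma zero_continuous_spectrum : continuous_spectrum T 0.
Proof.
split; [by move=> [_]; exact: zero_not_bounded| |exact: dense_range_axis].
move=> /point_spectrum_fix[p [C [x0 [pC Ix0 px0 pE]]]].
by have [_ + _] := fix_real pC Ix0 px0 pE; rewrite eqxx.
Qed.

(** An eigenvector contradicts the bound on the inverse. *)
Lemma point_spectrum_spectrum : point_spectrum T `<=` spectrum T.
Proof.
move=> l [Z [dZ nZ sZ]] [_ [C CP]]; move/negP: nZ; apply.
rewrite eq_le; apply/andP; split; last exact: sqrtr_ge0.
by have := CP Z dZ; rewrite sZ mulr0.
Qed.

Lemma spectrum_decomposition :
  spectrum T = continuous_spectrum T `|` point_spectrum T.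
Proof.
apply/seteqP; split=> [l ls|l [[]//|]]; last exact: point_spectrum_spectrum.
have [lp|nlp] := pselect (point_spectrum T l); first by right.
left; split=> //; apply: dense_range_axis; apply/eqP/negPn/negP => l0.
by apply: ls; exact: resolvent_off_axis.
Qed.

Lemma continuous_spectrum_axis : continuous_spectrum T `<=` [set l | complex.Re l = 0].
Proof.
move=> l [ls nlp _]; apply/eqP/negPn/negP => l0.
by apply: ls; exact: resolvent_off_axis.
Qed.

End kuramoto_spectrum.

(** * The critical interval *)

Section critical_coupling.
Context (R : realType) (g : R -> R) (W : R -> R -> R) (K M L : R).
Local Notation leb := (@lebesgue_measure R).
Local Notation I01 := (@unitI R).
Hypothesis g00 : 0 < g 0.
Hypothesis HW : lip_kernel W M L.

Lemma lip_kernelN : lip_kernel (fun x y => - W x y) M L.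
Proof.
case: HW => M0 L0 WM WL Ws; split=> //.
- by move=> x y Ix Iy; rewrite normrN WM.
- by move=> x x' y Ix Ix' Iy; rewrite -opprD normrN WL.
- by move=> x y Ix Iy; rewrite Ws.
Qed.

Lemma keigN (V : R -> R -> R) z : lip_kernel V M L -> keig V z -> keig (fun x y => - V x y) (- z).
Proof.
move=> HV [p [C [x0 [pC Ix0 px0 pE]]]]; exists p, C, x0; split=> // x Ix.
rewrite mulNr -pE// -[RHS]mulN1r -(kopZ HV _ Ix (lipI_L1 pC)) /kop.
by congr wint; apply/funext => y; ring.
Qed.

Lemma pos_eigenvaluesE z : pos_eigenvalues W z <-> 0 < z /\ keig W z.
Proof.
split=> -[z0] /=; split=> //; first by apply/(graphon_point_spectrum HW); rewrite ?gt_eqF.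
by apply/(graphon_point_spectrum HW); rewrite ?gt_eqF.
Qed.

Lemma neg_eigenvaluesE z : neg_eigenvalues W z <-> z < 0 /\ keig W z.
Proof.
split=> -[z0] /=; split=> //; first by apply/(graphon_point_spectrum HW); rewrite ?lt_eqF.
by apply/(graphon_point_spectrum HW); rewrite ?lt_eqF.
Qed.

Lemma xi_max_spec : pos_eigenvalues W !=set0 ->
  [/\ 0 < xi_max W, keig W (xi_max W) & forall z, 0 < z -> keig W z -> z <= xi_max W].
Proof.
move=> [z /pos_eigenvaluesE[z0 kz]].
have [y [y0 ky ymax]] : exists y, [/\ 0 < y, keig W y & forall z, 0 < z -> keig W z -> z <= y].
  by apply: (keig_max HW); exists z.
have /(xgetI 0)[/pos_eigenvaluesE[x0 kx] xmax] : (pos_eigenvalues W `&` ubound (pos_eigenvalues W)) y.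
  by split; [exact/pos_eigenvaluesE|move=> u /pos_eigenvaluesE[u0 ku]; exact: ymax].
by split=> // u u0 ku; apply: xmax; apply/pos_eigenvaluesE.
Qed.

(** The negative eigenvalues of [W] are the opposites of the positive ones of [- W]. *)
Lemma xi_min_spec : neg_eigenvalues W !=set0 ->
  [/\ xi_min W < 0, keig W (xi_min W) & forall z, z < 0 -> keig W z -> xi_min W <= z].
Proof.
move=> [z /neg_eigenvaluesE[z0 kz]].
have WNN : (fun x y => - - W x y) = W by apply/funext => x; apply/funext => y; rewrite opprK.
have [|y [y0 ky ymax]] := keig_max lip_kernelN.
  by exists (- z); [rewrite oppr_gt0|exact: keigN].
have /(xgetI 0)[/neg_eigenvaluesE[x0 kx] xmin] :
    (neg_eigenvalues W `&` lbound (neg_eigenvalues W)) (- y).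
  split; first by apply/neg_eigenvaluesE; split; [rewrite oppr_lt0|rewrite -WNN; exact: keigN lip_kernelN _].
  move=> u /neg_eigenvaluesE[u0 ku]; rewrite lerNl; apply: ymax; first by rewrite oppr_gt0.
  exact: keigN.
by split=> // u u0 ku; apply: xmin; apply/neg_eigenvaluesE.
Qed.

(** For [K > 0] only positive [z] matter and the largest one decides; for [K < 0]
only negative [z] matter and the smallest one decides. *)
Lemma Kc_rangeP : (Kc_minus g W <= K%:E <= Kc_plus g W)%E <->
  forall z, z != 0 -> keig W z -> K * z <= 2 / (pi * g 0).
Proof.
have c0 : 0 < 2 / (pi * g 0) by rewrite divr_gt0// mulr_gt0// pi_gt0.
have p0 : pi * g 0 != 0 :> R by rewrite gt_eqF// mulr_gt0// pi_gt0.
split.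
  move=> /andP[Km Kp] z z0 kz.
  have [zp|zn] : 0 < z \/ z < 0.
    by move: z0; rewrite neq_lt => /orP[]; [right|left].
    have ne : pos_eigenvalues W !=set0 by exists z; apply/pos_eigenvaluesE.
    have [x0 kx xmax] := xi_max_spec ne.
    move: Kp; rewrite /Kc_plus; case: pselect => [p|//]; rewrite lee_fin.
    rewrite invfM mulrA ler_pdivlMr// => Kp.
    have [K0|K0] := leP K 0; first by apply: le_trans (ltW c0); rewrite mulr_le0_ge0// ltW.
    by apply: le_trans Kp; rewrite ler_wpM2l ?(ltW K0)//; exact: xmax.
  have ne : neg_eigenvalues W !=set0 by exists z; apply/neg_eigenvaluesE.
  have [x0 kx xmin] := xi_min_spec ne.
  move: Km; rewrite /Kc_minus; case: pselect => [p|//]; rewrite lee_fin.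
  rewrite invfM mulrA ler_ndivrMr// => Km.
  have [K0|K0] := leP 0 K; first by apply: le_trans (ltW c0); rewrite mulr_ge0_le0// ltW.
  by apply: le_trans Km; rewrite ler_wnM2l ?(ltW K0)//; exact: xmin.
move=> H; apply/andP; split.
  rewrite /Kc_minus; case: pselect => [ne|ne]; last by rewrite leNye.
  have [x0 kx _] := xi_min_spec ne.
  by rewrite lee_fin invfM mulrA ler_ndivrMr//; apply: H; rewrite ?lt_eqF.
rewrite /Kc_plus; case: pselect => [ne|ne]; last by rewrite leey.
have [x0 kx _] := xi_max_spec ne.
by rewrite lee_fin invfM mulrA ler_pdivlMr//; apply: H; rewrite ?gt_eqF.
Qed.

End critical_coupling.

(** A Lipschitz bound in the pair gives one in each variable, and on the bounded
square also a bound. *)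
Lemma lipschitz_kernel (R : realType) (W : R -> R -> R) :
  (forall x y, unitI x -> unitI y -> W x y = W y x) ->
  [lipschitz W p.1 p.2 | p in @unitI R `*` @unitI R] -> exists M L, lip_kernel W M L.
Proof.
move=> Ws /pinfty_ex_gt0[L L0 WL].
have H x x' y : unitI x -> unitI x' -> unitI y -> `|W x y - W x' y| <= L * `|x - x'|.
  move=> Ix Ix' Iy; have := WL ((x, y), (x', y)) (conj (conj Ix Iy) (conj Ix' Iy)).
  by move=> /le_trans; apply; rewrite ler_wpM2l ?(ltW L0)//= prod_normE /= subrr normr0 ge_max lexx normr_ge0.
have I0 : unitI (0 : R) by apply/unitIP; rewrite lexx ler01.
have H2 x y : unitI x -> unitI y -> `|W x y| <= `|W 0 0| + 2 * L.
  move=> Ix Iy.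
  have a1 := H _ _ _ Ix I0 Iy; have a2 := H _ _ _ Iy I0 I0.
  rewrite (Ws 0 y)// subr0 in a1; rewrite subr0 in a2.
  have l1 (u : R) : unitI u -> L * `|u| <= L.
    by move=> /unitIP/andP[u0 u1]; rewrite ger0_norm// -[leRHS]mulr1 ler_wpM2l// ltW.
  have := l1 x Ix; have := l1 y Iy => b1 b2.
  have -> : W x y = (W x y - W y 0) + ((W y 0 - W 0 0) + W 0 0) by ring.
  apply: le_trans (ler_normD _ _) _; have := ler_normD (W y 0 - W 0 0) (W 0 0); lra.
exists (`|W 0 0| + 2 * L), L; split=> //.
- by rewrite addr_ge0// mulr_ge0// ltW.
- exact: ltW.
Qed.

(** * Positive eigenvalues and the theorem *)

Section main.
Context (R : realType) (g : R -> R) (W : R -> R -> R) (K M L : R).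
Hypothesis g_ge0 : forall w, 0 <= g w.
Hypothesis g_int1 : (\int[@lebesgue_measure R]_(w in setT) (g w)%:E = 1)%E.
Hypothesis g_cont : continuous g.
Hypothesis g_even : forall w, g (- w) = g w.
Hypothesis g_decr : forall a b : R, 0 < a -> a <= b -> g b <= g a.
Hypothesis HW : lip_kernel W M L.
Local Notation leb := (@lebesgue_measure R).
Local Notation gint := (wint leb setT g).
Let p0 : 0 < pi * g 0 :> R.
Proof. by rewrite mulr_gt0 ?pi_gt0// (density0_gt0 g_ge0). Qed.

Lemma wint_res_im0 a : a != 0 -> gint (res_im a 0) = 0.
Proof.
move=> a0; have [_ If] := wL1_res_im g_ge0 g_int1 g_cont 0 a0.
have : gint (res_im a 0) = - gint (res_im a 0); last by lra.
rewrite {1}/wint (Rintegral_reflect 0 If) -mulN1r.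
rewrite -(wintZ (density_weight g_ge0 g_int1 g_cont)); last exact: wL1_res_im.
apply: eq_Rintegral => w _; rewrite sub0r g_even /res_im !subr0 sqrrN; ring.
Qed.

(** Solve [I(a) = 2 / (K z)]; the imaginary part of [c] vanishes by evenness. *)
Lemma positive_eigenvalue z : z != 0 -> keig W z -> 2 / (pi * g 0) < K * z ->
  exists2 r : R, 0 < r & point_spectrum (kuramoto_op g W K) r%:C%C.
Proof.
move=> z0 kz zK.
have Kz : 0 < K * z by apply: lt_trans zK; rewrite divr_gt0.
have [||a a0 aE] := wint_res_re_ivt g_ge0 g_int1 g_cont g_even g_decr (t := 2 / (K * z)).
- by rewrite divr_gt0.
- by rewrite ltr_pdivrMr// mulrC -ltr_pdivrMr.
exists a => //; have an0 : a != 0 by rewrite gt_eqF.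
have [p [C [x0 [pC Ix0 px0 pE]]]] := keig_ckop HW z0 kz.
have Kn0 : K != 0 by apply: contraTneq Kz => ->; rewrite mul0r ltxx.
apply: (@fix_point_spectrum _ _ _ K _ _ g_ge0 g_int1 g_cont HW a%:C%C p C x0 an0 pC Ix0 px0) => x Ix.
rewrite pE//; congr (_ * _).
apply: complex_ext; rewrite ?Re_fix ?Im_fix /=.
  by rewrite aE; field; rewrite z0 Kn0.
by rewrite wint_res_im0// mulr0.
Qed.

(** A real [l > 0] would give [K z = 2 / I(l) > 2 / (pi g(0))]. *)
Lemma subcritical_eigenvalues : (forall z, z != 0 -> keig W z -> K * z <= 2 / (pi * g 0)) ->
  point_spectrum (kuramoto_op g W K) `<=` [set l | exists2 r : R, r < 0 & l = r%:C%C].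
Proof.
move=> sub l /(point_spectrum_fix g_ge0 g_int1 g_cont HW)[p [C [x0 [pC Ix0 px0 pE]]]].
have [lE l0 [z [z0 kz zE]]] := fix_real g_ge0 g_int1 g_cont g_even g_decr HW pC Ix0 px0 pE.
exists (complex.Re l) => //; rewrite lt_neqAle l0 leNgt; apply/negP => lpos.
have I1 := wint_res_re_lt g_ge0 g_int1 g_cont g_even g_decr lpos.
have I0 := wint_res_re_ge0 g_ge0 g_int1 g_cont 0 (ltW lpos).
have := sub _ z0 kz; rewrite ler_pdivlMr//; apply/negP; rewrite -ltNge.
set J := gint _ in zE I1 I0.
have Kz : 0 < K * z.
  by rewrite ltNge; apply/negP => h; have := zE; nra.
nra.
Qed.

End main.

Theorem theorem3p4 (R : realType) (g : R -> R) (W : R -> R -> R) (K : R)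
  (g_ge0 : forall w, 0 <= g w)
  (g_int1 : (\int[@lebesgue_measure R]_(w in setT) (g w)%:E = 1)%E)
  (g_cont : continuous g)
  (g_even : forall w, g (- w) = g w)
  (g_decr : forall a b : R, 0 < a -> a <= b -> g b <= g a)
  (W_sym : forall x y, unitI x -> unitI y -> W x y = W y x)
  (W_lip : [lipschitz W p.1 p.2 | p in @unitI R `*` @unitI R]) :
  ((Kc_minus g W <= K%:E <= Kc_plus g W)%E ->
    [/\ spectrum (kuramoto_op g W K) =
          continuous_spectrum (kuramoto_op g W K)
            `|` point_spectrum (kuramoto_op g W K),
        continuous_spectrum (kuramoto_op g W K) !=set0,
        continuous_spectrum (kuramoto_op g W K)
          `<=` [set l | complex.Re l = 0]
      & point_spectrum (kuramoto_op g W K)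
          `<=` [set l | exists2 r : R, r < 0 & l = r%:C%C] ])
  /\ (~ (Kc_minus g W <= K%:E <= Kc_plus g W)%E ->
    exists2 r : R, 0 < r & point_spectrum (kuramoto_op g W K) r%:C%C).
Proof.
have [M [L HW]] := lipschitz_kernel W_sym W_lip.
have g00 := density0_gt0 g_ge0 g_int1 g_cont g_even g_decr.
split=> [/(Kc_rangeP K g00 HW) sub|nr].
  split.
  - exact: (spectrum_decomposition K g_ge0 g_int1 g_cont g_even g_decr HW).
  - by exists 0; exact: (zero_continuous_spectrum K g_ge0 g_int1 g_cont g_even g_decr HW).
  - exact: (continuous_spectrum_axis g_ge0 g_int1 g_cont HW).
  - exact: (subcritical_eigenvalues g_ge0 g_int1 g_cont g_even g_decr HW).
have [[z [z0 kz zK]]|H] := pselect (exists z, [/\ z != 0, keig W z & 2 / (pi * g 0) < K * z]).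
  exact: (positive_eigenvalue g_ge0 g_int1 g_cont g_even g_decr HW z0 kz zK).
case: nr; apply/(Kc_rangeP K g00 HW) => z z0 kz; rewrite leNgt; apply/negP => zK.
by apply: H; exists z.
Qed.
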